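(* Let $d\ge 1$, let $R\subset\mathbb{R}^d$ be a bounded convex region with non-empty interior, and let $\omega_1,\ldots,\omega_d\in\mathbb{R}$ be such that $1,\omega_1,\ldots,\omega_d$ form a $\mathbb{Q}$-basis for an algebraic number field $\Phi\subset\mathbb{R}$. Let $r\ge 1$ denote the rank of the unit group $\mathbb{Z}_\Phi^\times$. For $t\ge1$ let $M(t)$ and the spacings $\delta_i(t)$, $1\le i\le|M(t)|-1$, be as defined in the context. Then there exists a finite set $\mathcal{R}=\{r_1,\ldots,r_J\}\subset\Phi$ (with $r_1,\ldots,r_J$ distinct) such that the following hold. (1) (Uniform set of ratios) For every $t>1$ the ratios of neighboring spacings satisfy $$\rho_i(t):=\frac{\delta_i(t)}{\delta_{i-1}(t)}\in\mathcal{R}\qquad\text{for } 2\le i\le|M(t)|-1.$$ (2) (Quasiperiodicity) For $1\le j\le J$ let $p_j(t)$ denote the proportion of the ratios of neighboring spacings $\rho_i(t)$, $2\le i\le|M(t)|-1$, such that $\rho_i(t)=r_j$. Then there are an integer $0\le k\le d+1$, a Lipschitz continuous function $$h:\mathbb{T}^k\times[0,1]^r\to P:=\Bigl\{(p_1,\ldots,p_J):\ \textstyle\sum_j p_j=1,\ p_j\ge 0\Bigr\},$$ angles $\boldsymbol{\theta}=(\theta_1,\ldots,\theta_k)\in\mathbb{R}^k$, rates $\boldsymbol{\beta}=(\beta_1,\ldots,\beta_r)\in\mathbb{R}^r$, and $0<\alpha<1$ such that, as $t\to\infty$, $$(p_1(t),\ldots,p_J(t)) = h\bigl(\boldsymbol{\theta}\log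 t,\ \{\boldsymbol{\beta}\log t\}\bigr)+\mathcal{O}(\alpha^{\log t}).$$
   Context: For $t\ge1$, $R(t)=\{t\boldsymbol{v}:\boldsymbol{v}\in R\}$ is the homothetic dilation of $R$ about the origin by a factor of $t$, and $M(t)=R(t)\cap\mathbb{Z}^d$. Write $\boldsymbol{\omega}=(\omega_1,\ldots,\omega_d)$ and $\{x\}$ for the fractional part of a real number $x$. The elements of $Y(t)=\{\{\boldsymbol{m}\cdot\boldsymbol{\omega}\}:\boldsymbol{m}\in M(t)\}$ are written in increasing order as $0\le y_1(t)\le\cdots\le y_{|M(t)|}(t)<1$, and the spacings are $\delta_i(t)=y_{i+1}(t)-y_i(t)$ for $1\le i\le|M(t)|-1$. $\mathbb{Z}_\Phi$ is the ring of integers of $\Phi$ and $\mathbb{Z}_\Phi^\times$ its group of units. $\mathbb{T}=\mathbb{R}/\mathbb{Z}$; the vector $\boldsymbol{\theta}\log t\in\mathbb{R}^k$ is reduced modulo $\mathbb{Z}^k$ to give a point of $\mathbb{T}^k$, and $\{\boldsymbol{\beta}\log t\}:=(\{\beta_1\log t\},\ldots,\{\beta_r\log t\})\in[0,1]^r$. The error term $\mathcal{O}(\cdot)$ for vectors is understood componentwise. *)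

(* Defs.v *)
From HB Require Import structures.
From mathcomp Require Import all_boot all_order all_algebra all_field.
From mathcomp Require Import finmap generic_quotient.
From mathcomp Require ring_quotient.
From mathcomp Require Import all_classical all_reals all_analysis.

Set Implicit Arguments.
Unset Strict Implicit.
Unset Printing Implicit Defensive.

Import Order.TTheory GRing.Theory Num.Theory.
Import numFieldNormedType.Exports.

Local Open Scope classical_set_scope.
Local Open Scope ring_scope.

Definition frac_part (R : realType) (x : R) : R := x - (Num.floor x)%:~R.

Section UnitGroup.
Variable Phi : fieldExtType rat.

Definition algebraic_integers : set Phi :=
  [set x | integralOver (intr : int -> Phi) x].

Definition algebraic_units : set Phi :=
  [set u | algebraic_integers u /\
           exists2 v, algebraic_integers v & u * v = 1].

Definition mult_independent (n : nat) (u : 'I_n -> Phi) :=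
  forall e : 'I_n -> int, \prod_i u i ^ e i = 1 -> forall i, e i = 0.

(* The rank of an abelian group is the maximal size of a Z-linearly
   independent family; here the group law is multiplicative. *)
Definition has_unit_rank (r : nat) :=
  (exists u : 'I_r -> Phi,
     (forall i, algebraic_units (u i)) /\ mult_independent u) /\
  (forall (n : nat) (u : 'I_n -> Phi),
     (forall i, algebraic_units (u i)) -> mult_independent u -> (n <= r)%N).

End UnitGroup.

Section Spacings.
Variables (R : realType) (d : nat) (K : set 'rV[R]_d) (omega : 'rV[R]_d).

Definition dilation (t : R) : set 'rV[R]_d := [set t *: v | v in K].

Definition lattice_points (t : R) : set 'rV[int]_d :=
  [set m | dilation t (map_mx intr m)].

(* [fset_set A] is A itself when A is finite (the case of interest, K being
   bounded) and is empty otherwise. *)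
Definition lattice_fset (t : R) : {fset 'rV[int]_d} :=
  fset_set (lattice_points t).

Definition npoints (t : R) : nat := #|` lattice_fset t|.

Definition dot_omega (m : 'rV[int]_d) : R :=
  \sum_(i < d) (m 0 i)%:~R * omega 0 i.

Definition frac_points (t : R) : seq R :=
  sort <=%R [seq frac_part (dot_omega m) | m <- lattice_fset t].

(* In the next three definitions indices start at 1. *)
Definition frac_point (t : R) (i : nat) : R := nth 0 (frac_points t) i.-1.

Definition spacing (t : R) (i : nat) : R :=
  frac_point t i.+1 - frac_point t i.

Definition spacing_ratio (t : R) (i : nat) : R :=
  spacing t i / spacing t i.-1.

(* [index_iota 2 n] enumerates 2 <= i <= n - 1. The value is 0 when there is
   no ratio at all, which can only happen for small t. *)
Definition ratio_proportion (t : R) (x : R) : R :=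
  (count (fun i => spacing_ratio t i == x) (index_iota 2 (npoints t)))%:R
    / (size (index_iota 2 (npoints t)))%:R.

End Spacings.

(* The quotient group R / Z. *)
Definition circle (R : realType) :=
  ring_quotient.Quotient.quot
    (GRing.ZmodClosed.clone R (@Num.int_num_subdef R) _).

Section TorusCube.
Variable R : realType.

Definition to_circle (x : R) : circle R := \pi_(circle R)%qT x.

Definition circle_dist (a b : circle R) : R :=
  inf [set e | exists x y : R,
         [/\ to_circle x = a, to_circle y = b & e = `|x - y|]].

Definition unit_cube (r : nat) : set 'rV[R]_r :=
  [set y | forall i, 0 <= y 0 i <= 1].

Definition prob_simplex (J : nat) : set 'rV[R]_J :=
  [set p | \sum_(j < J) p 0 j = 1 /\ forall j, 0 <= p 0 j].

(* Lipschitz continuity on T^k x [0,1]^r, for the sum metric on the source and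
   the sup metric on the target. *)
Definition lipschitz_torus_cube (k r J : nat)
    (h : ('I_k -> circle R) -> 'rV[R]_r -> 'rV[R]_J) :=
  exists L : R, forall (x x' : 'I_k -> circle R) (y y' : 'rV[R]_r),
    unit_cube y -> unit_cube y' -> forall j,
    `|h x y 0 j - h x' y' 0 j| <=
      L * (\sum_(i < k) circle_dist (x i) (x' i)
           + \sum_(i < r) `|y 0 i - y' 0 i|).

End TorusCube.

(* Main.v *)
Require Import Defs.
From HB Require Import structures.
From mathcomp Require Import all_boot all_order all_algebra all_field.
From mathcomp Require Import finmap generic_quotient complex.
From mathcomp Require Import zify ring lra.
From mathcomp Require Import all_classical all_reals all_analysis.
Set Implicit Arguments.
Unset Strict Implicit.
Unset Printing Implicit Defensive.

Import Order.TTheory GRing.Theory Num.Theory.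
Import numFieldNormedType.Exports.
Local Open Scope classical_set_scope.
Local Open Scope ring_scope.

(** Write [M] for the lattice spanned in [Phi] by [1] and the entries of [w], and
    [a x] for the coordinates of [x] in [M] other than the coordinate along [1].
    Seen from the point of the circle attached to [m], the next point is
    reached by the element [x] of [M] with the least value [emb x > 0] such
    that [m + a x] still lies in the dilated set, and the previous one by the
    least [x] such that [m - a x] does ([gap_exists]). The spacings are thus
    values of [emb], of order [t ^- d], on elements whose other conjugates are
    of order [t].

    Units renormalise this picture. Let [u t] be a unit preserving [M] all of
    whose conjugates but the distinguished one have size about [t]; the norm
    being one, [emb (u t)] is about [t ^- d]. Dividing a gap by [u t] leaves an
    element of [M] with bounded conjugates, one of finitely many candidates
    that do not depend on [t] ([gap_candidates]). The unit cancels in the ratio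
    of two consecutive gaps, whence the finite set of ratios.

    The units come from the argument behind Dirichlet's unit theorem. Elements
    of [M] given by simultaneous approximation have bounded norm, and two of
    them that are congruent modulo a suitable integer have a unit as quotient
    ([lattice_unit_of_size]). So there are units arbitrarily far out whose
    logarithms are within bounded distance of the line through
    [(1, ..., 1)], and this vector lies in the real span of the logarithms of
    units ([log_units_span]). By the definition of the rank, [r] units
    [eps_l] suffice to span; rounding down the real exponents [beta_l * ln t]
    gives [u t], and [sigma_i (u t) / t] becomes an explicit function of the
    fractional parts of the [beta_l * ln t] and of an angle linear in [ln t]
    ([unit_flow]).

    Which candidates are the gaps at [m] depends only on the set of the
    translates of [m / t] by vectors [a (u t * v) / t] or their opposites, for
    candidates [v], that lie in [K]. The proportion of lattice points showing a
    given membership pattern converges at speed [1 / t] to a limit that is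
    Lipschitz in the translation vectors ([pattern_frequency]). Both facts,
    which bypass volumes, rest on one observation: displacing points slightly
    changes their membership in a convex set only near the two ends of each
    line parallel to an axis ([convex_exchange]). The function [h] is this
    limit composed with the translation vectors, seen as Lipschitz functions
    on the torus and the cube ([flow_shift_lip], [flow_shift_approx]); the
    error [1 / t] is the power [ln t] of [alpha = exp (-1)]. *)

(** * Multiplication matrices and the diagonalisation of a number field *)

Section MulMatrix.
Variables (Phi : fieldExtType rat) (n : nat) (b : n.+1.-tuple Phi).

Definition coords (y : Phi) : 'cV[rat]_n.+1 := \col_k coord b k y.

(** The columns are the coordinates of the products [x * b_j], so that the rows
    [(sigma b_0, ..., sigma b_n)] are left eigenvectors. *)
Definition mulmat (x : Phi) : 'M[rat]_n.+1 :=
  \matrix_(k, j) coord b k (x * tnth b j).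

Hypothesis hb : basis_of fullv b.

Lemma coords_sum y : y = \sum_k coords y k 0 *: tnth b k.
Proof.
rewrite {1}(coord_basis hb (memvf y)); apply: eq_bigr => k _.
by rewrite mxE (tnth_nth 0).
Qed.

Lemma coords_inj : injective coords.
Proof. by move=> x y e; rewrite (coords_sum x) (coords_sum y) e. Qed.

Lemma coordsM x y : coords (x * y) = mulmat x *m coords y.
Proof.
apply/matrixP => k j; rewrite ord1 !mxE {1}(coords_sum y) mulr_sumr linear_sum /=.
apply: eq_bigr => l _; rewrite -scalerAr linearZ /= !mxE mulrC.
by [].
Qed.

Lemma coordsN x : coords (- x) = - coords x.
Proof. by apply/matrixP => k j; rewrite !mxE linearN. Qed.

Lemma coords_basis j : coords (tnth b j) = delta_mx j 0.
Proof.
apply/matrixP => k l; rewrite ord1 !mxE (tnth_nth 0) coord_free ?andbT 1?eq_sym //.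
exact: (basis_free hb).
Qed.

Lemma mulmatE x k j : mulmat x k j = coords (x * tnth b j) k 0.
Proof. by rewrite !mxE. Qed.

Lemma mulmatM x y : mulmat (x * y) = mulmat x *m mulmat y.
Proof.
apply/matrixP => k j; rewrite mulmatE -mulrA coordsM !mxE.
by apply: eq_bigr => l _; rewrite !mxE.
Qed.

Lemma mulmatD x y : mulmat (x + y) = mulmat x + mulmat y.
Proof. by apply/matrixP => k j; rewrite !mxE mulrDl linearD. Qed.

Lemma mulmatZ a x : mulmat (a *: x) = a *: mulmat x.
Proof. by apply/matrixP => k j; rewrite !mxE -scalerAl linearZ. Qed.

Lemma mulmat1 : mulmat 1 = 1%:M.
Proof.
by apply/matrixP => k j; rewrite mulmatE mul1r coords_basis !mxE andbT.
Qed.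

Lemma mulmatV x : x != 0 -> mulmat x *m mulmat x^-1 = 1%:M.
Proof. by move=> x0; rewrite -mulmatM divff // mulmat1. Qed.

Lemma det_mulmat_neq0 x : x != 0 -> \det (mulmat x) != 0.
Proof.
move=> x0; apply/eqP => d0; move/(congr1 determinant): (mulmatV x0).
by rewrite det_mulmx d0 mul0r det1 => /eqP; rewrite eq_sym oner_eq0.
Qed.

Lemma mulmat_horner (p : {poly rat}) x :
  mulmat (map_poly (GRing.in_alg Phi) p).[x] = horner_mx (mulmat x) p.
Proof.
elim/poly_ind: p => [|p c IHp].
  by rewrite !rmorph0 horner0; apply/matrixP => k j; rewrite !mxE mul0r linear0.
rewrite !rmorphD !rmorphM /= map_polyX map_polyC /= hornerMXaddC mulmatD mulmatM IHp.
by rewrite horner_mx_X horner_mx_C mulmatZ mulmat1 scalemx1.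
Qed.

Section Embeddings.
Variable C : numClosedFieldType.

Local Notation A x := (map_mx (ratr : rat -> C) (mulmat x)).

(** In characteristic zero minimal polynomials are separable, so a
    multiplication matrix has a minimal polynomial with simple roots. *)
Lemma mulmat_diagonalizable x : exists2 P : 'M[C]_n.+1, P \in unitmx & similar_diag P (A x).
Proof.
have [p Dp] := polyOver1P (minPolyOver 1%AS x).
have p0 : p != 0.
  apply: contraTneq (monic_minPoly 1%AS x) => p0.
  by rewrite Dp p0 rmorph0 monicE lead_coef0 eq_sym oner_eq0.
have sepp : separable_poly p.
  rewrite -(separable_map (GRing.in_alg Phi)) -Dp.
  apply: pcharf0_separable => q; apply/negP => /andP[q_pr].
  rewrite -(rmorph_nat (GRing.in_alg Phi)) fmorph_eq0 pnatr_eq0 => /eqP q0.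
  by rewrite q0 in q_pr.
apply/diagonalizableP.
have [s Ds] := closed_field_poly_normal (map_poly (ratr : rat -> C) p).
have lc0 : lead_coef (map_poly (ratr : rat -> C) p) != 0.
  by rewrite lead_coef_eq0 map_poly_eq0.
exists s.
  have : separable_poly (map_poly (ratr : rat -> C) p) by rewrite separable_map.
  rewrite -separable_prod_XsubC Ds.
  by rewrite !separable.separable_poly.unlock derivZ coprimepZl // coprimepZr.
rewrite -(dvdpZr _ _ lc0) -Ds; apply: mxminpoly_min.
rewrite -map_horner_mx -mulmat_horner -Dp.
have /eqP -> := root_minPoly 1%AS x.
by apply/matrixP => k j; rewrite !mxE mul0r linear0 rmorph0.
Qed.

Lemma mulmat_codiagonalizable : exists2 P : 'M[C]_n.+1, P \in unitmx &
  exists D : Phi -> 'rV[C]_n.+1, forall x, P *m A x = diag_mx (D x) *m P.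
Proof.
have [|P Pu /allP PA] := (@codiagonalizableP C n.+1 [seq A (tnth b j) | j <- enum 'I_n.+1]).1.
  split=> [f g /mapP[i _ ->] /mapP[j _ ->]|f /mapP[i _ ->]].
    by rewrite /comm_mx -!map_mxM -!mulmatM mulrC.
  exact: mulmat_diagonalizable.
exists P => //.
have /choice[D0 DP] j : exists D : 'rV[C]_n.+1, P *m A (tnth b j) = diag_mx D *m P.
  have /PA /= /(similar_diagLR Pu)[D ->] : A (tnth b j) \in [seq A (tnth b j) | j <- enum 'I_n.+1].
    by apply/mapP; exists j; rewrite ?mem_enum.
  by exists D; rewrite conjVmx // !mulmxA mulmxV // mul1mx.
exists (fun x => \sum_j (ratr (coords x j 0) : C) *: D0 j) => x.
have -> : A x = \sum_j (ratr (coords x j 0) : C) *: A (tnth b j).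
  rewrite {1}(coords_sum x).
  have -> : mulmat (\sum_j coords x j 0 *: tnth b j)
            = \sum_j coords x j 0 *: mulmat (tnth b j).
    apply/matrixP => k l; rewrite mxE mulr_suml linear_sum summxE.
    by apply: eq_bigr => j _; rewrite !mxE -scalerAl linearZ.
  rewrite raddf_sum /=; apply: eq_bigr => j _.
  by apply/matrixP => k l; rewrite !mxE rmorphM.
rewrite mulmx_sumr linear_sum /= mulmx_suml; apply: eq_bigr => j _.
by rewrite -scalemxAr DP linearZ /= -scalemxAl.
Qed.

End Embeddings.
End MulMatrix.

Lemma rmorph_rat_scale (Phi : fieldExtType rat) (F : unitRingType)
  (f : {rmorphism Phi -> F}) (a : rat) x : f (a *: x) = ratr a * f x.
Proof.
rewrite -mulr_algl rmorphM; congr (_ * _).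
exact: (fmorph_eq_rat (f \o GRing.in_alg Phi : {rmorphism rat -> F})%FUN).
Qed.

Section EmbeddingMatrix.
Variables (Phi : fieldExtType rat) (n : nat) (b : n.+1.-tuple Phi).
Variable C : numClosedFieldType.
Hypotheses (hb : basis_of fullv b) (b0 : tnth b ord0 = 1).

Local Notation A x := (map_mx (ratr : rat -> C) (mulmat b x)).

Definition embmat (sigma : 'I_n.+1 -> {rmorphism Phi -> C}) : 'M[C]_n.+1 :=
  \matrix_(i, j) sigma i (tnth b j).

Lemma rmorph_of_fun (f : Phi -> C) : (forall x y, f (x + y) = f x + f y) ->
  (forall x y, f (x * y) = f x * f y) -> f 1 = 1 ->
  exists g : {rmorphism Phi -> C}, g =1 f.
Proof.
move=> fD fM f1.
have f0 : f 0 = 0 by apply: (addIr (f 0)); rewrite -fD !add0r.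
have fB : additive f.
  move=> x y; apply: (addIr (f y)); rewrite -fD !subrK //.
have fMM : multiplicative f by split.
pose fA := GRing.isAdditive.Build _ _ f fB.
pose fMu := GRing.isMultiplicative.Build _ _ f fMM.
pose g : {rmorphism Phi -> C} := HB.pack f fA fMu.
by exists g.
Qed.

(** The simultaneous eigenvectors of the multiplication matrices are, up to
    scaling, the rows [sigma b_0, ..., sigma b_n] for the embeddings [sigma]:
    the eigenvalue of the matrix of [x] on such a row depends
    multiplicatively on [x]. *)
Lemma embmat_exists : exists sigma : 'I_n.+1 -> {rmorphism Phi -> C},
  embmat sigma \in unitmx.
Proof.
have [P Pu [D DP]] := mulmat_codiagonalizable hb C.
have PDE x i j : (P *m A x) i j = D x 0 i * P i j.
  rewrite DP mul_diag_mx !mxE. by [].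
have PE i j : P i j = D (tnth b j) 0 i * P i 0.
  rewrite -PDE mxE (bigD1 j) //= big1 ?addr0 => [|k kj].
    by rewrite mxE mulmatE b0 mulr1 coords_basis // !mxE !eqxx rmorph1 mulr1.
  by rewrite mxE mulmatE b0 mulr1 coords_basis // !mxE (negbTE kj) rmorph0 mulr0.
have P0 i : P i 0 != 0.
  apply/eqP => Pi0; have : row i P = 0.
    by apply/rowP => j; rewrite !mxE PE Pi0 mulr0.
  move/(congr1 (mulmx^~ (invmx P))); rewrite -row_mul mulmxV // mul0mx.
  by move/rowP/(_ i); rewrite !mxE eqxx => /eqP; rewrite oner_eq0.
have /choice[sigma sE] i : exists g : {rmorphism Phi -> C}, g =1 (fun x => D x 0 i).
  apply: rmorph_of_fun => [x y|x y|]; apply: (mulIf (P0 i)); rewrite -?PDE.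
  - by rewrite mulrDl -!PDE mulmatD map_mxD mulmxDr mxE.
  - by rewrite mulmatM // map_mxM mulmxA DP -mulmxA mul_diag_mx mxE PDE mulrA.
  - by rewrite mulmat1 // map_mx1 mulmx1 mul1r.
exists sigma.
have DPE : P = diag_mx (\row_i P i 0) *m embmat sigma.
  by apply/matrixP => i j; rewrite mul_diag_mx !mxE PE sE mulrC.
by move: Pu; rewrite {1}DPE unitmx_mul => /andP[].
Qed.

Variable sigma : 'I_n.+1 -> {rmorphism Phi -> C}.
Hypothesis Su : embmat sigma \in unitmx.

Lemma embmatE x i : sigma i x = (embmat sigma *m map_mx ratr (coords b x)) i 0.
Proof.
rewrite {1}(coords_sum hb x) rmorph_sum mxE; apply: eq_bigr => j _.
by rewrite rmorph_rat_scale !mxE mulrC.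
Qed.

Lemma coords_embmat x k :
  (ratr (coords b x k 0) : C) = \sum_i invmx (embmat sigma) k i * sigma i x.
Proof.
have -> : ratr (coords b x k 0) = (map_mx (ratr : rat -> C) (coords b x)) k 0.
  by rewrite [RHS]mxE.
rewrite -(mulKmx Su (map_mx _ (coords b x))) mxE; apply: eq_bigr => i _.
by rewrite -embmatE.
Qed.

Lemma embmat_mulmat x : embmat sigma *m A x = diag_mx (\row_i sigma i x) *m embmat sigma.
Proof.
apply/matrixP => i j; rewrite mul_diag_mx !mxE -rmorphM embmatE mxE.
by apply: eq_bigr => k _; rewrite !mxE.
Qed.

Lemma det_mulmat x : ratr (\det (mulmat b x)) = \prod_i sigma i x.
Proof.
have d0 : \det (embmat sigma) != 0 by rewrite -unitfE -unitmxE.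
apply: (mulIf d0); rewrite -det_map_mx mulrC -det_mulmx embmat_mulmat det_mulmx det_diag.
by congr (_ * _); apply: eq_bigr => i _; rewrite mxE.
Qed.

(** Linear independence of characters, in matrix form: the invertible matrix
    [embmat sigma] leaves no room for a further embedding. *)
Lemma embeddings_complete (tau : {rmorphism Phi -> C}) : exists i, sigma i =1 tau.
Proof.
pose v : 'rV[C]_n.+1 := \row_j tau (tnth b j).
have vA x : v *m A x = tau x *: v.
  apply/rowP => j; rewrite !mxE -rmorphM (coords_sum hb (x * _)) rmorph_sum.
  by apply: eq_bigr => k _; rewrite rmorph_rat_scale !mxE mulrC.
have [c vE] : exists c : 'rV[C]_n.+1, v = c *m embmat sigma.
  by exists (v *m invmx (embmat sigma)); rewrite mulmxKV.
have c0 : c != 0.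
  apply/eqP => c0; move: vE; rewrite c0 mul0mx => /rowP/(_ ord0).
  by rewrite !mxE b0 rmorph1 => /eqP; rewrite oner_eq0.
have [i ci] : exists i, c 0 i != 0.
  apply/existsP; apply: contraNT c0; rewrite negb_exists => /forallP h.
  by apply/eqP/rowP => i; rewrite [RHS]mxE; apply/eqP; have:= h i; rewrite negbK.
exists i => x; apply: (mulfI ci).
have := vA x; rewrite vE -mulmxA embmat_mulmat mulmxA scalemxAl.
move=> /(congr1 (mulmx^~ (invmx (embmat sigma)))); rewrite !mulmxK //.
by move=> /rowP/(_ i); rewrite mul_mx_diag !mxE => ->; rewrite mulrC.
Qed.

End EmbeddingMatrix.

(** * Units preserving the lattice spanned by the basis *)

Lemma int_mxP m n (A : 'M[rat]_(m, n)) :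
  A \is a mxOver Num.int -> exists Z : 'M[int]_(m, n), A = map_mx intr Z.
Proof.
move=> /mxOverP Ai; exists (\matrix_(i, j) numq (A i j)).
by apply/matrixP => i j; rewrite !mxE numqK.
Qed.

Section LatticeUnits.
Variables (Phi : fieldExtType rat) (n : nat) (b : n.+1.-tuple Phi).
Hypothesis hb : basis_of fullv b.

Definition in_lattice (x : Phi) : bool := coords b x \is a mxOver Num.int.

(** The units [u] with [u M = M], for [M] the lattice spanned by the basis. *)
Definition lattice_units : set Phi := [set u | [/\ u != 0,
  mulmat b u \is a mxOver Num.int & mulmat b u^-1 \is a mxOver Num.int]].

Lemma in_latticeP x : reflect (forall k, coords b x k 0 \is a Num.int) (in_lattice x).
Proof.
apply: (iffP mxOverP) => h; first by move=> k; apply: h.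
by move=> k j; rewrite ord1.
Qed.

Lemma in_latticeN x : in_lattice (- x) = in_lattice x.
Proof.
apply/in_latticeP/in_latticeP => h k; last by rewrite coordsN mxE rpredN.
by have:= h k; rewrite coordsN mxE rpredN.
Qed.

Lemma lattice_unit_neq0 u : lattice_units u -> u != 0.
Proof. by case. Qed.

Lemma lattice_unit1 : lattice_units 1.
Proof.
have h : mulmat b 1 \is a mxOver Num.int by rewrite mulmat1 // mxOver_scalar.
by split; rewrite ?oner_eq0 ?invr1.
Qed.

Lemma lattice_unitM u v : lattice_units u -> lattice_units v -> lattice_units (u * v).
Proof.
move=> [u0 u1 u2] [v0 v1 v2]; split; rewrite ?mulf_neq0 ?invfM ?mulmatM //.
  exact: mxOverM.
exact: mxOverM.
Qed.

Lemma lattice_unitV u : lattice_units u -> lattice_units u^-1.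
Proof. by move=> [u0 u1 u2]; split; rewrite ?invr_eq0 ?invrK. Qed.

Lemma lattice_unitX u (k : nat) : lattice_units u -> lattice_units (u ^+ k).
Proof.
move=> hu; elim: k => [|k IH]; first exact: lattice_unit1.
by rewrite exprS; apply: lattice_unitM.
Qed.

Lemma lattice_unitXz u (k : int) : lattice_units u -> lattice_units (u ^ k).
Proof.
by case: k => k hu; [|apply: lattice_unitV]; apply: lattice_unitX.
Qed.

Lemma lattice_unit_prod r (u : 'I_r -> Phi) : (forall i, lattice_units (u i)) ->
  lattice_units (\prod_i u i).
Proof.
by move=> h; apply: (big_ind lattice_units) => //;
  [exact: lattice_unit1 | exact: lattice_unitM].
Qed.

Lemma lattice_unit_in u x : lattice_units u -> in_lattice x -> in_lattice (u * x).
Proof. by move=> [_ ui _] xi; rewrite /in_lattice coordsM //; apply: mxOverM. Qed.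

Lemma lattice_unit_det u : lattice_units u -> `|\det (mulmat b u)| = 1.
Proof.
move=> [u0 /int_mxP[Z Du] /int_mxP[Z' Du']].
have := congr1 determinant (mulmatV hb u0).
rewrite det_mulmx det1 Du Du' -[1](rmorph1 (intr : int -> rat)).
rewrite !det_map_mx -rmorphM => /eqP; rewrite eqr_int => /eqP ZZ'.
have := congr1 absz ZZ'; rewrite abszM => /eqP; rewrite muln_eq1 => /andP[/eqP Z1 _].
by rewrite -intr_norm -abszE Z1.
Qed.

(** A unit of the lattice acts on it by an integral matrix, whose
    characteristic polynomial is monic, integral and vanishes at the unit. *)
Lemma integral_of_int_mulmat u : mulmat b u \is a mxOver Num.int ->
  algebraic_integers u.
Proof.
move=> /int_mxP[Z Du]; exists (char_poly Z); first exact: char_poly_monic.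
rewrite map_char_poly -eigenvalue_root_char; apply/eigenvalueP.
exists (\row_j tnth b j).
  apply/rowP => j; rewrite !mxE [RHS](coords_sum hb); apply: eq_bigr => k _.
  rewrite -mulmatE Du !mxE mulrC -mulr_algl; congr (_ * _).
  exact: esym (rmorph_int (GRing.in_alg Phi) _).
apply/eqP => /rowP/(_ ord0); rewrite !mxE => b0.
by have := free_not0 (basis_free hb) (mem_tnth ord0 b); rewrite b0 eqxx.
Qed.

Lemma lattice_unit_algebraic u : lattice_units u -> algebraic_units u.
Proof.
move=> [u0 u1 u2]; split; first exact: integral_of_int_mulmat.
by exists u^-1; [exact: integral_of_int_mulmat | rewrite divff].
Qed.

(** A multiplicatively independent family of units that is maximal among those
    preserving the lattice generates them up to finite index. It may have
    fewer than [r] members a priori, and is padded by trivial units. *)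
Lemma lattice_unit_family r : has_unit_rank Phi r ->
  exists eps : 'I_r -> Phi, (forall l, lattice_units (eps l)) /\
    forall u, lattice_units u -> exists (e : int) (f : 'I_r -> int),
      e != 0 /\ u ^ e = \prod_l eps l ^ f l.
Proof.
move=> [_ rmax].
pose Q m := `[< exists u : 'I_m -> Phi,
  (forall i, lattice_units (u i)) /\ mult_independent u >].
have Q0 : exists m, Q m.
  by exists 0%N; apply/asboolP; exists (fun _ => 1); split => [[]//|? ? []].
have Qle m : Q m -> (m <= r)%N.
  move=> /asboolP[u [hu iu]]; apply: rmax iu => i.
  exact: lattice_unit_algebraic.
case: (ex_maxnP Q0 Qle) => m Qm mmax; have mr := Qle _ Qm.
move: Qm => /asboolP[u [hu iu]].
pose eps (l : 'I_r) : Phi := if insub (l : nat) is Some i then u i else 1.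
exists eps; split=> [l|v hv].
  by rewrite /eps; case: insubP => // *; exact: lattice_unit1.
pose v' (i : 'I_m.+1) : Phi := if unlift ord0 i is Some j then u j else v.
have : ~ mult_independent v'.
  move=> iv'; have : Q m.+1.
    apply/asboolP; exists v'; split => // i.
    by rewrite /v'; case: unliftP.
  by move=> /mmax; rewrite ltnn.
move=> /existsNP[e /not_implyP[]]; rewrite big_ord_recl /v' unlift_none.
under eq_bigr do rewrite liftK.
move=> eE /existsNP[i0 ei0].
have e0 : e ord0 != 0.
  apply/eqP => e0; move: eE; rewrite e0 expr0z mul1r => /iu eE.
  by case: (unliftP ord0 i0) ei0 => [j|] ->; rewrite ?eE ?e0.
exists (e ord0), (fun l => if insub (l : nat) is Some j then - e (lift ord0 j) else 0).
split=> //.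
have -> : \prod_(l < r) eps l ^ (if insub (l : nat) is Some j then - e (lift ord0 j) else 0)
        = \prod_(j < m) u j ^ (- e (lift ord0 j)).
  pose G k := (if insub k is Some i then u i else 1) ^
     (if insub k is Some j then - e (lift ord0 j) else 0).
  transitivity (\prod_(l < r | (l < m)%N) G l).
    rewrite [RHS]big_mkcond; apply: eq_bigr => l _; rewrite /eps -/(G l).
    by case: ltnP => // lm; rewrite /G !insubF ?expr0z // ltnNge lm.
  rewrite -(big_ord_widen _ G mr); apply: eq_bigr => j _.
  by rewrite /G !valK.
under eq_bigr do rewrite -invr_expz.
rewrite prodfV -[LHS]mulr1 -[X in _ * X](@mulfV _ (\prod_j u j ^ e (lift ord0 j))).
  by rewrite mulrA eE mul1r.
rewrite prodf_seq_neq0; apply/allP => j _ /=.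
by rewrite expfz_neq0 // lattice_unit_neq0.
Qed.

End LatticeUnits.

(** * Moduli of complex numbers *)

Section Modulus.
Variable R : realType.
Implicit Types z w : R[i].

Definition cabs z : R := complex.Re `|z|.

Lemma cabsE z : `|z| = (cabs z)%:C%C.
Proof. by rewrite /cabs RRe_real // normr_real. Qed.

Lemma cabs_ge0 z : 0 <= cabs z.
Proof. by rewrite -lecR -cabsE normr_ge0. Qed.

Lemma cabsM z w : cabs (z * w) = cabs z * cabs w.
Proof. by apply: complexI; rewrite rmorphM /= -!cabsE normrM. Qed.

Lemma cabsD z w : cabs (z + w) <= cabs z + cabs w.
Proof. by rewrite -lecR rmorphD /= -!cabsE ler_normD. Qed.

Lemma cabs1 : cabs 1 = 1.
Proof. by rewrite /cabs normr1. Qed.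

Lemma cabs0 : cabs 0 = 0.
Proof. by rewrite /cabs normr0. Qed.

Lemma cabs_gt0 z : z != 0 -> 0 < cabs z.
Proof. by move=> z0; rewrite -ltcR -cabsE normr_gt0. Qed.

Lemma cabs_real (x : R) : cabs x%:C%C = `|x|.
Proof. by rewrite /cabs normc_def /= expr0n addr0 sqrtr_sqr. Qed.

Lemma cabs_prod (I : finType) (P : pred I) (F : I -> R[i]) :
  cabs (\prod_(i | P i) F i) = \prod_(i | P i) cabs (F i).
Proof. exact: (big_morph _ cabsM cabs1). Qed.

Lemma cabs_sum (I : finType) (F : I -> R[i]) :
  cabs (\sum_i F i) <= \sum_i cabs (F i).
Proof.
elim/big_rec2: _ => [|i y x _ h]; first by rewrite cabs0.
by rewrite (le_trans (cabsD _ _)) // lerD2l.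
Qed.

Lemma cabsV z : cabs z^-1 = (cabs z)^-1.
Proof. by apply: complexI; rewrite fmorphV /= -!cabsE normfV. Qed.

Lemma le_Re_cabs z : `|complex.Re z| <= cabs z.
Proof. by rewrite -lecR -cabsE normc_ge_Re. Qed.

Lemma cabs_ratr (a : rat) : cabs (ratr a) = `|ratr a|.
Proof.
rewrite -(cabs_real (ratr a)); congr (cabs _).
exact: esym (fmorph_eq_rat (real_complex R \o ratr : {rmorphism rat -> R[i]})%FUN a).
Qed.

Lemma ln_cabsM z w : z != 0 -> w != 0 -> ln (cabs (z * w)) = ln (cabs z) + ln (cabs w).
Proof. by move=> z0 w0; rewrite cabsM lnM // posrE cabs_gt0. Qed.

Lemma ln_cabsV z : z != 0 -> ln (cabs z^-1) = - ln (cabs z).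
Proof. by move=> z0; rewrite cabsV lnV // posrE cabs_gt0. Qed.

Lemma ln_cabsXz z (k : int) : z != 0 -> ln (cabs (z ^ k)) = k%:~R * ln (cabs z).
Proof.
move=> z0.
have lnX (j : nat) : ln (cabs (z ^+ j)) = j%:R * ln (cabs z).
  elim: j => [|j IH]; first by rewrite expr0 cabs1 ln1 mul0r.
  by rewrite exprS ln_cabsM ?expf_neq0 // IH -natr1 mulrDl mul1r addrC.
case: k => k; first exact: lnX.
by rewrite NegzE -invr_expz ln_cabsV ?expf_neq0 // lnX mulrNz mulNr.
Qed.

Lemma ln_cabs_prod r (F : 'I_r -> R[i]) : (forall l, F l != 0) ->
  ln (cabs (\prod_l F l)) = \sum_l ln (cabs (F l)).
Proof.
move=> F0; suff [] : \prod_l F l != 0 /\ ln (cabs (\prod_l F l)) = \sum_l ln (cabs (F l)) by [].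
elim/big_rec2: _ => [|l y x _ [x0 xE]]; first by rewrite oner_eq0 cabs1 ln1.
by rewrite mulf_neq0 // ln_cabsM // xE.
Qed.

End Modulus.

(** * Simultaneous approximation and units of prescribed size *)

Lemma frac_part_itv (R : realType) (x : R) : 0 <= frac_part x < 1.
Proof.
rewrite /frac_part subr_ge0 ltrBlDr addrC.
by have := floor_itv x; rewrite intrD.
Qed.

(** The fractional parts of [(N + 1) ^ d] linear combinations fall into [N ^ d]
    intervals of length [N ^- d]; two of them share an interval. *)
Lemma dirichlet_approximation (R : realType) d (omega : 'I_d -> R) (N : nat) :
  (0 < d)%N -> (0 < N)%N ->
  exists (a : 'I_d -> int) (m : int), [/\ exists i, a i != 0,
    forall i, `|(a i)%:~R : R| <= N%:R &
    `|m%:~R + \sum_i (a i)%:~R * omega i| * N%:R ^+ d <= 1].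
Proof.
move=> d0 N0.
pose T := {ffun 'I_d -> 'I_N.+1}.
pose S (v : T) : R := \sum_i (v i)%:R * omega i.
pose f v := frac_part (S v).
have f01 v : 0 <= f v < 1 by exact: frac_part_itv.
have Nd0 : (0 < N ^ d)%N by rewrite expn_gt0 N0.
have Nd0R : 0 < N%:R ^+ d :> R by rewrite exprn_gt0 // ltr0n.
pose k v := Num.truncn (f v * N%:R ^+ d).
have kP v : (k v)%:R <= f v * N%:R ^+ d < (k v).+1%:R.
  apply: truncn_itv; rewrite mulr_ge0 ?exprn_ge0 //.
  by have /andP[] := f01 v.
have klt v : (k v < N ^ d)%N.
  rewrite -(ltr_nat R) natrX; have /andP[h _] := kP v; apply: le_lt_trans h _.
  by rewrite gtr_pMl //; have /andP[] := f01 v.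
have /injectivePn[v [v' vv' kvv']] : ~~ injectiveb (fun v => Ordinal (klt v)).
  apply/negP => /injectiveP /leq_card.
  by rewrite card_ffun !card_ord leq_exp2r // ltnn.
have {}kvv' : k v = k v' by case: kvv'.
exists (fun i => (v i : nat)%:Z - (v' i : nat)%:Z), (Num.floor (S v') - Num.floor (S v)).
split.
- have [i vi] : exists i, v i != v' i.
    apply/existsP; apply: contraNT vv'; rewrite negb_exists => /forallP h.
    by apply/eqP/ffunP => i; apply/eqP; have := h i; rewrite negbK.
  by exists i; rewrite subr_eq0 eqz_nat.
- move=> i; rewrite intrB ler_norml !pmulrn.
  have h1 : (v i)%:R <= N%:R :> R by rewrite ler_nat -ltnS.
  have h2 : (v' i)%:R <= N%:R :> R by rewrite ler_nat -ltnS.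
  have h3 : 0 <= (v i)%:R :> R by [].
  have h4 : 0 <= (v' i)%:R :> R by [].
  move: h1 h2 h3 h4; rewrite -!pmulrn; lra.
have -> : \sum_i ((v i : nat)%:Z - (v' i : nat)%:Z)%:~R * omega i = S v - S v'.
  by rewrite -sumrB; apply: eq_bigr => i _; rewrite intrB mulrBl.
have -> : (Num.floor (S v') - Num.floor (S v))%:~R + (S v - S v') = f v - f v'.
  by rewrite intrB /f /frac_part; ring.
rewrite -[X in _ * X]gtr0_norm // -normrM ler_norml mulrBl.
have := kP v; have := kP v'; rewrite kvv' -natr1; lra.
Qed.

Section LatticeElements.
Variables (R : realType) (d : nat) (Phi : fieldExtType rat) (w : d.-tuple Phi).
Hypothesis d0 : (0 < d)%N.
Let b : d.+1.-tuple Phi := [tuple of 1 :: w].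
Hypothesis hb : basis_of fullv b.
Variable emb : {rmorphism Phi -> R}.
Variables (sigma : 'I_d.+1 -> {rmorphism Phi -> R[i]}) (i0 : 'I_d.+1).
Hypothesis Su : embmat b sigma \in unitmx.
Hypothesis s0 : forall x, sigma i0 x = (emb x)%:C%C.

Definition lattice_elt (v : 'I_d.+1 -> int) : Phi := \sum_k (v k)%:~R * tnth b k.

Lemma coords_lattice_elt v k : coords b (lattice_elt v) k 0 = (v k)%:~R.
Proof.
have aux (f : 'I_d.+1 -> Phi) : coords b (\sum_j f j) k 0 = \sum_j coords b (f j) k 0.
  by rewrite mxE linear_sum; apply: eq_bigr => j _; rewrite mxE.
rewrite aux (bigD1 k) //= big1 ?addr0 => [|j jk].
  rewrite -(rmorph_int (GRing.in_alg Phi)) mulr_algl mxE linearZ /=.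
  have := coords_basis hb k => /matrixP/(_ k 0); rewrite !mxE !eqxx => ->.
  by rewrite mulr1.
rewrite -(rmorph_int (GRing.in_alg Phi)) mulr_algl mxE linearZ /=.
have := coords_basis hb j => /matrixP/(_ k 0); rewrite !mxE eq_sym (negbTE jk) => ->.
by rewrite mulr0.
Qed.

Lemma in_lattice_elt v : in_lattice b (lattice_elt v).
Proof. by apply/in_latticeP => k; rewrite coords_lattice_elt. Qed.

Lemma in_latticeE x : in_lattice b x -> exists v, x = lattice_elt v.
Proof.
move=> /in_latticeP xi; exists (fun k => numq (coords b x k 0)).
apply: (coords_inj hb); apply/matrixP => k j.
by rewrite ord1 coords_lattice_elt numqK.
Qed.

Lemma lattice_elt_recl v :
  lattice_elt v = (v ord0)%:~R + \sum_(i < d) (v (lift ord0 i))%:~R * tnth w i.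
Proof.
rewrite /lattice_elt big_ord_recl tnth0 mulr1; congr (_ + _).
by apply: eq_bigr => i _; rewrite tnthS.
Qed.

Lemma sigma_lattice_elt v i : sigma i (lattice_elt v) = (emb (lattice_elt v))%:C%C +
  \sum_(j < d) (v (lift ord0 j))%:~R * (sigma i (tnth w j) - (emb (tnth w j))%:C%C).
Proof.
rewrite lattice_elt_recl !rmorphD /= !rmorph_int /= -addrA; congr (_ + _).
rewrite !rmorph_sum /= -big_split /=; apply: eq_bigr => j _.
by rewrite !rmorphM /= !rmorph_int mulrBr addrC subrK.
Qed.

Lemma sigma_neq0 x i : x != 0 -> sigma i x != 0.
Proof. by move=> x0; rewrite fmorph_eq0. Qed.

Lemma approximating_elements : exists2 C : R, 1 <= C &
  forall N, (0 < N)%N -> exists x, [/\ in_lattice b x, x != 0,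
    cabs (sigma i0 x) * N%:R ^+ d <= 1 &
    forall i, cabs (sigma i x) <= C * N%:R].
Proof.
pose S i := \sum_(j < d) cabs (sigma i (tnth w j) - (emb (tnth w j))%:C%C).
have S0 i : 0 <= S i by apply: sumr_ge0 => j _; apply: cabs_ge0.
exists (1 + \sum_i S i) => [|N N0]; first by rewrite lerDl sumr_ge0.
have [a [m [[i1 ai] aN am]]] := dirichlet_approximation (fun i => emb (tnth w i)) d0 N0.
pose v k := if unlift ord0 k is Some i then a i else m.
have vS i : v (lift ord0 i) = a i by rewrite /v liftK.
have v0 : v ord0 = m by rewrite /v unlift_none.
have NR1 : 1 <= N%:R :> R by rewrite ler1n.
have Nd : 1 <= N%:R ^+ d :> R by rewrite exprn_ege1.
have e0 : cabs (sigma i0 (lattice_elt v)) * N%:R ^+ d <= 1.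
  rewrite s0 cabs_real lattice_elt_recl rmorphD rmorph_int rmorph_sum /= v0.
  under eq_bigr do rewrite rmorphM rmorph_int vS.
  exact: am.
exists (lattice_elt v); split => //.
- exact: in_lattice_elt.
- apply/eqP => x0; have := coords_lattice_elt v (lift ord0 i1).
  rewrite x0 mxE linear0 vS => /esym/eqP; rewrite intr_eq0; exact/negP.
move=> i; rewrite sigma_lattice_elt (le_trans (cabsD _ _)) // mulrDl mul1r.
apply: lerD.
  rewrite -s0 (le_trans _ NR1) // (le_trans _ e0) // ler_peMr ?cabs_ge0 //.
apply: (@le_trans _ _ (S i * N%:R)); last first.
  rewrite ler_wpM2r // (bigD1 i) //= lerDl sumr_ge0 //.
rewrite (le_trans (cabs_sum _)) // mulr_suml; apply: ler_sum => j _.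
rewrite cabsM mulrC ler_wpM2l ?cabs_ge0 // vS.
by rewrite -(rmorph_int (real_complex R)) cabs_real aN.
Qed.

Lemma common_denominator : exists2 q : nat, (0 < q)%N &
  forall x, in_lattice b x -> q%:R *: mulmat b x \is a mxOver Num.int.
Proof.
pose q := (\prod_(t : 'I_d.+1 * 'I_d.+1 * 'I_d.+1)
  `|denq (mulmat b (tnth b t.1.1) t.1.2 t.2)|)%N.
exists q; first by rewrite prodn_gt0 // => t; rewrite absz_gt0 denq_neq0.
move=> x /in_latticeP xi; apply/mxOverP => k l.
have -> : (q%:R *: mulmat b x) k l
    = \sum_j coords b x j 0 * (q%:R * mulmat b (tnth b j) k l).
  rewrite !mxE {1}(coords_sum hb x) mulr_suml linear_sum mulr_sumr.
  by apply: eq_bigr => j _; rewrite -scalerAl linearZ /= !mxE mulrCA.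
apply: rpred_sum => j _; apply: rpredM => //.
rewrite /q (bigD1 (j, k, l)) //= natrM mulrAC; apply: rpredM; last exact: rpred_nat.
rewrite -{2}(divq_num_den (mulmat b (tnth b j) k l)) mulrC.
rewrite natr_absz gtr0_norm ?denq_gt0 // divfK ?intr_eq0 ?denq_neq0 //.
by apply/intrP; eexists.
Qed.

Lemma norm_det_mulmat q x :
  `|ratr (\det (q%:R *: mulmat b x)) : R| = q%:R ^+ d.+1 * \prod_i cabs (sigma i x).
Proof.
rewrite -cabs_ratr detZ rmorphM cabsM rmorphXn rmorph_nat.
rewrite /= (det_mulmat hb Su) cabs_prod.
congr (_ * _); rewrite -(rmorph_nat (real_complex R)) -rmorphXn.
by rewrite cabs_real ger0_norm ?exprn_ge0.
Qed.

Lemma lattice_norm_ge1 q x : x != 0 -> (0 < q)%N ->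
  q%:R *: mulmat b x \is a mxOver Num.int ->
  1 <= q%:R ^+ d.+1 * \prod_i cabs (sigma i x).
Proof.
move=> x0 q0 /int_mxP[Z DZ].
have : \det (q%:R *: mulmat b x) != 0.
  by rewrite detZ mulf_neq0 ?expf_neq0 ?det_mulmat_neq0 // pnatr_eq0 -lt0n.
rewrite -norm_det_mulmat DZ det_map_mx intr_eq0 ratr_int -intr_norm => dZ.
by rewrite ler1z -gtz0_ge1 normr_gt0.
Qed.

(** In [x / x' = 1 + D! (y / x')] the factor [D!] absorbs the determinant by
    which the adjugate is divided when the matrix of [x'] is inverted. *)
Lemma congruent_quotient_int q (D : nat) x x' y :
  q%:R *: mulmat b x' \is a mxOver Num.int ->
  q%:R *: mulmat b y \is a mxOver Num.int ->
  x' != 0 -> (0 < q)%N -> `|\det (q%:R *: mulmat b x')| <= D%:R ->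
  x = x' + D`!%:R * y -> mulmat b (x / x') \is a mxOver Num.int.
Proof.
move=> /int_mxP[Z' DZ'] /int_mxP[Y DY] x'0 q0.
have q0' : q%:R != 0 :> rat by rewrite pnatr_eq0 -lt0n.
have dZ' : \det Z' != 0.
  have : \det (q%:R *: mulmat b x') != 0.
    by rewrite detZ mulf_neq0 ?expf_neq0 // det_mulmat_neq0.
  by rewrite DZ' det_map_mx intr_eq0.
rewrite {1}DZ' det_map_mx -intr_norm -abszE ler_nat => Z'D ->.
have /dvdnP[g Dg] : (`|\det Z'| %| D`!)%N by rewrite dvdn_fact // absz_gt0 dZ'.
rewrite mulrDl divff // mulmatD mulmat1 //.
have -> : mulmat b (D`!%:R * y / x')
  = map_mx intr ((sgz (\det Z') * g%:Z) *: (Y *m \adj Z')).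
  have q0u : q%:R *: mulmat b x' \in unitmx.
    by rewrite DZ' unitmxE det_map_mx unitfE intr_eq0.
  apply: (can_inj (mulmxK q0u)).
  rewrite -scalemxAr -mulmatM // divfK //.
  have -> : D`!%:R * y = (D`!%:R : rat) *: y.
    by rewrite -mulr_algl; congr (_ * _); exact: esym (rmorph_nat (GRing.in_alg Phi) _).
  have -> : q%:R *: mulmat b (D`!%:R *: y) = D`!%:R *: map_mx intr Y.
    by rewrite mulmatZ -DY !scalerA mulrC.
  rewrite DZ' -map_mxM -scalemxAl -mulmxA mul_adj_mx mul_mx_scalar scalerA Dg.
  have -> : (sgz (\det Z') * g%:Z) * \det Z' = (g * `|\det Z'|)%N%:Z.
    by rewrite PoszM abszEsg mulrAC mulrC.
  by apply/matrixP => k l; rewrite !mxE rmorphM.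
apply/mxOverP => k l; rewrite mxE; apply: rpredD.
  by rewrite mxE; case: (k == l).
by rewrite mxE; apply/intrP; eexists.
Qed.


Lemma in_lattice_modn Q x x' : (0 < Q)%N -> in_lattice b x -> in_lattice b x' ->
  (forall k, modz (numq (coords b x k 0)) Q = modz (numq (coords b x' k 0)) Q) ->
  exists2 y, in_lattice b y & x = x' + Q%:R * y.
Proof.
move=> Q0 /in_latticeE[v ->] /in_latticeE[v' ->] h.
pose u k := ((v k - v' k) %/ Q)%Z.
exists (lattice_elt u); first exact: in_lattice_elt.
have vE k : v k = v' k + Q%:Z * u k.
  have hd : (Q %| v k - v' k)%Z.
    rewrite -eqz_mod_dvd; apply/eqP.
    by have := h k; rewrite !coords_lattice_elt !numq_int.
  by rewrite mulrC (divzK hd) addrC subrK.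
rewrite /lattice_elt mulr_sumr -big_split /=; apply: eq_bigr => k _.
by rewrite vE intrD mulrDl intrM mulrA.
Qed.

End LatticeElements.

Lemma prod_le_exp (R : realType) (I : finType) (P : pred I) (F : I -> R) (B : R) :
  (forall i, 0 <= F i <= B) -> \prod_(i | P i) F i <= B ^+ #|P|.
Proof.
move=> FB; rewrite -prodr_const; apply: ler_prod => i _; exact: FB.
Qed.

Section LogarithmsOfUnits.
Variables (R : realType) (d : nat) (Phi : fieldExtType rat) (w : d.-tuple Phi).
Hypothesis d0 : (0 < d)%N.
Let b : d.+1.-tuple Phi := [tuple of 1 :: w].
Hypothesis hb : basis_of fullv b.
Variable emb : {rmorphism Phi -> R}.
Variables (sigma : 'I_d.+1 -> {rmorphism Phi -> R[i]}) (i0 : 'I_d.+1).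
Hypothesis Su : embmat b sigma \in unitmx.
Hypothesis s0 : forall x, sigma i0 x = (emb x)%:C%C.
(** The norm of an element approximating as well as Dirichlet's theorem allows
    is bounded; being bounded below as well, it forces every conjugate except
    the distinguished one to have the largest possible order of magnitude. *)
Lemma approximating_elements_bounded : exists (c C : R) (q D : nat),
  [/\ 0 < c, 0 < C, (0 < q)%N,
   forall x, in_lattice b x -> q%:R *: mulmat b x \is a mxOver Num.int &
   forall N, (0 < N)%N -> exists x, [/\ in_lattice b x, x != 0,
    `|\det (q%:R *: mulmat b x)| <= D%:R &
    forall i, i != i0 -> c * N%:R <= cabs (sigma i x) <= C * N%:R]].
Proof.
have [C C1 hC] := approximating_elements d0 hb s0.
have [q q0 hq] := common_denominator hb.
have C0 : 0 < C by apply: lt_le_trans C1.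
have q0R : 0 < q%:R :> R by rewrite ltr0n.
pose c := (q%:R ^+ d.+1 * C ^+ d.-1)^-1.
have c0 : 0 < c by rewrite invr_gt0 mulr_gt0 ?exprn_gt0.
pose D := (Num.truncn (q%:R ^+ d.+1 * C ^+ d)).+1.
exists c, C, q, D; split => // N N0.
have N0R : 0 < N%:R :> R by rewrite ltr0n.
have Nd0 : 0 < N%:R ^+ d :> R by rewrite exprn_gt0.
have [x [xi x0 xs xC]] := hC N N0.
exists x; split => //.
  rewrite -(ler_rat R) ratr_norm ratr_nat (norm_det_mulmat hb Su) //.
  apply: le_trans (ltW (truncnS_gt _)).
  rewrite ler_pM2l ?exprn_gt0 // (bigD1 i0) //=.
  have h : \prod_(i | i != i0) cabs (sigma i x) <= (C * N%:R) ^+ d.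
    have e : #|[pred i : 'I_d.+1 | i != i0]| = d by rewrite cardC1 card_ord.
    by rewrite -[X in _ ^+ X]e; apply: prod_le_exp => i; rewrite cabs_ge0 xC.
  rewrite (le_trans (ler_wpM2l (cabs_ge0 _) h)) // exprMn mulrCA.
  by rewrite ler_piMr // exprn_ge0 // ltW.
move=> i ii0; rewrite xC andbT /c mulrC ler_pdivrMr ?mulr_gt0 ?exprn_gt0 //.
have := lattice_norm_ge1 hb Su x0 q0 (hq _ xi).
rewrite (bigD1 i0) //= (bigD1 i) //=.
have h : \prod_(j | (j != i0) && (j != i)) cabs (sigma j x) <= (C * N%:R) ^+ d.-1.
  have e : #|[pred j : 'I_d.+1 | (j != i0) && (j != i)]| = d.-1.
    have := cardC1 i0; rewrite (cardD1 i) inE ii0 card_ord /= add1n.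
    move=> /(congr1 predn) /= h; rewrite -[RHS]h.
    by apply: eq_card => j; rewrite !inE andbC.
  by rewrite -[X in _ ^+ X]e; apply: prod_le_exp => j; rewrite cabs_ge0 xC.
set p := \prod_(j | _) _ in h *; move=> h1.
have p0 : 0 <= p by apply: prodr_ge0 => j _; apply: cabs_ge0.
have := ler_wpM2r (ltW N0R) h1; rewrite mul1r => /le_trans; apply.
set a := cabs (sigma i0 x) in xs *; set ai := cabs (sigma i x).
have a0 : 0 <= a by apply: cabs_ge0.
have apN : a * p * N%:R <= C ^+ d.-1.
  apply: (@le_trans _ _ (C ^+ d.-1 * (a * N%:R ^+ d))); last first.
    by rewrite ler_piMr // exprn_ge0 // ltW.
  have -> : C ^+ d.-1 * (a * N%:R ^+ d) = a * (C * N%:R) ^+ d.-1 * N%:R.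
    by rewrite -[in N%:R ^+ d](prednK d0) exprS exprMn; ring.
  by rewrite ler_pM2r // ler_wpM2l.
have -> : q%:R ^+ d.+1 * (a * (ai * p)) * N%:R = q%:R ^+ d.+1 * ai * (a * p * N%:R).
  by ring.
have -> : ai * (q%:R ^+ d.+1 * C ^+ d.-1) = q%:R ^+ d.+1 * ai * C ^+ d.-1 by ring.
by rewrite ler_wpM2l // mulr_ge0 ?cabs_ge0 // exprn_ge0 // ltW.
Qed.

Lemma ln_cabs_div x y i : x != 0 -> y != 0 ->
  ln (cabs (sigma i (x / y))) = ln (cabs (sigma i x)) - ln (cabs (sigma i y)).
Proof.
by move=> x0 y0; rewrite rmorphM fmorphV ln_cabsM ?ln_cabsV ?invr_eq0 // fmorph_eq0.
Qed.

(** Among the approximating elements for [N = 1, B, B ^ 2, ...] two must be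
    congruent modulo a fixed integer; their quotient is a unit. *)
Lemma lattice_unit_of_size : exists C : R, forall B : nat, (1 < B)%N ->
  exists u s, [/\ lattice_units b u, ln (B%:R : R) <= s &
    forall i, i != i0 -> `|ln (cabs (sigma i u)) - s| <= C].
Proof.
have [c [C [q [D [c0 C0 q0 hq hx]]]]] := approximating_elements_bounded.
have /choice[x_ x_P] N : exists x, (0 < N)%N -> [/\ in_lattice b x, x != 0,
    `|\det (q%:R *: mulmat b x)| <= D%:R &
    forall i, i != i0 -> c * N%:R <= cabs (sigma i x) <= C * N%:R].
  by case: N => [|N]; [exists 0 | have [x xP] := hx N.+1 isT; exists x].
exists (`|ln C| + `|ln c|) => B B1.
have B0 : (0 < B)%N by apply: ltnW.
have BR0 : 0 < B%:R :> R by rewrite ltr0n.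
have lnB : 0 < ln (B%:R : R) by rewrite ln_gt0 // ltr1n.
pose Q := D`!.
have Q0 : (0 < Q)%N by exact: fact_gt0.
pose cls (k : nat) : {ffun 'I_d.+1 -> 'I_Q.-1.+1} :=
  [ffun j => inord (absz (modz (numq (coords b (x_ (B ^ k)%N) j 0)) Q))].
pose M := #|{ffun 'I_d.+1 -> 'I_Q.-1.+1}|.
have [k [k' [kk' clsE]]] : exists k k', (k < k')%N /\ cls k = cls k'.
  have /injectivePn[k [k' kk' h]] : ~~ injectiveb (fun k : 'I_M.+1 => cls k).
    by apply/negP => /injectiveP /leq_card; rewrite card_ord ltnn.
  have : (k : nat) != k' by [].
  by rewrite neq_ltn => /orP[lt|lt]; [exists k, k'|exists k', k].
have Bk j : (0 < B ^ j)%N by rewrite expn_gt0 B0.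
have [xi x0 xD xC] := x_P _ (Bk k'); have [yi y0 yD yC] := x_P _ (Bk k).
set x := x_ _ in xi x0 xD xC; set y := x_ _ in yi y0 yD yC.
have xy j : modz (numq (coords b x j 0)) Q = modz (numq (coords b y j 0)) Q.
  have modQ (z : int) : (`|modz z Q| < Q)%N /\ modz z Q = (`|modz z Q|%N : int).
    have h0 : 0 <= modz z Q by rewrite modz_ge0 // eqz_nat -lt0n.
    have h1 : modz z Q < Q by rewrite ltz_pmod // ltz_nat.
    by rewrite -ltz_nat gez0_abs.
  move/ffunP: clsE => /(_ j); rewrite !ffunE => /(congr1 val) /=.
  rewrite !inordK ?prednK ?(modQ _).1 // => e.
  by rewrite (modQ _).2 -e -(modQ _).2.
have [z zi xE] := in_lattice_modn hb Q0 xi yi xy.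
have yE : y = x + Q%:R * (- z) by rewrite xE mulrN addrK.
exists (x / y), ((k'%:R - k%:R) * ln B%:R); split.
- split; first by rewrite mulf_neq0 ?invr_eq0.
    exact: (congruent_quotient_int hb (hq _ yi) (hq _ zi) y0 q0 yD xE).
  rewrite invf_div.
  apply: (congruent_quotient_int hb (hq _ xi) _ x0 q0 xD yE).
  by apply: hq; rewrite in_latticeN.
- rewrite -natrB; last exact: ltnW.
  by rewrite ler_peMl ?ler1n ?subn_gt0 // ltW.
move=> i ii0; rewrite ln_cabs_div //.
have sz j (a : R) : c * (B ^ j)%:R <= a <= C * (B ^ j)%:R ->
    ln c + j%:R * ln B%:R <= ln a <= ln C + j%:R * ln B%:R.
  move=> /andP[h1 h2].
  have Bj0 : 0 < (B ^ j)%:R :> R by rewrite ltr0n.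
  have a0 : 0 < a by apply: lt_le_trans h1; rewrite mulr_gt0.
  have lnBj : ln ((B ^ j)%:R : R) = j%:R * ln B%:R by rewrite natrX lnXn // mulr_natl.
  by rewrite -lnBj -!lnM ?posrE // !ler_ln ?posrE ?mulr_gt0 // h1.
have := sz _ _ (xC i ii0); have := sz _ _ (yC i ii0).
have := ler_norm (ln C); have := ler_norm (ln c).
have := ler_norm (- ln C); have := ler_norm (- ln c); rewrite !normrN ler_norml.
lra.
Qed.

(** Dirichlet's unit theorem enters only through this consequence: the
    one-parameter group scaling all conjugates but one lies in the real span
    of the logarithms of the units. It holds because units follow that group
    at bounded distance arbitrarily far out. *)
Lemma log_units_span r (eps : 'I_r -> Phi) :
  (forall l, lattice_units b (eps l)) ->
  (forall u, lattice_units b u -> exists (e : int) (f : 'I_r -> int),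
      e != 0 /\ u ^ e = \prod_l eps l ^ f l) ->
  exists beta : 'I_r -> R, forall i, i != i0 ->
    \sum_l beta l * ln (cabs (sigma i (eps l))) = 1.
Proof.
move=> heps hgen; have [C hC] := lattice_unit_of_size.
pose L u : 'rV[R]_d.+1 := \row_i ((i != i0)%:R * ln (cabs (sigma i u))).
pose E : 'M[R]_(r, d.+1) := \matrix_(l, i) L (eps l) 0 i.
pose v : 'rV[R]_d.+1 := \row_i (i != i0)%:R.
have LE u : lattice_units b u -> L u *m cokermx E = 0.
  move=> hu; have [e [f [e0 ue]]] := hgen u hu.
  have eL : e%:~R *: L u = (\row_l (f l)%:~R) *m E.
    apply/rowP => i; rewrite !mxE mulrCA -ln_cabsXz ?sigma_neq0 ?(lattice_unit_neq0 hu) //.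
    rewrite -rmorphXz ?unitfE ?(lattice_unit_neq0 hu) // ue rmorph_prod ln_cabs_prod.
      rewrite mulr_sumr; apply: eq_bigr => l _; rewrite !mxE mulrCA; congr (_ * _).
      rewrite rmorphXz ?unitfE ?(lattice_unit_neq0 (heps _)) // ln_cabsXz //.
      by rewrite fmorph_eq0 (lattice_unit_neq0 (heps _)).
    move=> l; rewrite fmorph_eq0 expfz_neq0 //.
    exact: (lattice_unit_neq0 (heps _)).
  have : (e%:~R *: L u) *m cokermx E = 0 by rewrite eL -mulmxA mulmx_coker mulmx0.
  rewrite -scalemxAl => /eqP; rewrite scaler_eq0 intr_eq0 (negbTE e0) => /eqP //.
have /submxP[beta vE] : (v <= E)%MS.
  rewrite submxE; apply/eqP.
  apply/rowP => j; rewrite [RHS]mxE; apply/eqP/negPn/negP => x0.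
  set x := _ 0 j in x0.
  pose M := \sum_i `|C| * `|cokermx E i j|.
  have M0 : 0 <= M by apply: sumr_ge0 => i _; rewrite mulr_ge0.
  pose B := (Num.truncn (expR (M / `|x|))).+2.
  have [//|u [s [hu sB uC]]] := hC B.
  have xn0 : 0 < `|x| by rewrite normr_gt0.
  have : s * `|x| <= M.
    have -> : s * `|x| = `|((L u - s *: v) *m cokermx E) 0 j|.
      rewrite mulmxBl LE // sub0r -scalemxAl 2!mxE normrN normrM ger0_norm //.
      by apply: le_trans sB; rewrite ln_ge0 // ler1n.
    rewrite mxE (le_trans (ler_norm_sum _ _ _)) // ler_sum // => i _.
    rewrite normrM ler_wpM2r // !mxE.
    have [->|ii0] := eqVneq i i0; first by rewrite !(mul0r, mulr0) subrr normr0.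
    by rewrite mul1r mulr1 (le_trans (uC i ii0)) // ler_norm.
  apply/negP; rewrite -ltNge -ltr_pdivrMr //; apply: lt_le_trans sB.
  rewrite -[X in X < _]expRK ltr_ln ?posrE ?expR_gt0 // (lt_trans (truncnS_gt _)) //.
  by rewrite ltr_nat.
exists (fun l => beta 0 l) => i ii0.
move/rowP: vE => /(_ i); rewrite !mxE ii0 -[true%:R]/1 => ->.
by apply: eq_bigr => l _; rewrite !mxE ii0 mul1r.
Qed.

End LogarithmsOfUnits.

(** * Polar coordinates *)

Section Polar.
Variable R : realType.
Implicit Types l phi : R.

(** The angle is counted in turns, so that it lives on [R / Z]. *)
Definition polar l phi : R[i] :=
  Complex (expR l * cos (2 * pi * phi)) (expR l * sin (2 * pi * phi)).

Lemma polarD l l' phi phi' : polar (l + l') (phi + phi') = polar l phi * polar l' phi'.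
Proof.
rewrite /polar; apply/eqP; rewrite eq_complex /= expRD mulrDr cosD sinD.
by apply/andP; split; apply/eqP; ring.
Qed.

Lemma polar00 : polar 0 0 = 1.
Proof. by rewrite /polar expR0 mulr0 cos0 sin0 mulr1 mulr0. Qed.

Lemma polar_ln (t : R) : 0 < t -> polar (ln t) 0 = t%:C%C.
Proof. by move=> t0; rewrite /polar lnK ?posrE // mulr0 cos0 sin0 mulr1 mulr0. Qed.

Lemma cabs_polar l phi : cabs (polar l phi) = expR l.
Proof.
rewrite /cabs normc_def /= !exprMn -mulrDr cos2Dsin2 mulr1 sqrtr_sqr.
by rewrite gtr0_norm ?expR_gt0.
Qed.

Lemma polar_neq0 l phi : polar l phi != 0.
Proof.
apply/eqP => h; have := cabs_polar l phi; rewrite h cabs0 => /esym/eqP.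
by rewrite gt_eqF ?expR_gt0.
Qed.

Lemma polarXz l phi (k : int) : polar l phi ^ k = polar (k%:~R * l) (k%:~R * phi).
Proof.
have polarX (j : nat) : polar l phi ^+ j = polar (j%:R * l) (j%:R * phi).
  elim: j => [|j IH]; first by rewrite expr0 !mul0r polar00.
  by rewrite exprS IH -polarD -natr1 !mulrDl !mul1r ![_ + (_ * _)]addrC.
case: k => k; first exact: polarX.
apply: (mulIf (polar_neq0 (k.+1%:R * l) (k.+1%:R * phi))).
rewrite -polarD NegzE -invr_expz (_ : (_ ^ _) = polar l phi ^+ k.+1) // polarX.
rewrite mulVf ?polar_neq0 // !mulrNz !mulNr -!pmulrn.
by rewrite !addNr polar00.
Qed.

Lemma polar_sum r (l phi : 'I_r -> R) :
  polar (\sum_i l i) (\sum_i phi i) = \prod_i polar (l i) (phi i).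
Proof.
elim/big_rec3: _ => [|i x y z _ <-]; [exact: polar00 | exact: polarD].
Qed.

Lemma polarP (z : R[i]) : z != 0 -> exists phi, z = polar (ln (cabs z)) phi.
Proof.
move=> z0; have c0 := cabs_gt0 z0.
pose a := complex.Re z / cabs z; pose s := complex.Im z / cabs z.
have as1 : a ^+ 2 + s ^+ 2 = 1.
  rewrite !exprMn -mulrDl exprVn -[X in X / _](sqr_sqrtr (_ : 0 <= _)) //.
    rewrite (_ : Num.sqrt _ = cabs z) ?divff ?expf_neq0 ?gt_eqF //.
    by rewrite /cabs normc_def.
  by rewrite addr_ge0 ?sqr_ge0.
have aI : -1 <= a <= 1.
  have : a ^+ 2 <= 1 by rewrite -as1 lerDl sqr_ge0.
  by rewrite -real_normK ?num_real // expr_le1 // ler_norml.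
pose psi := if 0 <= s then acos a else - acos a.
have [cpsi spsi] : cos psi = a /\ sin psi = s.
  have sa : sin (acos a) = `|s|.
    rewrite sin_acos // -sqrtr_sqr; congr Num.sqrt; rewrite -as1; ring.
  rewrite /psi; case: (lerP 0 s) => s0; split.
  - by rewrite acosK // in_itv.
  - by rewrite sa ger0_norm.
  - by rewrite cosN acosK // in_itv.
  - by rewrite sinN sa ltr0_norm // opprK.
have pi0 : 2 * pi != 0 :> R by rewrite mulf_neq0 // gt_eqF ?pi_gt0.
exists (psi / (2 * pi)).
rewrite /polar lnK ?posrE // [2 * pi * _]mulrC divfK // cpsi spsi /a /s.
rewrite ![cabs z * _]mulrC !divfK ?gt_eqF //.
by case: (z).
Qed.

Lemma polarDz l phi (k : int) : polar l (phi + k%:~R) = polar l phi.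
Proof.
have p1 : polar 0 1 = 1.
  by rewrite /polar expR0 !mul1r mulr1 mulr2n mulrDl !mul1r cos2pi sin2pi.
rewrite -[l in LHS]addr0 polarD; suff -> : polar 0 k%:~R = 1 by rewrite mulr1.
by rewrite -[k%:~R]mulr1 -[0 in LHS](mulr0 k%:~R) -polarXz p1 exp1rz.
Qed.

Lemma cos_lip (x y : R) : `|cos x - cos y| <= `|x - y|.
Proof.
wlog xy : x y / y < x => [h|].
  have [/h //|/h|->] := ltgtP y x; last by rewrite !subrr normr0.
  by rewrite distrC [X in _ <= X]distrC.
have [|c _ ->] := @MVT R cos (fun z => - sin z) y x xy (fun z _ => is_derive_cos z).
  by apply: continuous_subspaceT => z; exact: continuous_cos.
rewrite normrM normrN ler_piMl // ler_norml; apply/andP; split.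
  exact: sin_geN1.
exact: sin_le1.
Qed.

Lemma sin_lip (x y : R) : `|sin x - sin y| <= `|x - y|.
Proof.
wlog xy : x y / y < x => [h|].
  have [/h //|/h|->] := ltgtP y x; last by rewrite !subrr normr0.
  by rewrite distrC [X in _ <= X]distrC.
have [|c _ ->] := @MVT R sin (fun z => cos z) y x xy (fun z _ => is_derive_sin z).
  by apply: continuous_subspaceT => z; exact: continuous_sin.
rewrite normrM ler_piMl // ler_norml; apply/andP; split.
  exact: cos_geN1.
exact: cos_le1.
Qed.

Lemma expR_lip (L x y : R) : x <= L -> y <= L ->
  `|expR x - expR y| <= expR L * `|x - y|.
Proof.
wlog xy : x y / y <= x => [h|] xL yL.
  have [/h ->//|/ltW/h] := leP y x.
  by rewrite distrC [X in _ <= _ * X]distrC => ->.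
rewrite !ger0_norm ?subr_ge0 ?ler_expR //.
apply: (@le_trans _ _ (expR x * (x - y))); last first.
  by rewrite ler_wpM2r ?subr_ge0 // ler_expR.
have := expR_ge1Dx (y - x); rewrite expRD expRN => h.
have := ler_wpM2l (ltW (expR_gt0 x)) h; rewrite mulrCA divff ?gt_eqF ?expR_gt0 //.
by rewrite mulr1; lra.
Qed.

Lemma polar_lip (L l l' phi phi' : R) : l <= L -> l' <= L ->
  cabs (polar l phi - polar l' phi')
    <= 2 * expR L * (`|l - l'| + 2 * pi * `|phi - phi'|).
Proof.
move=> lL l'L; have eL0 : 0 < expR L by exact: expR_gt0.
have aux (f : R -> R) : (forall x, `|f x| <= 1) ->
    (forall x y, `|f x - f y| <= `|x - y|) ->
    `|expR l * f (2 * pi * phi) - expR l' * f (2 * pi * phi')|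
      <= expR L * (`|l - l'| + 2 * pi * `|phi - phi'|).
  move=> f1 flip.
  have -> : expR l * f (2 * pi * phi) - expR l' * f (2 * pi * phi') =
    (expR l - expR l') * f (2 * pi * phi)
      + expR l' * (f (2 * pi * phi) - f (2 * pi * phi')) by ring.
  rewrite (le_trans (ler_normD _ _)) // [X in _ <= X]mulrDr lerD //.
    by rewrite normrM (le_trans _ (expR_lip lL l'L)) // ler_piMr.
  rewrite normrM gtr0_norm ?expR_gt0 // ler_pM ?expR_ge0 ?ler_expR //.
  rewrite (le_trans (flip _ _)) // -mulrBr normrM ger0_norm //.
  by rewrite mulr_ge0 ?pi_ge0.
set z := _ - _.
have -> : z = (complex.Re z)%:C%C + Complex 0 1 * (complex.Im z)%:C%C by exact: complexE.
rewrite (le_trans (cabsD _ _)) // cabsM !cabs_real.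
have -> : cabs (Complex 0 1) = 1 :> R.
  by rewrite /cabs normc_def /= expr0n expr1n add0r sqrtr1.
rewrite mul1r -mulrA mulr_natl mulr2n lerD // /z /polar /=.
  apply: aux; last exact: cos_lip.
  by move=> x; rewrite ler_norml cos_geN1 cos_le1.
apply: aux; last exact: sin_lip.
by move=> x; rewrite ler_norml sin_geN1 sin_le1.
Qed.

End Polar.

(** * A quasiperiodic family of units *)

Section UnitFlow.
Variables (R : realType) (d : nat) (Phi : fieldExtType rat) (w : d.-tuple Phi).
Hypothesis d0 : (0 < d)%N.
Let b : d.+1.-tuple Phi := [tuple of 1 :: w].
Hypothesis hb : basis_of fullv b.
Variable emb : {rmorphism Phi -> R}.
Variables (sigma : 'I_d.+1 -> {rmorphism Phi -> R[i]}) (i0 : 'I_d.+1).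
Hypothesis Su : embmat b sigma \in unitmx.
Hypothesis s0 : forall x, sigma i0 x = (emb x)%:C%C.

(** The exponents are rounded-down real multiples of [ln t]: up to the
    fractional parts of these multiples, the unit scales every conjugate other
    than the distinguished one by [t], and rotates it by an angle that is
    linear in [ln t]. *)
Lemma unit_flow r : has_unit_rank Phi r ->
  exists (beta : 'I_r -> R) (lam phi : 'I_d.+1 -> 'I_r -> R) (u : R -> Phi),
  forall t, 0 < t -> [/\ lattice_units b (u t), 0 < emb (u t) &
   forall i, i != i0 -> sigma i (u t) =
     t%:C%C * polar (- \sum_l frac_part (beta l * ln t) * lam i l)
       ((\sum_l beta l * phi i l) * ln t - \sum_l frac_part (beta l * ln t) * phi i l)].
Proof.
move=> hr; have [eps [heps hgen]] := lattice_unit_family hb hr.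
have [beta0 hbeta0] := log_units_span d0 hb Su s0 heps hgen.
(* Squaring makes the distinguished conjugate positive. *)
pose eta l := eps l ^+ 2; pose beta l := beta0 l / 2.
have eta0 l : eta l != 0 by rewrite expf_neq0 // (lattice_unit_neq0 (heps l)).
have heta l : lattice_units b (eta l) by apply: lattice_unitX.
pose lam i l := ln (cabs (sigma i (eta l))).
have blam i : i != i0 -> \sum_l beta l * lam i l = 1.
  move=> ii0; rewrite -[RHS](hbeta0 i ii0); apply: eq_bigr => l _.
  rewrite /beta /lam /eta rmorphXn (ln_cabsXz 2%:Z) ?fmorph_eq0; last first.
    exact: lattice_unit_neq0 (heps l).
  by field.
have /choice[phi hphi] (il : 'I_d.+1 * 'I_r) :
    exists phi, sigma il.1 (eta il.2) = polar (lam il.1 il.2) phi.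
  by apply: polarP; rewrite fmorph_eq0 eta0.
pose n t l := Num.floor (beta l * ln t).
exists beta, lam, (fun i l => phi (i, l)), (fun t => \prod_l eta l ^ n t l) => t t0.
split.
- by apply: lattice_unit_prod => // l; apply: lattice_unitXz.
- rewrite rmorph_prod; apply: prodr_gt0 => l _.
  rewrite rmorphXz ?unitfE ?eta0 //; apply: exprz_gt0.
  rewrite /eta rmorphXn exprn_even_gt0 //=.
  by rewrite fmorph_eq0 (lattice_unit_neq0 (heps l)).
move=> i ii0; rewrite rmorph_prod.
transitivity (\prod_l polar ((n t l)%:~R * lam i l) ((n t l)%:~R * phi (i, l))).
  by apply: eq_bigr => l _; rewrite rmorphXz ?unitfE ?eta0 // (hphi (i, l)) polarXz.
rewrite -polar_sum -polar_ln // -polarD add0r; congr polar.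
  have e : ln t = \sum_l beta l * lam i l * ln t by rewrite -mulr_suml blam // mul1r.
  rewrite [X in _ = X - _]e -sumrB; apply: eq_bigr => l _.
  by rewrite /frac_part /n /=; ring.
rewrite mulr_suml -sumrB; apply: eq_bigr => l _.
by rewrite /frac_part /n /=; ring.
Qed.

(** Multiplicativity of the norm transfers the size of the other conjugates to
    the distinguished one, the norm of a unit being one in absolute value. *)
Lemma unit_flow_size r (beta : 'I_r -> R) (lam phi : 'I_d.+1 -> 'I_r -> R) (u : R -> Phi) :
  (forall t, 0 < t -> [/\ lattice_units b (u t), 0 < emb (u t) &
   forall i, i != i0 -> sigma i (u t) =
     t%:C%C * polar (- \sum_l frac_part (beta l * ln t) * lam i l)
       ((\sum_l beta l * phi i l) * ln t - \sum_l frac_part (beta l * ln t) * phi i l)]) ->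
  exists2 C : R, 1 <= C & forall t, 0 < t ->
    C^-1 <= emb (u t) * t ^+ d <= C /\
    forall i, i != i0 -> C^-1 * t <= cabs (sigma i (u t)) <= C * t.
Proof.
move=> hu; pose L := \sum_i \sum_l `|lam i l|.
have L0 : 0 <= L by do 2![apply: sumr_ge0 => ? _].
have C1 : 1 <= expR L by rewrite -expR0 ler_expR.
have hC t i : 0 < t -> i != i0 -> (expR L)^-1 * t <= cabs (sigma i (u t)) <= expR L * t.
  move=> t0 ii0; have [_ _ ->//] := hu t t0.
  rewrite cabsM cabs_real (gtr0_norm t0) cabs_polar ![t * _]mulrC !ler_pM2r //.
  rewrite -expRN !ler_expR -ler_norml normrN (le_trans (ler_norm_sum _ _ _)) //.
  rewrite /L (bigD1 i) //= -[X in X <= _]addr0 lerD //; last first.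
    by do 2![apply: sumr_ge0 => ? _].
  apply: ler_sum => l _; rewrite normrM ler_piMl //.
  by have /andP[h1 h2] := frac_part_itv (beta l * ln t); rewrite ger0_norm // ltW.
exists (expR L ^+ d) => [|t t0]; first by rewrite exprn_ege1.
have CL : expR L <= expR L ^+ d by rewrite ler_eXnr.
split; last first.
  move=> i ii0; have /andP[h1 h2] := hC t i t0 ii0; apply/andP; split.
    by apply: le_trans h1; rewrite ler_pM2r // lef_pV2 ?posrE ?exprn_gt0 ?expR_gt0.
  by apply: (le_trans h2); rewrite ler_pM2r.
have [hut eu0 _] := hu t t0.
have := norm_det_mulmat hb Su 1 (u t); rewrite expr1n mul1r scale1r -ratr_norm.
rewrite (lattice_unit_det hb hut) rmorph1 (bigD1 i0) //= s0 cabs_real (gtr0_norm eu0).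
set p := \prod_(i | _) _ => ep.
have card_i0 : #|[pred i : 'I_d.+1 | i != i0]| = d by rewrite cardC1 card_ord.
have p_le : p <= expR L ^+ d * t ^+ d.
  rewrite -exprMn -[X in _ ^+ X]card_i0 -prodr_const; apply: ler_prod => i ii0.
  by rewrite cabs_ge0 (proj2 (andP (hC t i t0 ii0))).
have p_ge : (expR L)^-1 ^+ d * t ^+ d <= p.
  rewrite -exprMn -[X in _ ^+ X]card_i0 -prodr_const; apply: ler_prod => i ii0.
  rewrite (proj1 (andP (hC t i t0 ii0))) andbT mulr_ge0 ?invr_ge0 ?expR_ge0 ?ltW //.
have td0 : 0 < t ^+ d by rewrite exprn_gt0.
have eL0 : 0 < expR L ^+ d by rewrite exprn_gt0 ?expR_gt0.
apply/andP; split.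
  by rewrite -[leLHS]mul1r ler_pdivrMr // ep -mulrA ler_pM2l // [t ^+ d * _]mulrC.
by rewrite -[leRHS]mul1r -ler_pdivrMr // ep -mulrA ler_pM2l // mulrC -exprVn.
Qed.


End UnitFlow.

(** * Counting lattice points in convex sets *)

Section Counting.
Variable R : realType.

Lemma card_ord_itv n p q : #|[pred k : 'I_n | (p <= k < q)%N]| = (minn q n - p)%N.
Proof.
rewrite -sum1_card (eq_bigl (fun k : 'I_n => (p <= k)%N && (k < minn q n)%N)); last first.
  by move=> k; rewrite inE leq_min ltn_ord andbT.
rewrite -(big_mkord (fun k => (p <= k)%N && (k < minn q n)%N) (fun=> 1%N)).
rewrite -(@big_nat_widen _ _ _ 0 (minn q n) n (fun k => p <= k)%N) ?geq_minr //.
have [pq|qp] := leqP p (minn q n).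
  transitivity (\sum_(p <= i < minn q n) 1)%N; last by rewrite sum_nat_const_nat muln1.
  by rewrite [RHS](big_nat_widenl p 0) //.
have /eqP -> : (minn q n - p == 0)%N by rewrite subn_eq0 ltnW.
rewrite big_nat_cond big1 // => k /andP[/andP[_ k1] k2].
by have := leq_trans k1 (leq_trans (ltnW qp) k2); rewrite ltnn.
Qed.

Lemma nat_ceil_exists (a : R) :
  exists p : nat, (forall k, (a <= k%:R) = (p <= k)%N) /\ (0 <= a -> p%:R < a + 1).
Proof.
have ex : exists k, a <= k%:R by exists (Num.truncn a).+1; rewrite ltW // truncnS_gt.
case: (ex_minnP ex) => p ap pmin; exists p; split=> [k|a0].
  apply/idP/idP => [/pmin//|]; rewrite -(ler_nat R); exact: le_trans.
case: p pmin {ap} => [|p] pmin; first by rewrite ltr_wpDl.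
rewrite -natr1 ltrD2r ltNge; apply/negP => /pmin; by rewrite ltnn.
Qed.

Lemma nat_floor_exists (c : R) : 0 <= c ->
  exists q : nat, (forall k, (k%:R <= c) = (k < q)%N) /\ q%:R <= c + 1.
Proof.
move=> c0; exists (Num.truncn c).+1; split=> [k|].
  by rewrite ltnS truncn_ge_nat.
by rewrite -natr1 lerD2r truncn_le.
Qed.

Lemma card_window_le n (a c : R) : a <= c ->
  #|[pred k : 'I_n | a <= k%:R <= c]|%:R <= c - a + 1.
Proof.
move=> ac; have [c0|c0] := ltP c 0.
  rewrite eq_card0; first by rewrite mulr0n; lra.
  move=> k; rewrite inE; by apply/negbTE/negP => /andP[_ h]; have := le_lt_trans h c0; rewrite ltNge ler0n.
have [p [pP _]] := nat_ceil_exists a; have [q [qP qc]] := nat_floor_exists c0.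
rewrite (eq_card (B := [pred k : 'I_n | (p <= k < q)%N])); last first.
  by move=> k; rewrite !inE pP qP.
rewrite card_ord_itv.
have ap : a <= p%:R by rewrite pP.
have [pq|qp] := leqP p (minn q n).
  rewrite natrB //; have : (minn q n)%:R <= q%:R :> R by rewrite ler_nat geq_minl.
  lra.
have /eqP -> : (minn q n - p == 0)%N by rewrite subn_eq0 ltnW.
by rewrite mulr0n; lra.
Qed.

Lemma card_itv_approx n (a c : R) : 0 <= a -> a <= c -> c <= n%:R ->
  c - a - 1 <= #|[pred k : 'I_n | a <= k%:R < c]|%:R <= c - a + 1.
Proof.
move=> a0 ac cn; have c0 := le_trans a0 ac.
have [p [pP pa]] := nat_ceil_exists a; have [q [qP qc]] := nat_ceil_exists c.
rewrite (eq_card (B := [pred k : 'I_n | (p <= k < q)%N])); last first.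
  by move=> k; rewrite !inE pP ltNge qP -ltnNge.
have qn : (q <= n)%N by rewrite -qP.
have ap : a <= p%:R by rewrite pP.
have cq : c <= q%:R by rewrite qP.
have pq : (p <= q)%N by rewrite -pP (le_trans ac).
rewrite card_ord_itv (minn_idPl qn) natrB //.
have := pa a0; have := qc c0; lra.
Qed.

(** Points at which membership in an interval changes under a displacement
    of at most [delta] lie within [delta] of an endpoint. *)
Lemma interval_exchange n (g g' : 'I_n -> R) (I : set R) (delta B : R) :
  is_interval I -> (forall k, `|g k - g' k| <= delta) ->
  (forall e, #|[pred k | `|g k - e| <= delta]|%:R <= B) ->
  #|[pred k | (g k \in I) != (g' k \in I)]|%:R <= 2 * B.
Proof.
move=> iI gg' gB.
have near_end x y : I x -> ~ I y -> `|x - y| <= delta ->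
    (forall z, (x <= z <= y) || (y <= z <= x) -> `|z - sup I| <= delta) \/
    (forall z, (x <= z <= y) || (y <= z <= x) -> `|z - inf I| <= delta).
  move=> Ix Iy xy.
  have [lt|lt|e] := ltgtP x y; last by rewrite e in Ix.
  - left=> z zxy.
    have uy : ubound I y.
      move=> s Is; rewrite leNgt; apply/negP => ys; apply: Iy.
      by apply: iI Ix Is _ _; rewrite !ltW.
    have h1 : sup I <= y by apply: ge_sup => //; exists x.
    have h2 : x <= sup I by apply: ub_le_sup => //; exists y.
    have {}zxy : x <= z <= y by case/orP: zxy => // /andP[? ?]; lra.
    by move: xy zxy; rewrite !ler_norml; lra.
  - right=> z zxy.
    have uy : lbound I y.
      move=> s Is; rewrite leNgt; apply/negP => ys; apply: Iy.
      by apply: iI Is Ix _ _; rewrite !ltW.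
    have h1 : y <= inf I by apply: lb_le_inf => //; exists x.
    have h2 : inf I <= x by apply: ge_inf => //; exists y.
    have {}zxy : y <= z <= x by case/orP: zxy => // /andP[? ?]; lra.
    by move: xy zxy; rewrite !ler_norml; lra.
apply: (@le_trans _ _ (#|[pred k | `|g k - sup I| <= delta]|%:R
    + #|[pred k | `|g k - inf I| <= delta]|%:R)); last first.
  by rewrite mulr_natl mulr2n lerD.
rewrite -natrD ler_nat -cardUI.
apply: leq_trans (leq_addr _ _); apply: subset_leq_card; apply/fintype.subsetP => k.
have in1 (x y : R) : (x <= x <= y) || (y <= x <= x) by rewrite !lexx andbT le_total.
have in2 (x y : R) : (x <= y <= y) || (y <= y <= x) by rewrite !lexx andbT le_total.
rewrite !inE; case: (boolP (g k \in I)); case: (boolP (g' k \in I)) => // h1 h2 _.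
  have [h|h] := near_end (g k) (g' k) (set_mem h2) (fun h => negP h1 (mem_set h)) (gg' k).
    by rewrite (h _ (in1 _ _)).
  by rewrite (h _ (in1 _ _)) orbT.
have := near_end (g' k) (g k) (set_mem h1) (fun h => negP h2 (mem_set h)).
rewrite distrC => /(_ (gg' k)) [h|h].
  by rewrite (h _ (in2 _ _)).
by rewrite (h _ (in2 _ _)) orbT.
Qed.

End Counting.

Section Exchange.
Variables (R : realType) (d : nat) (K : set 'rV[R]_d).
Hypothesis Kconvex : convex_set K.

Lemma convex_set_comb (x y : 'rV[R]_d) (s : R) : K x -> K y -> 0 <= s <= 1 ->
  K (s *: x + (1 - s) *: y).
Proof.
move=> Kx Ky /andP[s0 s1].
exact: set_mem (Kconvex (Itv01 s0 s1) (mem_set Kx) (mem_set Ky)).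
Qed.

Lemma convex_line_interval (i : 'I_d) (p : 'I_d -> R) :
  is_interval [set z | K (\row_j if j == i then z else p j)].
Proof.
move=> x y /= Kx Ky z /andP[xz zy].
have [e|xy] := eqVneq x y.
  by have -> : z = x by apply/eqP; rewrite eq_le xz e zy.
have lt : 0 < y - x by rewrite subr_gt0 lt_neqAle xy (le_trans xz).
have s01 : 0 <= (y - z) / (y - x) <= 1.
  apply/andP; split; first by apply: divr_ge0 (ltW lt); rewrite subr_ge0.
  by rewrite ler_pdivrMr // mul1r lerD2l lerN2.
have := convex_set_comb Kx Ky s01; congr K; apply/rowP => j; rewrite !mxE.
by case: eqP => _; field; rewrite gt_eqF.
Qed.

Variable n : nat.
Local Notation T := {ffun 'I_d -> 'I_n}.

Definition grid_point (g : 'I_d -> 'I_n -> R) (m : T) : 'rV[R]_d :=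
  \row_i g i (m i).

Definition subst_coord (m : T) (i : 'I_d) (k : 'I_n) : T :=
  [ffun j => if j == i then k else m j].

(** Double counting: swapping the new value with the [i]-th coordinate is an
    involution on the pairs of a grid point and a new value. *)
Lemma sum_subst_coord (i : 'I_d) (f : T -> nat) :
  (\sum_m \sum_k f (subst_coord m i k) = n * \sum_m f m)%N.
Proof.
rewrite pair_big /=.
pose sw (p : T * 'I_n) : T * 'I_n := (subst_coord p.1 i p.2, p.1 i).
have swK : involutive sw.
  move=> [m k]; rewrite /sw /subst_coord /= ffunE eqxx; congr pair.
  by apply/ffunP => j; rewrite !ffunE; case: eqP => // ->.
rewrite (reindex_inj (inv_inj swK)) /=.
under eq_bigr => p _.
  have -> : subst_coord (subst_coord p.1 i p.2) i (p.1 i) = p.1.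
    by apply/ffunP => j; rewrite !ffunE; case: eqP => // ->.
  over.
rewrite -(pair_big xpredT xpredT (fun m (k : 'I_n) => f m)) /= big_distrr /=.
by apply: eq_bigr => m _; rewrite sum_nat_const card_ord.
Qed.

(** Moving one coordinate of all grid points slightly changes membership in a
    convex set only near the two ends of each line in that direction. *)
Lemma convex_exchange1 (i : 'I_d) (g g' : 'I_d -> 'I_n -> R) (delta B : R) :
  (forall j, j != i -> g j =1 g' j) ->
  (forall k, `|g i k - g' i k| <= delta) ->
  (forall e, #|[pred k | `|g i k - e| <= delta]|%:R <= B) ->
  n%:R * #|[pred m | (grid_point g m \in K) != (grid_point g' m \in K)]|%:R
    <= n%:R ^+ d * (2 * B).
Proof.
move=> gE gg' gB.
set bad := [pred m | _].
have -> : #|bad| = (\sum_m bad m)%N by rewrite -sum1_card big_mkcond.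
rewrite -natrM -(sum_subst_coord i) natr_sum.
have -> : n%:R ^+ d * (2 * B) = \sum_(m : T) (2 * B).
  by rewrite sumr_const card_ffun !card_ord -natrX mulr_natl.
apply: ler_sum => m _.
pose I := [set z | K (\row_j if j == i then z else g j (m j))].
have -> : (\sum_k bad (subst_coord m i k) = #|[pred k | (g i k \in I) != (g' i k \in I)]|)%N.
  rewrite -sum1_card [RHS]big_mkcond; apply: eq_bigr => k _; rewrite /bad !inE.
  have -> : grid_point g (subst_coord m i k) = \row_j if j == i then g i k else g j (m j).
    by apply/rowP => j; rewrite !mxE ffunE; case: eqP => // ->.
  have -> : grid_point g' (subst_coord m i k) = \row_j if j == i then g' i k else g j (m j).
    apply/rowP => j; rewrite !mxE ffunE; case: eqP => [->//|/eqP/gE e]; by rewrite e.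
  have -> : (g i k \in I) = (\row_j (if j == i then g i k else g j (m j)) \in K).
    by apply/idP/idP => /set_mem h; apply/mem_set.
  have -> : (g' i k \in I) = (\row_j (if j == i then g' i k else g j (m j)) \in K).
    by apply/idP/idP => /set_mem h; apply/mem_set.
  by case: (_ != _).
by apply: interval_exchange gg' gB; exact: convex_line_interval.
Qed.

(** The coordinates are moved one at a time, through hybrid grids. *)
Lemma convex_exchange (g g' : 'I_d -> 'I_n -> R) (delta B : R) :
  (forall i k, `|g i k - g' i k| <= delta) ->
  (forall i e, #|[pred k | `|g i k - e| <= delta]|%:R <= B) ->
  n%:R * #|[pred m | (grid_point g m \in K) != (grid_point g' m \in K)]|%:R
    <= d%:R * (n%:R ^+ d * (2 * B)).
Proof.
move=> gg' gB.
pose h j (i : 'I_d) := if (i < j)%N then g' i else g i.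
have hd : grid_point g' = grid_point (h d).
  by apply/funext => m; apply/rowP => i; rewrite !mxE /h ltn_ord.
have step j : (j <= d)%N ->
  n%:R * #|[pred m | (grid_point g m \in K) != (grid_point (h j) m \in K)]|%:R
    <= j%:R * (n%:R ^+ d * (2 * B)).
  elim: j => [|j IH] jd.
    rewrite mul0r eq_card0 ?mulr0 // => m; apply/negbTE; rewrite inE negbK.
    have -> : grid_point (h 0%N) m = grid_point g m by apply/rowP => i; rewrite !mxE /h.
    exact: eqxx.
  rewrite -natr1 mulrDl mul1r; apply: le_trans (lerD (IH (ltnW jd)) (convex_exchange1
     (i := Ordinal jd) (g := h j) (g' := h j.+1) (delta := delta) (B := B) _ _ _)).
  - rewrite -mulrDr ler_wpM2l // -natrD ler_nat -cardUI.
    apply: leq_trans (leq_addr _ _); apply: subset_leq_card; apply/fintype.subsetP => m.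
    by rewrite !inE; case: (_ \in K); case: (_ \in K); case: (_ \in K).
  - move=> i ij k; rewrite /h; suff -> : (i < j.+1)%N = (i < j)%N by [].
    by rewrite ltnS [in RHS]ltn_neqAle; have -> : i != j :> nat by [].
  - by move=> k; rewrite /h /= ltnn ltnSn.
  - by move=> e; rewrite /h /= ltnn.
by rewrite hd; apply: step.
Qed.

End Exchange.

Lemma card_ffun_forall d (T : finType) (A : 'I_d -> pred T) :
  (#|[pred m : {ffun 'I_d -> T} | [forall i, A i (m i)]]| = \prod_i #|A i|)%N.
Proof.
under [RHS]eq_bigr do rewrite -sum1_card big_mkcond.
rewrite bigA_distr_bigA /= -sum1_card big_mkcond; apply: eq_bigr => f _ /=.
rewrite inE; case: forallP => [h|h].
  by rewrite big1 // => i _; rewrite unfold_in h.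
apply/esym/eqP; rewrite -leqn0 leqNgt; apply/negP => h'; apply: h => i.
by move: h'; rewrite (bigD1 i) //= unfold_in; case: (A i (f i)).
Qed.

Lemma card_sub_le (T : finType) (P Q : pred T) (R : realType) :
  `|#|P|%:R - #|Q|%:R : R| <= #|[pred m | P m != Q m]|%:R.
Proof.
have aux (P' Q' : pred T) : (#|P'| <= #|Q'| + #|[pred m | P' m != Q' m]|)%N.
  rewrite -cardUI; apply: leq_trans (leq_addr _ _); apply: subset_leq_card.
  by apply/fintype.subsetP => m; rewrite !inE /in_mem /=; case: (P' m); case: (Q' m).
have h1 := aux P Q; have h2 := aux Q P.
have e : #|[pred m | Q m != P m]| = #|[pred m | P m != Q m]|.
  by apply: eq_card => m; rewrite !inE eq_sym.
rewrite e in h2; rewrite ler_distlC; apply/andP; split.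
  by rewrite lerBlDr -natrD ler_nat.
by rewrite -natrD ler_nat.
Qed.

Section PatternSets.
Variables (R : realType) (d : nat) (K : set 'rV[R]_d) (I : finType).
Hypothesis Kconvex : convex_set K.

(** To have given candidates as gaps is a condition of this kind on the rescaled
    lattice point. *)
Definition pattern_set (c : I -> 'rV[R]_d) (Q : pred {ffun I -> bool}) (v : 'rV[R]_d) : bool :=
  (v \in K) && Q [ffun x => (v + c x) \in K].

Lemma pattern_exchange n (g g' : 'I_d -> 'I_n -> R) (c c' : I -> 'rV[R]_d)
    Q (t delta0 : R) (delta : I -> R) :
  (forall i k, `|g i k - g' i k| <= delta0) ->
  (forall x i k, `|g i k + c x 0 i - (g' i k + c' x 0 i)| <= delta x) ->
  (forall i e dl, 0 <= dl -> #|[pred k | `|g i k - e| <= dl]|%:R <= 2 * dl * t + 1) ->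
  0 <= delta0 -> (forall x, 0 <= delta x) ->
  n%:R * #|[pred m | pattern_set c Q (grid_point g m) != pattern_set c' Q (grid_point g' m)]|%:R
  <= d%:R * n%:R ^+ d * 2 * (2 * delta0 * t + 1 + \sum_x (2 * delta x * t + 1)).
Proof.
move=> gg' gc' gB dl0 dl.
pose gx x (i : 'I_d) k := g i k + c x 0 i; pose gx' x (i : 'I_d) k := g' i k + c' x 0 i.
have gxE x m : grid_point (gx x) m = grid_point g m + c x.
  by apply/rowP => i; rewrite !mxE.
have gxE' x m : grid_point (gx' x) m = grid_point g' m + c' x.
  by apply/rowP => i; rewrite !mxE.
pose b0 m := (grid_point g m \in K) != (grid_point g' m \in K).
pose bx x m := (grid_point (gx x) m \in K) != (grid_point (gx' x) m \in K).
have le : (#|[pred m | pattern_set c Q (grid_point g m) != pattern_set c' Q (grid_point g' m)]|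
    <= #|[pred m | b0 m]| + \sum_x #|[pred m | bx x m]|)%N.
  rewrite -!sum1_card big_mkcond [X in (_ <= X + _)%N]big_mkcond /=.
  under [X in (_ <= _ + X)%N]eq_bigr do rewrite -sum1_card big_mkcond.
  rewrite exchange_big /= -big_split /=; apply: leq_sum => m _; rewrite !inE.
  case: ifP => // /negP neq.
  case h0 : (b0 m); first by rewrite addSn.
  have [x hx] : exists x, bx x m.
    apply/existsP; apply: contraT; rewrite negb_exists => /forallP h; case: neq.
    move/negbT: h0; rewrite negbK => /eqP h0; rewrite /pattern_set h0; apply/eqP.
    congr (_ && Q _); apply/ffunP => x; rewrite !ffunE.
    by have := h x; rewrite negbK /bx gxE gxE' => /eqP.
  by rewrite (bigD1 x) //= inE hx addnCA.
have le0 := convex_exchange Kconvex gg' (fun i e => gB i e _ dl0).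
have lex x : n%:R * #|[pred m | bx x m]|%:R <= d%:R * (n%:R ^+ d * (2 * (2 * delta x * t + 1))).
  apply: (convex_exchange Kconvex (delta := delta x)) => [i k|i e]; first exact: gc'.
  apply: le_trans (gB i (e - c x 0 i) _ (dl x)).
  by rewrite ler_nat; apply: subset_leq_card; apply/fintype.subsetP => k; rewrite !inE opprB addrA.
apply: (@le_trans _ _ (n%:R * (#|[pred m | b0 m]| + \sum_x #|[pred m | bx x m]|)%N%:R)).
  by rewrite ler_wpM2l // ler_nat.
rewrite natrD natr_sum mulrDr mulr_sumr mulrDr lerD //.
  by rewrite (le_trans le0) // !mulrA.
by rewrite mulr_sumr ler_sum // => x _; rewrite (le_trans (lex x)) // !mulrA.
Qed.

Section Density.
Hypothesis d0 : (0 < d)%N.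
Variable B : R.
Hypothesis B1 : 1 <= B.
Hypothesis KB : forall v, K v -> forall i, `|v 0 i| <= B - 1.

(** The margin beyond [B * t] leaves room for the rounding in [coarsen]. *)
Definition grid_radius (t : R) : nat := (Num.truncn (B * t)).+3.
Definition side (t : R) : nat := (grid_radius t).*2.+1.
Definition grid_coord (t : R) (k : nat) : R := (k%:R - (grid_radius t)%:R) / t.
Definition grid (t : R) : 'I_d -> 'I_(side t) -> R := fun _ k => grid_coord t k.
Arguments grid : clear implicits.

Definition pattern_count (t : R) c Q : nat :=
  #|[pred m | pattern_set c Q (grid_point (grid t) m)]|.

Let B0 : 0 < B. Proof. exact: lt_le_trans B1. Qed.

Lemma grid_radius_bounds t : 0 <= t -> B * t + 2 < (grid_radius t)%:R <= B * t + 3.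
Proof.
move=> t0; have Bt0 : 0 <= B * t by rewrite mulr_ge0 // ltW.
rewrite /grid_radius -!natr1; have := truncn_itv Bt0; rewrite -natr1; lra.
Qed.

Lemma natr_side t : (side t)%:R = 2 * (grid_radius t)%:R + 1 :> R.
Proof. by rewrite /side -addn1 natrD -mul2n natrM. Qed.

Lemma side_le t : 1 <= t -> (side t)%:R <= (2 * B + 7) * t.
Proof.
move=> t1; have t0 : 0 <= t by apply: le_trans t1.
have /andP[_ h] := grid_radius_bounds t0.
rewrite natr_side; nra.
Qed.

Lemma grid_window t i e dl : 0 < t -> 0 <= dl ->
  #|[pred k | `|grid t i k - e| <= dl]|%:R <= 2 * dl * t + 1.
Proof.
move=> t0 dl0.
rewrite (eq_card (B := [pred k : 'I_(side t) | (grid_radius t)%:R + t * (e - dl) <= k%:R <= (grid_radius t)%:R + t * (e + dl)])).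
  apply: le_trans (card_window_le _ _) _; last by lra.
  by rewrite lerD2l ler_pM2l //; lra.
move=> k; rewrite !inE /grid /grid_coord ler_distl.
rewrite ler_pdivlMr // ler_pdivrMr // [t * _]mulrC [t * (e + _)]mulrC.
by rewrite lerBrDl lerBlDl.
Qed.

(** A factor [2] for the ends of a line, [d] for the directions, and the rest for
    the number of lines in one direction. *)
Definition exchange_cst : R := d%:R * (2 * B + 7) ^+ d.-1 * 2.

Lemma exchange_cst_ge0 : 0 <= exchange_cst.
Proof. by rewrite /exchange_cst !mulr_ge0 // exprn_ge0 //; have := B0; lra. Qed.

Lemma grid_exchange t (g' : 'I_d -> 'I_(side t) -> R) (c c' : I -> 'rV[R]_d) Q delta0 (delta : I -> R) :
  1 <= t ->
  (forall i k, `|grid t i k - g' i k| <= delta0) ->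
  (forall x i k, `|grid t i k + c x 0 i - (g' i k + c' x 0 i)| <= delta x) ->
  0 <= delta0 -> (forall x, 0 <= delta x) ->
  `|(pattern_count t c Q)%:R - #|[pred m | pattern_set c' Q (grid_point g' m)]|%:R|
  <= exchange_cst * t ^+ d * (2 * delta0 + t^-1 + \sum_x (2 * delta x + t^-1)).
Proof.
move=> t1 h1 h2 dl0 dl; have t0 : 0 < t by apply: lt_le_trans t1.
apply: le_trans (card_sub_le _ _ _) _.
have := pattern_exchange Q h1 h2 (fun i e dl => @grid_window t i e dl t0) dl0 dl.
set X := #|_|%:R; set n := (side t)%:R.
have -> : 2 * delta0 * t + 1 + \sum_x (2 * delta x * t + 1)
   = t * (2 * delta0 + t^-1 + \sum_x (2 * delta x + t^-1)).
  rewrite mulrDr mulr_sumr; congr (_ + _).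
    by rewrite mulrDr divff ?gt_eqF // mulrC.
  by apply: eq_bigr => x _; rewrite mulrDr divff ?gt_eqF // mulrC.
set Y := 2 * delta0 + t^-1 + _.
have Y0 : 0 <= Y.
  have t'0 : 0 <= t^-1 by rewrite invr_ge0 ltW.
  apply: addr_ge0; first by rewrite addr_ge0 ?mulr_ge0.
  by apply: sumr_ge0 => x _; rewrite addr_ge0 ?mulr_ge0.
have n0 : 0 < n by rewrite ltr0n.
have -> : d%:R * n ^+ d * 2 * (t * Y) = n * (d%:R * n ^+ d.-1 * 2 * (t * Y)).
  by rewrite -[in n ^+ d](prednK d0) exprS; ring.
rewrite ler_pM2l // => /le_trans; apply.
have -> : exchange_cst * t ^+ d * Y = d%:R * ((2 * B + 7) * t) ^+ d.-1 * 2 * (t * Y).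
  by rewrite /exchange_cst exprMn -[in t ^+ d](prednK d0) exprS; ring.
have tY : 0 <= t * Y by rewrite mulr_ge0 // ltW.
have Bt : 0 <= (2 * B + 7) * t by rewrite mulr_ge0 ?(ltW t0) //; have := B0; lra.
apply: ler_wpM2r => //; apply: ler_wpM2r => //; apply: ler_wpM2l => //.
by apply: lerXn2r; rewrite ?nnegrE ?(ltW n0) // side_le.
Qed.

Lemma pow_dist1 (x : R) n : 0 <= x <= 2 -> `|x ^+ n - 1| <= (2 ^+ n - 1) * `|x - 1|.
Proof.
move=> /andP[x0 x2]; elim: n => [|n IH]; first by rewrite !expr0 !subrr normr0 mul0r.
have -> : x ^+ n.+1 - 1 = x * (x ^+ n - 1) + (x - 1) by rewrite exprS; ring.
have -> : (2 ^+ n.+1 - 1) * `|x - 1| = 2 * ((2 ^+ n - 1) * `|x - 1|) + `|x - 1|.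
  by rewrite exprS; ring.
rewrite (le_trans (ler_normD _ _)) // lerD2r normrM ger0_norm //.
by apply: ler_pM.
Qed.

(** Rounding from the grid of mesh [1 / N] down to the grid of mesh [1 / t]. *)
Definition coarsen (N t : R) (k : 'I_(side N)) : 'I_(side t) :=
  inord (absz (Num.floor (t * grid_coord N k) + (grid_radius t)%:Z)).

Section Compare.
Variables N t : R.
Hypotheses (t1 : 1 <= t) (Nt : 3 * t <= N) (Ntt : t ^+ 2 <= N).

Let t0 : 0 < t. Proof. exact: lt_le_trans t1. Qed.
Let N1 : 1 <= N. Proof. by have := t1; have := Nt; lra. Qed.
Let N0 : 0 < N. Proof. exact: lt_le_trans N1. Qed.

Lemma coarsen_val (k : 'I_(side N)) :
  ((@coarsen N t k : nat)%:Z = Num.floor (t * grid_coord N k) + (grid_radius t)%:Z)%R.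
Proof.
have /andP[hN1 hN2] := grid_radius_bounds (ltW N0); have /andP[ht1 ht2] := grid_radius_bounds (ltW t0).
have kN : (k : nat)%:R <= 2 * (grid_radius N)%:R :> R.
  by rewrite -natrM ler_nat mul2n -ltnS ltn_ord.
have k0 : 0 <= (k : nat)%:R :> R by [].
set y := grid_coord N k.
have yP : y * N = (k : nat)%:R - (grid_radius N)%:R by rewrite /y /grid_coord divfK ?gt_eqF.
have tyN : - (B * t + 1) <= t * y <= B * t + 1.
  have g1 := ler_wpM2l (ltW t0) hN2; have g2 := ler_wpM2l (ltW t0) kN.
  have g3 := ler_wpM2l (ltW t0) k0; have g4 := Nt.
  by apply/andP; split; rewrite -(ler_pM2r N0) -[t * y * N]mulrA yP; lra.
have /andP[f1 f2] := floor_itv (t * y).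
rewrite intrD in f2.
have fge : 0 <= Num.floor (t * y) + (grid_radius t)%:Z.
  by rewrite -(ler0z R) intrD -pmulrn; lra.
have flt : Num.floor (t * y) + (grid_radius t)%:Z < (side t)%:Z.
  rewrite -(ltr_int R) intrD -!pmulrn natr_side; lra.
rewrite -(gez0_abs fge) in flt *; rewrite ltz_nat in flt.
by rewrite /coarsen inordK.
Qed.

Lemma coarsen_coord (k : 'I_(side N)) :
  grid_coord t (@coarsen N t k) = (Num.floor (t * grid_coord N k))%:~R / t.
Proof.
rewrite /grid_coord; congr (_ / t).
by have /(congr1 (intr : int -> R)) := coarsen_val k; rewrite intrD -!pmulrn => ->; rewrite addrK.
Qed.

Lemma coarsen_near (k : 'I_(side N)) :
  `|grid_coord N k - grid_coord t (@coarsen N t k)| <= t^-1.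
Proof.
rewrite coarsen_coord; set y := grid_coord N k.
have -> : y - (Num.floor (t * y))%:~R / t = (t * y - (Num.floor (t * y))%:~R) / t.
  by field; rewrite gt_eqF.
rewrite normrM [X in _ * X]gtr0_norm ?invr_gt0 // ler_piMl ?invr_ge0 ?(ltW t0) //.
have /andP[f1 f2] := floor_itv (t * y); rewrite intrD in f2.
by rewrite ler_norml; lra.
Qed.

(** The bound [B - 1] instead of [B] keeps the fiber away from the border of the
    finer grid, which would truncate it. *)
Lemma coarsen_fiber (j : 'I_(side t)) : `|grid_coord t j| <= B - 1 ->
  N / t - 1 <= #|[pred k | @coarsen N t k == j]|%:R <= N / t + 1.
Proof.
move=> jB; have /andP[hN1 hN2] := grid_radius_bounds (ltW N0).
pose z := (j : nat)%:R - (grid_radius t)%:R : R.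
have zB : - ((B - 1) * t) <= z <= (B - 1) * t.
  move: jB; rewrite /grid_coord -/z normrM [X in _ * X]gtr0_norm ?invr_gt0 //.
  by rewrite ler_pdivrMr // ler_norml.
pose a := (grid_radius N)%:R + (N / t) * z : R.
pose c := (grid_radius N)%:R + (N / t) * (z + 1) : R.
have Nt0 : 0 < N / t by rewrite divr_gt0.
have NtE : N / t * t = N by rewrite divfK ?gt_eqF.
have Nt_le : N / t <= N by rewrite ler_pdivrMr // ler_peMr // ltW.
have qB : N / t * ((B - 1) * t) = (B - 1) * N by rewrite -[in RHS]NtE; ring.
have /andP[z1 z2] : - ((B - 1) * N) <= N / t * z <= (B - 1) * N.
  by rewrite -qB -mulrN !ler_pM2l.
have a0 : 0 <= a by rewrite /a; have := N0; lra.
have ac : a <= c by rewrite /a /c; lra.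
have cN : c <= (side N)%:R by rewrite /c natr_side; lra.
rewrite (eq_card (B := [pred k : 'I_(side N) | a <= (k : nat)%:R < c])).
  have -> : N / t = c - a by rewrite /a /c; ring.
  exact: card_itv_approx.
move=> k; rewrite !inE.
have -> : (coarsen t k == j) = (Num.floor (t * grid_coord N k) == (j : nat)%:Z - (grid_radius t)%:Z).
  by rewrite [RHS]eq_sym subr_eq -(inj_eq val_inj) /= -eqz_nat coarsen_val eq_sym.
rewrite floor_eq !intrD intrN -!pmulrn -/z /grid_coord.
have -> : t * (((k : nat)%:R - (grid_radius N)%:R) / N) = ((k : nat)%:R - (grid_radius N)%:R) / (N / t).
  by field; rewrite !gt_eqF.
by rewrite ler_pdivlMr // ltr_pdivrMr // /a /c lerBrDl ltrBlDl ![_ * (N / t)]mulrC.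
Qed.

Lemma coarsen_fibers (m : {ffun 'I_d -> 'I_(side t)}) :
  (forall i, `|grid_coord t (m i)| <= B - 1) ->
  (N / t - 1) ^+ d <= #|[pred m' : {ffun 'I_d -> 'I_(side N)} | [ffun i => @coarsen N t (m' i)] == m]|%:R
    <= (N / t + 1) ^+ d.
Proof.
move=> mB.
have -> : (#|[pred m' : {ffun 'I_d -> 'I_(side N)} | [ffun i => @coarsen N t (m' i)] == m]|
  = \prod_i #|[pred k | @coarsen N t k == m i]|)%N.
  rewrite -card_ffun_forall; apply: eq_card => m'; rewrite !inE.
  apply/eqP/forallP => [<- i|h]; first by rewrite /= ffunE.
  by apply/ffunP => i; rewrite ffunE; apply/eqP; exact: h.
rewrite natr_prod.
have cE : d = #|'I_d| by rewrite card_ord.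
have Nt1 : 1 <= N / t by rewrite ler_pdivlMr // mul1r; have := Nt; have := t1; lra.
rewrite [X in _ ^+ X <= _]cE [X in _ <= _ ^+ X]cE -!prodr_const.
apply/andP; split; apply: ler_prod => i _; have /andP[h1 h2] := coarsen_fiber (mB i).
  by rewrite h1 subr_ge0 Nt1.
by rewrite h2 andbT.
Qed.

Lemma card_coarsen (S : pred 'rV[R]_d) : (forall v, S v -> K v) ->
  (N / t - 1) ^+ d * #|[pred m | S (grid_point (grid t) m)]|%:R
  <= #|[pred m | S (grid_point (fun _ k => grid_coord t (@coarsen N t k)) m)]|%:R
  <= (N / t + 1) ^+ d * #|[pred m | S (grid_point (grid t) m)]|%:R.
Proof.
move=> SK.
have -> : (#|[pred m | S (grid_point (fun _ k => grid_coord t (@coarsen N t k)) m)]| =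
  \sum_(m | S (grid_point (grid t) m))
    #|[pred m' : {ffun 'I_d -> 'I_(side N)} | [ffun i => @coarsen N t (m' i)] == m]|)%N.
  rewrite -sum1_card (partition_big (fun m' : {ffun 'I_d -> 'I_(side N)} => [ffun i => @coarsen N t (m' i)])
     (fun m => S (grid_point (grid t) m))) /=.
    apply: eq_bigr => m Sm; rewrite -sum1_card; apply: eq_bigl => m'; rewrite !inE.
    case: eqP => [e|]; last by rewrite andbF.
    rewrite andbT -[RHS]/true -[RHS]Sm; congr S; apply/rowP => i; rewrite !mxE -e ffunE //.
  move=> m'; rewrite inE; congr (is_true (S _)); apply/rowP => i; rewrite !mxE /grid ffunE //.
have fib m : S (grid_point (grid t) m) ->
    (N / t - 1) ^+ d <= #|[pred m' : {ffun 'I_d -> 'I_(side N)} | [ffun i => @coarsen N t (m' i)] == m]|%:R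
      <= (N / t + 1) ^+ d.
  move=> Sm; apply: coarsen_fibers => i.
  by have := KB (SK _ Sm) i; rewrite mxE.
rewrite natr_sum; set A := #|_|%:R.
have AE x : x * A = \sum_(m | S (grid_point (grid t) m)) x.
  by rewrite sumr_const mulr_natr.
by rewrite !AE; apply/andP; split; apply: ler_sum => m /fib /andP[].
Qed.

Lemma pattern_count_le c Q : (pattern_count t c Q)%:R <= (2 * B + 7) ^+ d * t ^+ d.
Proof.
rewrite -exprMn; apply: le_trans (_ : (side t)%:R ^+ d <= _).
  rewrite -natrX ler_nat; apply: leq_trans (max_card _) _.
  by rewrite card_ffun !card_ord.
apply: lerXn2r; rewrite ?nnegrE ?side_le //.
by rewrite mulr_ge0 ?(ltW t0) //; have := B0; lra.
Qed.

(** The counts at scales [N] and [t] differ by the points whose pattern changes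
    under rounding, and by the deviation of the fibers of the rounding from
    their expected size [(N / t) ^ d]. *)
Lemma density_compare c Q :
  `|(pattern_count N c Q)%:R / N ^+ d - (pattern_count t c Q)%:R / t ^+ d|
   <= (exchange_cst * 3 * (1 + #|I|%:R) + (2 * B + 7) ^+ d * 2 ^+ d) / t.
Proof.
have Nd0 : 0 < N ^+ d by rewrite exprn_gt0.
have td0 : 0 < t ^+ d by rewrite exprn_gt0.
have t'0 : 0 <= t^-1 by rewrite invr_ge0 ltW.
pose X := #|[pred m | pattern_set c Q (grid_point (fun _ k => grid_coord t (@coarsen N t k)) m)]|%:R : R.
have N't' : N^-1 <= t^-1 by rewrite lef_pV2 ?posrE //; have := Nt; have := t0; lra.
have h1 : `|(pattern_count N c Q)%:R / N ^+ d - X / N ^+ d| <= exchange_cst * 3 * (1 + #|I|%:R) / t.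
  rewrite -mulrBl normrM [X in _ * X]gtr0_norm ?invr_gt0 // ler_pdivrMr //.
  apply: (le_trans (@grid_exchange N (fun _ k => grid_coord t (@coarsen N t k)) c c Q t^-1 (fun=> t^-1) N1 _ _ t'0 (fun=> t'0))).
  - by move=> i k; apply: coarsen_near.
  - by move=> x i k; rewrite opprD addrACA subrr addr0; apply: coarsen_near.
  have -> : \sum_(x : I) (2 * t^-1 + N^-1) = #|I|%:R * (2 * t^-1 + N^-1).
    by rewrite sumr_const [RHS]mulr_natl; congr (_ *+ _); exact: eq_card.
  have -> : exchange_cst * 3 * (1 + #|I|%:R) / t * N ^+ d
      = exchange_cst * N ^+ d * (3 * t^-1 + #|I|%:R * (3 * t^-1)) by ring.
  apply: ler_wpM2l; first exact: mulr_ge0 exchange_cst_ge0 (ltW Nd0).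
  apply: lerD; first by lra.
  by apply: ler_wpM2l => //; lra.
have h2 : `|X / N ^+ d - (pattern_count t c Q)%:R / t ^+ d| <= (2 * B + 7) ^+ d * 2 ^+ d / t.
  set P := (pattern_count t c Q)%:R.
  have P0 : 0 <= P by [].
  have PK v : pattern_set c Q v -> K v by case/andP => /set_mem.
  have /andP[x1 x2] := card_coarsen PK; rewrite -/X -/(pattern_count t c Q) -/P in x1 x2.
  pose e := t / N.
  have eN : e * (N / t) = 1 by rewrite /e; field; rewrite !gt_eqF.
  have e0 : 0 <= e by rewrite /e divr_ge0 ?ltW.
  have et : e <= t^-1 by rewrite /e ler_pdivrMr // mulrC ler_pdivlMr // -expr2.
  have t'1 : t^-1 <= 1 by rewrite invf_le1.
  have p1 := @pow_dist1 (1 - e) d; have p2 := @pow_dist1 (1 + e) d.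
  have e1 : (N / t - 1) ^+ d / N ^+ d = (1 - e) ^+ d / t ^+ d.
    by rewrite -!exprVn -!exprMn; congr (_ ^+ _); rewrite /e; field; rewrite !gt_eqF.
  have e2 : (N / t + 1) ^+ d / N ^+ d = (1 + e) ^+ d / t ^+ d.
    by rewrite -!exprVn -!exprMn; congr (_ ^+ _); rewrite /e; field; rewrite !gt_eqF.
  have D0 : 0 <= P / t ^+ d by rewrite divr_ge0 // ltW.
  have Dle : P / t ^+ d <= (2 * B + 7) ^+ d.
    by rewrite ler_pdivrMr //; apply: pattern_count_le.
  have y1 : (1 - e) ^+ d * (P / t ^+ d) <= X / N ^+ d.
    have -> : (1 - e) ^+ d * (P / t ^+ d) = (1 - e) ^+ d / t ^+ d * P by ring.
    by rewrite -e1 mulrAC ler_pM2r ?invr_gt0.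
  have y2 : X / N ^+ d <= (1 + e) ^+ d * (P / t ^+ d).
    have -> : (1 + e) ^+ d * (P / t ^+ d) = (1 + e) ^+ d / t ^+ d * P by ring.
    by rewrite -e2 [X in _ <= X]mulrAC ler_pM2r ?invr_gt0.
  set D := P / t ^+ d in D0 Dle y1 y2 *.
  have e01 : `|1 - e - 1| = e by rewrite addrAC subrr sub0r normrN ger0_norm.
  have e02 : `|1 + e - 1| = e by rewrite addrAC subrr add0r ger0_norm.
  rewrite e01 in p1; rewrite e02 in p2.
  have {}p1 : `|(1 - e) ^+ d - 1| <= (2 ^+ d - 1) * e by apply: p1; lra.
  have {}p2 : `|(1 + e) ^+ d - 1| <= (2 ^+ d - 1) * e by apply: p2; lra.
  have two : 1 <= 2 ^+ d :> R by rewrite exprn_ege1 // ler1n.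
  have key : D * ((2 ^+ d - 1) * e) <= (2 * B + 7) ^+ d * 2 ^+ d / t.
    rewrite -mulrA; apply: ler_pM => //; first by rewrite mulr_ge0 ?subr_ge0.
    by apply: ler_pM => //; rewrite ?subr_ge0 //; lra.
  rewrite ler_norml in p1; rewrite ler_norml in p2.
  move: p1 p2 => /andP[p1 _] /andP[_ p2].
  have z1 := ler_wpM2l D0 p1; have z2 := ler_wpM2l D0 p2.
  rewrite ler_norml; apply/andP; split; lra.
rewrite mulrDl; apply: le_trans (lerD h1 h2).
by apply: le_trans (ler_normD _ _); rewrite addrA subrK.
Qed.

End Compare.

End Density.
End PatternSets.

Lemma le_of_le_add_inv (R : realType) (a b M : R) :
  (forall t, 1 <= t -> a <= b + M / t) -> a <= b.
Proof.
move=> h; rewrite leNgt; apply/negP => ba.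
pose t := 1 + `|M| / (a - b) * 2.
have ab : 0 < a - b by rewrite subr_gt0.
have q0 : 0 <= `|M| / (a - b) by rewrite divr_ge0 // ltW.
have t1 : 1 <= t by rewrite /t; lra.
have := h t t1; rewrite -lerBlDl ler_pdivlMr; last by lra.
have -> : (a - b) * t = (a - b) + `|M| * 2 by rewrite /t; field; rewrite gt_eqF.
by have := ler_norm M; have := normr_ge0 M; lra.
Qed.

Section PatternDensity.
Variables (R : realType) (d : nat) (K : set 'rV[R]_d) (I : finType).
Hypotheses (Kconvex : convex_set K) (d0 : (0 < d)%N).
Variable B : R.
Hypothesis B1 : 1 <= B.
Hypothesis KB : forall v, K v -> forall i, `|v 0 i| <= B - 1.

Local Notation cnt := (@pattern_count R d K I B).

(** The density is the supremum of the lower bounds supplied by the finite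
    counts: any two counts are compared through one at a much finer scale. *)
Lemma pattern_density_exists : exists (C : R) (V : (I -> 'rV[R]_d) -> pred {ffun I -> bool} -> R),
  forall c Q t, 1 <= t -> `|(cnt t c Q)%:R / t ^+ d - V c Q| <= C / t.
Proof.
pose C := exchange_cst d B * 3 * (1 + #|I|%:R) + (2 * B + 7) ^+ d * 2 ^+ d.
pose D c Q t := (cnt t c Q)%:R / t ^+ d.
pose E c Q := [set x | exists2 t, 1 <= t & x = D c Q t - C / t].
exists C, (fun c Q => sup (E c Q)) => c Q t t1.
have cmp s : 1 <= s -> D c Q s - C / s <= D c Q t + C / t.
  move=> s1; pose N := 3 * s + 3 * t + s ^+ 2 + t ^+ 2.
  have s2 : 0 <= s ^+ 2 by apply: sqr_ge0.
  have t2 : 0 <= t ^+ 2 by apply: sqr_ge0.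
  have := @density_compare R d K I Kconvex d0 B B1 KB N s s1 _ _ c Q.
  have := @density_compare R d K I Kconvex d0 B B1 KB N t t1 _ _ c Q.
  rewrite -/C -/(D c Q s) -/(D c Q t) -/(D c Q N) /N => h1 h2.
  have {}h1 := h1 ltac:(lra) ltac:(lra); have {}h2 := h2 ltac:(lra) ltac:(lra).
  by move: h1 h2; rewrite !ler_norml; lra.
have ubE : ubound (E c Q) (D c Q t + C / t) by move=> x [s s1 ->]; apply: cmp.
have inE : E c Q (D c Q t - C / t) by exists t.
have h1 : sup (E c Q) <= D c Q t + C / t by apply: ge_sup => //; exists (D c Q t - C / t).
have h2 : D c Q t - C / t <= sup (E c Q) by apply: ub_le_sup => //; exists (D c Q t + C / t).
by rewrite -/(D c Q t) ler_norml; lra.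
Qed.

Lemma pattern_count_split J (cl : {ffun I -> bool} -> 'I_J) t c :
  (\sum_j cnt t c (fun f => cl f == j) = cnt t c xpredT)%N.
Proof.
rewrite /pattern_count.
under eq_bigr do rewrite -sum1_card big_mkcond.
rewrite exchange_big -sum1_card [RHS]big_mkcond; apply: eq_bigr => m _.
rewrite inE /pattern_set andbT; case: ifP => mK; last first.
  by rewrite big1 // => j _; rewrite inE mK.
rewrite (bigD1 (cl [ffun x => grid_point (@grid R d B t) m + c x \in K])) //= inE mK eqxx /=.
by rewrite big1 // => j; rewrite inE mK /= eq_sym => /negbTE ->.
Qed.

Lemma convex_count_ge (p : 'rV[R]_d) (rho : R) c t : 0 < rho ->
  (forall v : 'rV[R]_d, (forall i, `|v 0 i - p 0 i| <= rho) -> K v) ->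
  2 <= rho * t -> 0 < t -> (rho / 2) ^+ d * t ^+ d <= (cnt t c xpredT)%:R.
Proof.
move=> rho0 pK rt t0.
have /andP[h1 h2] := grid_radius_bounds (t := t) B1 (ltW t0).
have pB i : `|p 0 i + rho| <= B - 1 /\ `|p 0 i - rho| <= B - 1.
  have Kp s : `|s| <= rho -> K (p + const_mx s).
    by move=> hs; apply: pK => j; rewrite !mxE addrAC subrr add0r.
  have := KB (Kp rho _) i; have := KB (Kp (- rho) _) i; rewrite !mxE.
  by rewrite normrN gtr0_norm // => h h'; split; [apply: h'|apply: h].
pose A (i : 'I_d) : pred 'I_(side B t) := fun k =>
  (grid_radius B t)%:R + t * (p 0 i - rho) <= (k : nat)%:R < (grid_radius B t)%:R + t * (p 0 i + rho).
have le : (#|[pred m : {ffun 'I_d -> 'I_(side B t)} | [forall i, A i (m i)]]| <= cnt t c xpredT)%N.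
  apply: subset_leq_card; apply/fintype.subsetP => m; rewrite !inE => /forallP mA.
  rewrite /pattern_set andbT; apply/mem_set/pK => i; rewrite mxE /grid /grid_coord.
  have /andP[a1 a2] := mA i; rewrite ler_distl ler_pdivlMr // ler_pdivrMr //.
  by apply/andP; split; lra.
apply: le_trans (_ : (_ <= (\prod_i #|A i|)%N%:R)) _; last by rewrite -card_ffun_forall ler_nat.
rewrite natr_prod -exprMn.
have cE : d = #|'I_d| by rewrite card_ord.
rewrite [X in _ ^+ X <= _]cE -prodr_const; apply: ler_prod => i _.
have rt2 : 0 <= rho / 2 * t by lra.
rewrite rt2 /=.
have [] := pB i; rewrite !ler_norml => /andP[g1 g2] /andP[g3 g4].
have g4' := ler_wpM2l (ltW t0) g3; have g2' := ler_wpM2l (ltW t0) g2.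
have /andP[low _] := @card_itv_approx R (side B t) ((grid_radius B t)%:R + t * (p 0 i - rho))
  ((grid_radius B t)%:R + t * (p 0 i + rho)) ltac:(lra) ltac:(nra)
  ltac:(rewrite natr_side; lra).
by apply: le_trans _ low; lra.
Qed.

End PatternDensity.

Section PatternFrequency.
Variables (R : realType) (d : nat) (K : set 'rV[R]_d) (I : finType).
Hypotheses (Kconvex : convex_set K) (d0 : (0 < d)%N).
Variable B : R.
Hypothesis B1 : 1 <= B.
Hypothesis KB : forall v, K v -> forall i, `|v 0 i| <= B - 1.
Variables (p : 'rV[R]_d) (rho : R).
Hypothesis rho0 : 0 < rho.
Hypothesis pK : forall v : 'rV[R]_d, (forall i, `|v 0 i - p 0 i| <= rho) -> K v.

Local Notation cnt := (@pattern_count R d K I B).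

Lemma pattern_count_shift (c c' : I -> 'rV[R]_d) Q (delta : I -> R) t : 1 <= t ->
  (forall x i, `|c x 0 i - c' x 0 i| <= delta x) -> (forall x, 0 <= delta x) ->
  `|(cnt t c Q)%:R / t ^+ d - (cnt t c' Q)%:R / t ^+ d|
    <= 2 * exchange_cst d B * (\sum_x delta x) + exchange_cst d B * (1 + #|I|%:R) / t.
Proof.
move=> t1 h dl; have t0 : 0 < t by apply: lt_le_trans t1.
have td0 : 0 < t ^+ d by rewrite exprn_gt0.
rewrite -mulrBl normrM [X in _ * X]gtr0_norm ?invr_gt0 // ler_pdivrMr //.
have := @grid_exchange R d K I Kconvex d0 B B1 t (@grid R d B t) c c' Q 0 delta t1 _ _ (lexx 0) dl.
move=> /(_ _ _)/le_trans; apply.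
- by move=> i k; rewrite subrr normr0.
- by move=> x i k; rewrite opprD addrACA subrr add0r.
have -> : \sum_x (2 * delta x + t^-1) = 2 * (\sum_x delta x) + #|I|%:R * t^-1.
  rewrite big_split /= -mulr_sumr; congr (_ + _).
  by rewrite sumr_const [RHS]mulr_natl; congr (_ *+ _); apply: eq_card.
by rewrite le_eqVlt; apply/orP; left; apply/eqP; ring.
Qed.

(** The limits are densities of patterns normalised by the density of [K], which
    is bounded below by that of a cube inside [K]. *)
Lemma pattern_frequency J (cl : {ffun I -> bool} -> 'I_J) :
  exists (H : (I -> 'rV[R]_d) -> 'rV[R]_J) (L : R),
  [/\ forall c, prob_simplex (H c),
     forall (c c' : I -> 'rV[R]_d) (delta : I -> R), (forall x i, `|c x 0 i - c' x 0 i| <= delta x) ->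
       (forall x, 0 <= delta x) ->
       forall j, `|H c 0 j - H c' 0 j| <= L * \sum_x delta x &
     forall M, 0 <= M -> exists C : R, forall t (c c' : I -> 'rV[R]_d), 1 <= t -> 2 <= rho * t ->
       (forall x i, `|c x 0 i - c' x 0 i| <= M / t) ->
       (0 < cnt t c xpredT)%N /\
       forall j, `|(cnt t c (fun f => cl f == j))%:R / (cnt t c xpredT)%:R - H c' 0 j| <= C / t].
Proof.
have [C0 [V VP]] := @pattern_density_exists R d K I Kconvex d0 B B1 KB.
pose D t c Q := (cnt t c Q)%:R / t ^+ d.
pose vol := V (fun=> 0) xpredT.
pose Q j : pred {ffun I -> bool} := fun f => cl f == j.
pose X := exchange_cst d B.
have X0 : 0 <= X by exact: exchange_cst_ge0.
have DV c Qx t : 1 <= t -> V c Qx <= D t c Qx + C0 / t /\ D t c Qx <= V c Qx + C0 / t.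
  by move=> t1; have := VP c Qx t t1; rewrite -/(D t c Qx) ler_norml; lra.
have cntT c c' t : cnt t c xpredT = cnt t c' xpredT.
  by apply: eq_card => m; rewrite !inE /pattern_set !andbT.
have VT c : V c xpredT = vol.
  have le c1 c2 : V c1 xpredT <= V c2 xpredT.
    apply: (@le_of_le_add_inv _ _ _ (C0 + C0)) => t t1.
    have [h1 _] := DV c1 xpredT t t1; have [_ h2] := DV c2 xpredT t t1.
    have e : D t c1 xpredT = D t c2 xpredT by rewrite /D (cntT c1 c2).
    by rewrite e in h1; rewrite mulrDl; lra.
  by apply/eqP; rewrite eq_le !le.
have rd0 : 0 < (rho / 2) ^+ d by rewrite exprn_gt0 // divr_gt0.
have Dge c t : 1 <= t -> 2 <= rho * t -> (rho / 2) ^+ d <= D t c xpredT.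
  move=> t1 rt; have t0 : 0 < t by apply: lt_le_trans t1.
  rewrite /D ler_pdivlMr ?exprn_gt0 //.
  exact: (convex_count_ge B1 KB c rho0 pK rt t0).
have vol0 : 0 < vol.
  apply: lt_le_trans rd0 _; rewrite -(VT (fun=> 0)).
  pose m := Num.max 1 (2 / rho).
  have m1 : 1 <= m by rewrite le_max lexx.
  have mr : 2 <= rho * m by rewrite mulrC -ler_pdivrMr // le_max lexx orbT.
  apply: (@le_of_le_add_inv _ _ _ `|C0|) => t t1.
  have s1 : 1 <= t * m by rewrite -[1]mulr1; apply: ler_pM.
  have st : t <= t * m by rewrite ler_peMr //; lra.
  have rs : 2 <= rho * (t * m).
    by apply: le_trans mr _; rewrite ler_pM2l // ler_peMl //; lra.
  have [_ h] := DV (fun=> 0) xpredT (t * m) s1; have h' := Dge (fun=> 0) (t * m) s1 rs.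
  have : C0 / (t * m) <= `|C0| / t.
    apply: le_trans (_ : `|C0| / (t * m) <= _); first by rewrite ler_wpM2r ?invr_ge0 ?ler_norm //; lra.
    by rewrite ler_wpM2l // lef_pV2 ?posrE //; lra.
  lra.
have D0 t c Qx : 1 <= t -> 0 <= D t c Qx by move=> t1; rewrite divr_ge0 // exprn_ge0 //; lra.
have V0 c Qx : 0 <= V c Qx.
  apply: (@le_of_le_add_inv _ _ _ C0) => t t1.
  by have [_ h] := DV c Qx t t1; have := D0 t c Qx t1; lra.
have Vlip (c c' : I -> 'rV[R]_d) (delta : I -> R) Qx : (forall x i, `|c x 0 i - c' x 0 i| <= delta x) ->
    (forall x, 0 <= delta x) -> V c Qx <= V c' Qx + 2 * X * \sum_x delta x.
  move=> h dl; apply: (@le_of_le_add_inv _ _ _ (C0 + C0 + X * (1 + #|I|%:R))) => t t1.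
  have [h1 _] := DV c Qx t t1; have [_ h2] := DV c' Qx t t1.
  have := pattern_count_shift Qx t1 h dl; rewrite -/(D t c Qx) -/(D t c' Qx) -/X ler_norml.
  by move=> h3; rewrite !mulrDl -mulrDl; lra.
have Vlip2 (c c' : I -> 'rV[R]_d) (delta : I -> R) Qx : (forall x i, `|c x 0 i - c' x 0 i| <= delta x) ->
    (forall x, 0 <= delta x) -> `|V c Qx - V c' Qx| <= 2 * X * \sum_x delta x.
  move=> h dl; have h1 := Vlip c c' delta Qx h dl.
  have h2 : V c' Qx <= V c Qx + 2 * X * \sum_x delta x.
    by apply: Vlip dl => x i; rewrite distrC.
  by rewrite ler_norml; lra.
have Vsum c : \sum_j V c (Q j) = vol.
  rewrite -(VT c).
  have Dsum t : \sum_j D t c (Q j) = D t c xpredT.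
    by rewrite -mulr_suml -natr_sum (pattern_count_split K B cl t c).
  have sumC t : \sum_(j < J) C0 / t = J%:R * C0 / t.
    by rewrite sumr_const card_ord -[RHS]mulrA mulr_natl.
  apply/eqP; rewrite eq_le; apply/andP; split;
    apply: (@le_of_le_add_inv _ _ _ (J%:R * C0 + C0)) => t t1;
    have [h1 h2] := DV c xpredT t t1; rewrite mulrDl.
    have : \sum_j V c (Q j) <= \sum_j (D t c (Q j) + C0 / t).
      by apply: ler_sum => j _; have [] := DV c (Q j) t t1.
    by rewrite big_split /= Dsum sumC; lra.
  have : \sum_j D t c (Q j) <= \sum_j (V c (Q j) + C0 / t).
    by apply: ler_sum => j _; have [] := DV c (Q j) t t1.
  by rewrite big_split /= Dsum sumC; lra.
have Vle c j : V c (Q j) <= vol.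
  by rewrite -(Vsum c) (bigD1 j) //= lerDl sumr_ge0.
exists (fun c => \row_j (V c (Q j) / vol)), (2 * X / vol); split.
- move=> c; split=> [|j]; last by rewrite mxE divr_ge0 // ltW.
  by under eq_bigr do rewrite mxE; rewrite -mulr_suml Vsum divff // gt_eqF.
- move=> c c' delta h dl j; rewrite !mxE -mulrBl normrM [X in _ * X <= _]gtr0_norm ?invr_gt0 //.
  by rewrite ler_pdivrMr // mulrAC divfK ?gt_eqF // Vlip2.
move=> M M0; exists ((`|C0| + 2 * X * (#|I|%:R * M) + `|C0|) / (rho / 2) ^+ d) => t c c' t1 rt h.
have t0 : 0 < t by apply: lt_le_trans t1.
have td0 : 0 < t ^+ d by rewrite exprn_gt0.
have DT := Dge c t t1 rt; have DT0 := lt_le_trans rd0 DT.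
have cnt0 : (0 < cnt t c xpredT)%N.
  by move: DT0; rewrite /D pmulr_lgt0 ?invr_gt0 // ltr0n.
split=> // j; rewrite mxE.
set Dj := D t c (Q j); set Vj := V c' (Q j).
have -> : (cnt t c (fun f => cl f == j))%:R / (cnt t c xpredT)%:R = Dj / D t c xpredT.
  rewrite /Dj /D /Q; field.
  by rewrite !gt_eqF // ltr0n.
have t'0 : 0 <= t^-1 by rewrite invr_ge0 ltW.
have Ct : C0 / t <= `|C0| / t by rewrite ler_wpM2r // ler_norm.
have e1 : `|Dj - Vj| <= (`|C0| + 2 * X * (#|I|%:R * M)) / t.
  have [g1 g2] := DV c (Q j) t t1.
  have := Vlip2 c c' (fun=> M / t) (Q j) h (fun=> divr_ge0 M0 (ltW t0)).
  have -> : \sum_(x in I) M / t = #|I|%:R * M / t.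
    by rewrite sumr_const -[RHS]mulrA mulr_natl.
  by rewrite !ler_norml -/Dj -/Vj in g1 g2 *; rewrite !mulrDl !mulrA; lra.
have e2 : `|D t c xpredT - vol| <= `|C0| / t.
  have [g1 g2] := DV c xpredT t t1; rewrite VT in g1 g2.
  by rewrite ler_norml; lra.
have -> : Dj / D t c xpredT - Vj / vol
    = ((Dj - Vj) - Vj / vol * (D t c xpredT - vol)) / D t c xpredT.
  by field; rewrite !gt_eqF.
rewrite normrM [X in _ * X]gtr0_norm ?invr_gt0 //.
have -> : (`|C0| + 2 * X * (#|I|%:R * M) + `|C0|) / (rho / 2) ^+ d / t
   = ((`|C0| + 2 * X * (#|I|%:R * M)) / t + `|C0| / t) / (rho / 2) ^+ d.
  by rewrite mulrAC mulrDl.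
apply: ler_pM; rewrite ?invr_ge0 ?(ltW DT0) //; last by rewrite lef_pV2 ?posrE.
apply: le_trans (ler_normB _ _) _; apply: lerD => //.
rewrite normrM; apply: le_trans _ e2; apply: ler_piMl => //.
by rewrite ger0_norm ?divr_ge0 ?(ltW vol0) // ?V0 // ler_pdivrMr // mul1r Vle.
Qed.

End PatternFrequency.

(** * Lattice points of a dilated set *)

Section LatticeCount.
Variables (R : realType) (d : nat) (K : set 'rV[R]_d) (B : R).
Hypothesis B1 : 1 <= B.
Hypothesis KB : forall v, K v -> forall i, `|v 0 i| <= B - 1.

Definition real_point (t : R) (m : 'rV[int]_d) : 'rV[R]_d := t^-1 *: map_mx intr m.

Lemma lattice_pointsE t m : 0 < t -> lattice_points K t m <-> K (real_point t m).
Proof.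
move=> t0; rewrite /lattice_points /dilation /real_point /=; split=> [[v Kv <-]|h].
  by rewrite scalerA mulVf ?gt_eqF // scale1r.
by exists (t^-1 *: map_mx intr m) => //; rewrite scalerA divff ?gt_eqF // scale1r.
Qed.

Definition grid_int t (m : {ffun 'I_d -> 'I_(side B t)}) : 'rV[int]_d :=
  \row_i ((m i : nat)%:Z - (grid_radius B t)%:Z).

Lemma grid_int_inj t : injective (@grid_int t).
Proof.
move=> m m' /rowP e; apply/ffunP => i; apply: val_inj.
have := e i; rewrite !mxE => /addIr [].
by [].
Qed.

Lemma real_point_grid t m : real_point t (@grid_int t m) = grid_point (@grid R d B t) m.
Proof. by apply/rowP => i; rewrite !mxE /grid /grid_coord intrB -!pmulrn mulrC. Qed.

Lemma grid_int_onto t m : 0 < t -> K (real_point t m) -> exists m', m = @grid_int t m'.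
Proof.
move=> t0 Km; have /andP[h1 h2] := grid_radius_bounds B1 (ltW t0).
have mB i : - (B * t) <= (m 0 i)%:~R <= B * t.
  have := KB Km i; rewrite !mxE normrM gtr0_norm ?invr_gt0 // mulrC ler_pdivrMr // ler_norml.
  have : (B - 1) * t <= B * t by rewrite ler_pM2r //; lra.
  lra.
have ge0 i : 0 <= m 0 i + (grid_radius B t)%:Z.
  by rewrite -(ler0z R) intrD -pmulrn; have := mB i; lra.
have lt i : (absz (m 0 i + (grid_radius B t)%:Z)%R < side B t)%N.
  by rewrite -ltz_nat gez0_abs // -(ltr_int R) intrD -!pmulrn natr_side; have := mB i; lra.
exists [ffun i => Ordinal (lt i)]; apply/rowP => i.
by rewrite !mxE ffunE /= gez0_abs // addrK.
Qed.

Lemma finite_lattice_points t : 0 < t -> finite_set (lattice_points K t).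
Proof.
move=> t0; apply: (@sub_finite_set _ _ (range (@grid_int t))); last first.
  by apply: finite_image; exact: finite_finset.
by move=> m /(lattice_pointsE _ t0) /(grid_int_onto t0)[m' ->]; exists m'.
Qed.

Lemma mem_lattice_fset t m : 0 < t -> (m \in lattice_fset K t) = (real_point t m \in K).
Proof.
move=> t0; rewrite /lattice_fset in_fset_set; last exact: finite_lattice_points.
by apply/idP/idP => /set_mem h; apply/mem_set; apply/(lattice_pointsE m t0).
Qed.

Lemma count_lattice_fset t (S : pred 'rV[R]_d) : 0 < t -> (forall v, S v -> K v) ->
  count (fun m => S (real_point t m)) (lattice_fset K t)
  = #|[pred m | S (grid_point (@grid R d B t) m)]|.
Proof.
move=> t0 SK; rewrite -size_filter cardE -(size_map (@grid_int t)).
apply: perm_size; apply: uniq_perm.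
- by rewrite filter_uniq // fset_uniq.
- by rewrite map_inj_uniq ?enum_uniq //; exact: grid_int_inj.
move=> m; rewrite mem_filter mem_lattice_fset //; apply/andP/mapP => [[Sm /set_mem Km]|[m' ]].
  have [m' e] := grid_int_onto t0 Km; exists m' => //.
  by rewrite mem_enum unfold_in /= -real_point_grid -e.
by rewrite mem_enum unfold_in /= -real_point_grid => Sm ->; split => //; apply/mem_set/SK.
Qed.

End LatticeCount.

(** * Spacings as minimal positive lattice elements *)

Lemma frac_part_id (R : realType) (x : R) : 0 <= x < 1 -> frac_part x = x.
Proof.
by move=> x01; rewrite /frac_part (@floor_def _ x 0) ?subr0 // add0r.
Qed.

Lemma frac_partDz (R : realType) (x : R) (k : int) : frac_part (x + k%:~R) = frac_part x.
Proof.
rewrite /frac_part; have := floor_itv x; rewrite intrD => h.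
rewrite (@floor_def _ (x + k%:~R) (Num.floor x + k)); last first.
  by rewrite !intrD; move: h; lra.
by rewrite intrD; ring.
Qed.

Section Neighbours.
Variables (R : realType) (d : nat) (K : set 'rV[R]_d) (B : R).
Hypothesis B1 : 1 <= B.
Hypothesis KB : forall v, K v -> forall i, `|v 0 i| <= B - 1.
Variables (Phi : fieldExtType rat) (w : d.-tuple Phi).
Let b : d.+1.-tuple Phi := [tuple of 1 :: w].
Hypothesis hb : basis_of fullv b.
Variables (emb : {rmorphism Phi -> R}) (omega : 'rV[R]_d).
Hypothesis homega : forall i : 'I_d, omega 0 i = emb (tnth w i).

Definition int_coords (x : Phi) : 'rV[int]_d := \row_i numq (coords b x (lift ord0 i) 0).

Lemma emb_lattice_elt v : emb (lattice_elt w v) = (v ord0)%:~R + dot_omega omega (\row_i v (lift ord0 i)).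
Proof.
rewrite lattice_elt_recl rmorphD rmorph_int rmorph_sum; congr (_ + _).
by apply: eq_bigr => i _; rewrite rmorphM rmorph_int mxE homega.
Qed.

Lemma int_coords_elt v : int_coords (lattice_elt w v) = \row_i v (lift ord0 i).
Proof. by apply/rowP => i; rewrite [LHS]mxE [RHS]mxE (coords_lattice_elt hb) numq_int. Qed.

Lemma dot_omegaD m m' : dot_omega omega (m + m') = dot_omega omega m + dot_omega omega m'.
Proof. by rewrite /dot_omega -big_split /=; apply: eq_bigr => i _; rewrite mxE intrD mulrDl. Qed.

Lemma dot_omegaN m : dot_omega omega (- m) = - dot_omega omega m.
Proof. by rewrite /dot_omega -sumrN; apply: eq_bigr => i _; rewrite mxE intrN mulNr. Qed.

Local Notation f m := (frac_part (dot_omega omega m)).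

Lemma lattice_elt_between m m' : exists x, [/\ in_lattice b x,
  int_coords x = m' - m & emb x = f m' - f m].
Proof.
pose n0 := Num.floor (dot_omega omega m) - Num.floor (dot_omega omega m').
pose v k := if unlift ord0 k is Some i then (m' - m) 0 i else n0.
have vE : \row_i v (lift ord0 i) = m' - m by apply/rowP => i; rewrite mxE /v liftK.
exists (lattice_elt w v); rewrite int_coords_elt emb_lattice_elt vE; split => //.
  exact: in_lattice_elt.
rewrite /v unlift_none dot_omegaD dot_omegaN /n0 intrB /frac_part; ring.
Qed.

Lemma frac_int_coords (e : bool) m x : in_lattice b x ->
  0 <= f m + (-1) ^+ e * emb x < 1 ->
  f (m + (-1) ^+ e *: int_coords x) = f m + (-1) ^+ e * emb x.
Proof.
move=> /(in_latticeE hb)[v ->] h; rewrite -[RHS]frac_part_id //.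
rewrite int_coords_elt emb_lattice_elt dot_omegaD.
have -> : dot_omega omega ((-1) ^+ e *: \row_i v (lift ord0 i))
    = (-1) ^+ e * dot_omega omega (\row_i v (lift ord0 i)).
  by case: e {h}; rewrite ?expr1 ?expr0 ?scaleN1r ?scale1r ?mulN1r ?mul1r // dot_omegaN.
set y := dot_omega _ (\row_i _); set z := dot_omega omega m.
have -> : frac_part z + (-1) ^+ e * ((v ord0)%:~R + y)
  = z + (-1) ^+ e * y + (- Num.floor z + (-1) ^+ e * v ord0)%:~R.
  rewrite /frac_part intrD intrN.
  by case: e {h}; rewrite ?expr1 ?expr0 ?mulN1r ?mul1r ?intrN; ring.
by rewrite frac_partDz.
Qed.

Lemma frac_dot_inj m m' : f m = f m' -> m = m'.
Proof.
move=> e; have [x [xi xm ex]] := lattice_elt_between m m'.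
move: ex; rewrite e subrr => /eqP; rewrite fmorph_eq0 => /eqP x0.
apply/eqP; rewrite eq_sym -subr_eq0 -xm x0; apply/eqP/rowP => i.
by rewrite !mxE linear0.
Qed.

Variable t : R.
Hypothesis t0 : 0 < t.

Definition admissible (e : bool) (m : 'rV[int]_d) (x : Phi) : bool :=
  (0 < emb x) && (real_point t (m + (-1) ^+ (~~ e) *: int_coords x) \in K).

(** The step to the next point on the circle as seen from [m], or from the
    previous one if [e] is [false]. *)
Definition gap (e : bool) (m : 'rV[int]_d) (x : Phi) : Prop :=
  [/\ in_lattice b x, admissible e m x &
    forall x', in_lattice b x' -> admissible e m x' -> emb x <= emb x'].

Definition ordered_points : seq 'rV[int]_d :=
  sort (relpre (fun m => f m) <=%R) (lattice_fset K t).

Lemma frac_pointsE : frac_points K omega t = map (fun m => f m) ordered_points.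
Proof. by rewrite /frac_points sort_map. Qed.

Lemma mem_ordered m : (m \in ordered_points) = (real_point t m \in K).
Proof. by rewrite mem_sort; apply: (mem_lattice_fset B1 KB). Qed.

Lemma size_ordered : size ordered_points = npoints K t.
Proof. by rewrite size_sort. Qed.

Lemma frac_points_sorted : sorted <%R (frac_points K omega t).
Proof.
rewrite lt_sorted_uniq_le; apply/andP; split; last exact: sort_le_sorted.
by rewrite sort_uniq map_inj_uniq ?fset_uniq // => m m' /frac_dot_inj.
Qed.

Lemma nth_frac i : (i < npoints K t)%N ->
  nth 0 (frac_points K omega t) i = f (nth 0 ordered_points i).
Proof. by move=> lt; rewrite frac_pointsE (nth_map 0) // size_ordered. Qed.

Lemma no_point_between i m : (i.+1 < npoints K t)%N -> m \in ordered_points ->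
  f (nth 0 ordered_points i) < f m < f (nth 0 ordered_points i.+1) -> False.
Proof.
move=> lt mL; have [j jlt jE] : exists2 j, (j < npoints K t)%N & nth 0 ordered_points j = m.
  by exists (index m ordered_points); [rewrite -size_ordered index_mem | rewrite nth_index].
have sz : size (frac_points K omega t) = npoints K t.
  by rewrite frac_pointsE size_map size_ordered.
rewrite -jE -!nth_frac // ?(ltnW lt) //.
rewrite !(lt_sorted_ltn_nth 0 frac_points_sorted) ?inE ?sz // ?(ltnW lt) //.
by rewrite ltnS => /andP[h1 h2]; have := leq_ltn_trans h2 h1; rewrite ltnn.
Qed.

(** An admissible element with a smaller value would lead to a point strictly
    between two consecutive ones. *)
Lemma gap_exists e i : (i.+1 < npoints K t)%N ->
  exists2 x, gap e (nth 0 ordered_points (if e then i else i.+1)) x &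
    emb x = nth 0 (frac_points K omega t) i.+1 - nth 0 (frac_points K omega t) i.
Proof.
move=> lt; have lt' := ltnW lt.
set m := nth 0 ordered_points i; set m' := nth 0 ordered_points i.+1.
have mL : m \in ordered_points by rewrite mem_nth // size_ordered.
have mL' : m' \in ordered_points by rewrite mem_nth // size_ordered.
have sz : size (frac_points K omega t) = npoints K t.
  by rewrite frac_pointsE size_map size_ordered.
have ff' : f m < f m'.
  by rewrite -!nth_frac // (lt_sorted_ltn_nth 0 frac_points_sorted) ?inE ?sz.
have [x [xi xm ex]] := lattice_elt_between m m'.
exists x; last by rewrite !nth_frac.
have f01 (z : R) := frac_part_itv z.
have /andP[g1 g2] := f01 (dot_omega omega m); have /andP[g3 g4] := f01 (dot_omega omega m').
split=> //.
  rewrite /admissible ex subr_gt0 ff' xm /=; case: (e); rewrite /= -mem_ordered.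
    by rewrite expr0 scale1r addrC subrK.
  by rewrite expr1 scaleN1r opprB addrC subrK.
move=> x' xi' /andP[ex' Kx']; rewrite leNgt; apply/negP => lt_x.
rewrite -mem_ordered in Kx'; rewrite ex in lt_x.
apply: (no_point_between lt Kx'); rewrite -/m -/m' frac_int_coords //.
  by case: (e); rewrite -/m -/m' /= ?expr0 ?expr1 ?mul1r ?mulN1r; lra.
by case: (e); rewrite -/m -/m' /= ?expr0 ?expr1 ?mul1r ?mulN1r; lra.
Qed.

End Neighbours.

(** * Finitely many candidate gaps up to units *)

Lemma ler_sum_term (R : realDomainType) (I : finType) (F : I -> R) k :
  (forall i, 0 <= F i) -> F k <= \sum_i F i.
Proof. by move=> F0; rewrite (bigD1 k) //= lerDl sumr_ge0. Qed.

Section Candidates.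
Variables (R : realType) (d : nat) (Phi : fieldExtType rat) (w : d.-tuple Phi).
Hypothesis d0 : (0 < d)%N.
Let b : d.+1.-tuple Phi := [tuple of 1 :: w].
Hypothesis hb : basis_of fullv b.
Variable emb : {rmorphism Phi -> R}.
Variables (sigma : 'I_d.+1 -> {rmorphism Phi -> R[i]}) (i0 : 'I_d.+1).
Hypothesis Su : embmat b sigma \in unitmx.
Hypothesis s0 : forall x, sigma i0 x = (emb x)%:C%C.
Variables (u : R -> Phi) (C1 : R).
Hypothesis C11 : 1 <= C1.
Hypothesis hu : forall t, 0 < t -> lattice_units b (u t) /\ 0 < emb (u t).
Hypothesis usize : forall t, 0 < t -> C1^-1 <= emb (u t) * t ^+ d <= C1 /\
    forall i, i != i0 -> C1^-1 * t <= cabs (sigma i (u t)) <= C1 * t.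

Let C10 : 0 < C1. Proof. exact: lt_le_trans C11. Qed.

(** The conjugates determine the coordinates linearly. *)
Lemma coords_bounded : exists2 M : R, 0 < M & forall x N,
  (forall i, cabs (sigma i x) <= N) -> forall k, `|ratr (coords b x k 0) : R| <= M * N.
Proof.
pose M := 1 + \sum_k \sum_i cabs (invmx (embmat b sigma) k i).
have M0 : 0 <= \sum_k \sum_i cabs (invmx (embmat b sigma) k i).
  by do 2![apply: sumr_ge0 => ? _]; apply: cabs_ge0.
exists M => [|x N xN k]; first by rewrite /M; lra.
rewrite -cabs_ratr (coords_embmat hb Su) (le_trans (cabs_sum _)) //.
have N0 : 0 <= N by apply: le_trans (xN i0); apply: cabs_ge0.
apply: le_trans (_ : (\sum_i cabs (invmx (embmat b sigma) k i)) * N <= _).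
  rewrite mulr_suml; apply: ler_sum => i _; rewrite cabsM.
  by apply: ler_wpM2l; [exact: cabs_ge0 | exact: xN].
apply: ler_wpM2r => //.
have := @ler_sum_term R _ (fun k => \sum_i cabs (invmx (embmat b sigma) k i)) k.
move=> h; apply: le_trans (h _) _; last by rewrite /M; lra.
by move=> k'; apply: sumr_ge0 => i _; apply: cabs_ge0.
Qed.

Lemma emb_coords x : emb x = \sum_k ratr (coords b x k 0) * emb (tnth b k).
Proof.
rewrite {1}(coords_sum hb x) rmorph_sum; apply: eq_bigr => k _.
exact: rmorph_rat_scale.
Qed.

(** The multiples of the basis by a unit of size [lambda * t] are a basis of the
    lattice whose vectors are short compared with [t]; rounding the
    coordinates in it moves a target by less than [rho * t], while the height
    over the window stays of the order of [t ^- d]. *)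
Lemma lattice_near rho : 0 < rho -> exists C T0 : R, 1 <= T0 /\
  forall t (q : 'I_d -> R), T0 <= t -> exists x, [/\ in_lattice b x,
    0 < emb x <= C / t ^+ d &
    forall i, `|(int_coords w x 0 i)%:~R - q i| <= rho * t].
Proof.
move=> rho0; have [M M0 hM] := coords_bounded.
pose W := 1 + \sum_i \sum_j cabs (sigma i (tnth b j)).
have W0 : 0 <= \sum_i \sum_j cabs (sigma i (tnth b j)).
  by do 2![apply: sumr_ge0 => ? _]; apply: cabs_ge0.
have W1 : 1 <= W by rewrite /W; lra.
have Wij i j : cabs (sigma i (tnth b j)) <= W.
  apply: le_trans (_ : \sum_j cabs (sigma i (tnth b j)) <= _).
    by apply: (@ler_sum_term R _ (fun j => cabs (sigma i (tnth b j)))) => ?; apply: cabs_ge0.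
  apply: le_trans (@ler_sum_term R _ (fun i => \sum_j cabs (sigma i (tnth b j))) i _) _.
    by move=> ?; apply: sumr_ge0 => ? _; apply: cabs_ge0.
  by rewrite /W; lra.
pose C2 := d.+1%:R * (M * (C1 * W)).
have C20 : 0 < C2 by rewrite /C2 !mulr_gt0 // ?ltr0n //; lra.
pose lambda := rho / C2.
have la0 : 0 < lambda by rewrite divr_gt0.
pose We := \sum_j `|emb (tnth b j)|.
have We0 : 0 <= We by apply: sumr_ge0.
exists ((2 * We + 1) * C1 / lambda ^+ d), (1 + lambda^-1); split.
  by rewrite lerDl invr_ge0 ltW.
move=> t q tT; have la'0 : 0 < lambda^-1 by rewrite invr_gt0.
have t0 : 0 < t by lra.
pose s := lambda * t.
have s1 : 1 <= s by rewrite /s mulrC -ler_pdivrMr // div1r; lra.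
have sp : 0 < s by apply: lt_le_trans s1.
have sd : 1 <= s ^+ d by rewrite exprn_ege1.
have [uU eu0] := hu sp; have [/andP[_ eus] us] := usize sp.
have us_le i : cabs (sigma i (u s)) <= C1 * s.
  have [->|ii0] := eqVneq i i0; last by have /andP[] := us i ii0.
  rewrite s0 cabs_real gtr0_norm //; apply: le_trans (_ : emb (u s) * s ^+ d <= _).
    by rewrite ler_peMr // ltW.
  by rewrite (le_trans eus) // ler_peMr // ltW.
pose A : 'M[R]_d.+1 := map_mx ratr (mulmat b (u s)).
have Au : A \in unitmx.
  rewrite unitmxE /A det_map_mx unitfE fmorph_eq0.
  exact: det_mulmat_neq0 hb _ (lattice_unit_neq0 uU).
have AE k j : `|A k j| <= M * (C1 * W) * s.
  rewrite mxE mulmatE -mulrA; apply: hM => i.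
  rewrite rmorphM cabsM mulrAC; apply: ler_pM; rewrite ?cabs_ge0 //.
pose beta := (We + 1) * C1 / s ^+ d.
pose v : 'cV[R]_d.+1 := \col_k if unlift ord0 k is Some i then q i
  else beta - \sum_i q i * emb (tnth w i).
have v_lift i : v (lift ord0 i) 0 = q i by rewrite mxE liftK.
have ev : \sum_k v k 0 * emb (tnth b k) = beta.
  rewrite big_ord_recl tnth0 rmorph1 mulr1 [v ord0 0]mxE unlift_none.
  under [X in _ + X]eq_bigr do rewrite v_lift tnthS.
  by rewrite subrK.
pose l := invmx A *m v.
pose z (j : 'I_d.+1) : int := Num.floor (l j 0).
pose dl (j : 'I_d.+1) := l j 0 - (z j)%:~R.
have dl01 j : `|dl j| <= 1.
  have /andP[h1 h2] := floor_itv (l j 0); rewrite intrD in h2.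
  by rewrite /dl /z ler_norml; lra.
pose x := u s * lattice_elt w z.
have xi : in_lattice b x by apply: lattice_unit_in => //; apply: in_lattice_elt.
have cx k : ratr (coords b x k 0) = v k 0 - \sum_j A k j * dl j.
  have -> : v k 0 = \sum_j A k j * l j 0.
    by rewrite -{1}[v](mulKVmx Au) mxE.
  rewrite -sumrB /x coordsM // mxE rmorph_sum; apply: eq_bigr => j _.
  by rewrite rmorphM (coords_lattice_elt hb) /= ratr_int [A k j]mxE /dl; ring.
have ex : emb x = beta - emb (u s) * \sum_j dl j * emb (tnth b j).
  rewrite emb_coords -ev mulr_sumr.
  under eq_bigr do rewrite cx mulrBl.
  rewrite sumrB; congr (_ - _).
  under eq_bigr do rewrite mulr_suml.
  rewrite exchange_big /=; apply: eq_bigr => j _.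
  rewrite mulrCA -rmorphM (emb_coords (u s * _)) mulr_sumr; apply: eq_bigr => k _.
  by rewrite mxE mulmatE; ring.
have small : `|emb (u s) * \sum_j dl j * emb (tnth b j)| <= C1 * We / s ^+ d.
  rewrite normrM (gtr0_norm eu0) mulrAC; apply: ler_pM => //.
  - by rewrite ltW.
  - by rewrite ler_pdivlMr // (lt_le_trans _ sd).
  rewrite (le_trans (ler_norm_sum _ _ _)) //; apply: ler_sum => j _.
  by rewrite normrM ler_piMl.
have sdE : s ^+ d = lambda ^+ d * t ^+ d by rewrite exprMn.
exists x; split => //.
  have eb : beta = C1 * We / s ^+ d + C1 / s ^+ d by rewrite /beta; ring.
  have Cs : 0 < C1 / s ^+ d by rewrite divr_gt0 // (lt_le_trans _ sd).
  have -> : (2 * We + 1) * C1 / lambda ^+ d / t ^+ d = 2 * (C1 * We / s ^+ d) + C1 / s ^+ d.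
    by rewrite sdE invfM; ring.
  by move: small; rewrite ler_norml ex eb; lra.
move=> i.
have -> : (int_coords w x 0 i)%:~R = ratr (coords b x (lift ord0 i) 0) :> R.
  rewrite mxE -ratr_int numqK //.
  by move/in_latticeP: xi => /(_ (lift ord0 i)).
rewrite cx v_lift addrAC subrr sub0r normrN.
rewrite (le_trans (ler_norm_sum _ _ _)) //.
have -> : rho * t = \sum_(j < d.+1) M * (C1 * W) * s.
  rewrite sumr_const card_ord -[_ *+ _]mulr_natl mulrA -/C2 /s /lambda.
  by field; rewrite gt_eqF.
apply: ler_sum => j _; rewrite normrM; apply: le_trans (AE (lift ord0 i) j).
by rewrite ler_piMr.
Qed.

Definition box_elt n (v : {ffun 'I_d.+1 -> 'I_n.*2.+1}) : Phi :=
  lattice_elt w (fun k => (v k : nat)%:Z - n%:Z).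

Lemma bounded_lattice_box (N : R) : exists n, forall x, in_lattice b x ->
  (forall i, cabs (sigma i x) <= N) -> exists v, x = @box_elt n v.
Proof.
have [M M0 hM] := coords_bounded.
pose n := (Num.truncn (M * N)).+1; exists n => x xi xN.
have [z xz] := in_latticeE hb xi.
have zn k : `|(z k)%:~R : R| <= n%:R.
  have := hM x N xN k; rewrite xz (coords_lattice_elt hb) ratr_int => /le_trans; apply.
  exact: ltW (truncnS_gt _).
have ge0 k : 0 <= z k + n%:Z.
  by rewrite -(ler0z R) intrD -pmulrn; have := zn k; rewrite ler_norml; lra.
have lt k : (absz (z k + n%:Z)%R < n.*2.+1)%N.
  rewrite -ltz_nat gez0_abs // -(ltr_int R) intrD -!pmulrn -addn1 natrD -mul2n natrM.
  by have := zn k; rewrite ler_norml; lra.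
exists [ffun k => Ordinal (lt k)]; rewrite xz /box_elt; apply: eq_bigr => k _.
by rewrite ffunE /= gez0_abs // addrK.
Qed.

Variables (K : set 'rV[R]_d) (B : R).
Hypothesis B1 : 1 <= B.
Hypothesis KB : forall v, K v -> forall i, `|v 0 i| <= B - 1.
Variables (p : 'rV[R]_d) (rho : R).
Hypothesis rho0 : 0 < rho.
Hypothesis pK : forall v : 'rV[R]_d, (forall i, `|v 0 i - p 0 i| <= rho) -> K v.

(** For small [t] the bound comes from the element [1], which does not move [m]
    at all. *)
Lemma gap_small : exists2 C : R, 0 <= C & forall t e m x, 1 <= t -> K (real_point t m) ->
  gap K w emb t e m x -> emb x <= C / t ^+ d.
Proof.
have [C [T0 [T01 near]]] := lattice_near rho0.
exists (`|C| + T0 ^+ d) => [|t e m x t1 Km [xi _ xmin]].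
  by rewrite addr_ge0 // exprn_ge0 //; lra.
have t0 : 0 < t by apply: lt_le_trans t1.
have td0 : 0 < t ^+ d by rewrite exprn_gt0.
have [tT|Tt] := leP T0 t.
  have [x0 [x0i /andP[ex0 ex0C] x0q]] := near t (fun i => (-1) ^+ (~~ e) * (t * p 0 i - (m 0 i)%:~R)) tT.
  apply: le_trans (xmin x0 x0i _) _.
    rewrite /admissible ex0 /=; apply/mem_set/pK => i; have := x0q i.
    set a := (int_coords w x0 0 i)%:~R => h.
    have -> : real_point t (m + (-1) ^+ (~~ e) *: int_coords w x0) 0 i - p 0 i
        = t^-1 * ((-1) ^+ (~~ e) * (a - (-1) ^+ (~~ e) * (t * p 0 i - (m 0 i)%:~R))).
      rewrite 4!mxE intrD intrM rmorphXn rmorphN1 -/a.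
      by case: (e); rewrite /= ?expr0 ?expr1; field; rewrite gt_eqF.
    rewrite normrM gtr0_norm ?invr_gt0 // normrM normrX normrN1 expr1n mul1r.
    by rewrite mulrC ler_pdivrMr.
  apply: (le_trans ex0C); rewrite ler_pM2r ?invr_gt0 //.
  apply: le_trans (ler_norm C) _; rewrite lerDl exprn_ge0 //; lra.
have x1 : in_lattice b 1.
  by have := in_lattice_elt hb (fun k => ((k == ord0) : nat)%:Z); congr (in_lattice b _);
    rewrite lattice_elt_recl /= big1 ?addr0 // => i _; rewrite mul0r.
apply: le_trans (xmin 1 x1 _) _.
  rewrite /admissible rmorph1 ltr01 /=; apply/mem_set.
  have -> : int_coords w 1 = 0.
    apply/rowP => i; have := coords_basis hb ord0; rewrite tnth0 => e1.
    by rewrite mxE e1 !mxE.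
  by rewrite scaler0 addr0.
rewrite rmorph1 ler_pdivlMr // mul1r; apply: le_trans (_ : T0 ^+ d <= _).
  by apply: lerXn2r; rewrite ?nnegrE; lra.
by rewrite lerDr.
Qed.

(** Dividing a gap by the unit of its scale leaves a lattice element with
    bounded conjugates, that is one of finitely many. *)
Lemma gap_candidates : exists n, forall t e m x, 1 <= t -> K (real_point t m) ->
  gap K w emb t e m x -> exists v, x = u t * @box_elt n v.
Proof.
have [C C0 hC] := gap_small.
pose S := \sum_i \sum_(j < d) cabs (sigma i (tnth w j) - (emb (tnth w j))%:C%C).
have S0 : 0 <= S by do 2![apply: sumr_ge0 => ? _]; apply: cabs_ge0.
have B0 : 0 <= B by apply: le_trans B1.
have BS0 : 0 <= 2 * B * S by rewrite !mulr_ge0.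
have CBS0 : 0 <= C + 2 * B * S by rewrite addr_ge0.
pose N := (C + 2 * B * S) * C1.
have [n hn] := bounded_lattice_box N.
exists n => t e m x t1 Km gx; have [xi /andP[ex0 Kx] _] := gx.
have t0 : 0 < t by apply: lt_le_trans t1.
have td : 1 <= t ^+ d by rewrite exprn_ege1.
have td0 : 0 < t ^+ d by rewrite exprn_gt0.
have exC := hC t e m x t1 Km gx.
have [uU eu0] := hu t0; have [/andP[eus _] us] := usize t0.
have [v xv] : exists v, (u t)^-1 * x = @box_elt n v.
  apply: hn; first by apply: lattice_unit_in => //; apply: lattice_unitV.
  move=> i; rewrite rmorphM fmorphV cabsM cabsV.
  have [->|ii0] := eqVneq i i0.
    rewrite !s0 !cabs_real !gtr0_norm // mulrC ler_pdivrMr //.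
    apply: (le_trans exC); rewrite ler_pdivrMr // -mulrA.
    apply: le_trans (_ : (C + 2 * B * S) * 1 <= _); first by lra.
    rewrite /N -[_ * C1 * _]mulrA; apply: ler_wpM2l => //.
    by rewrite -[leLHS](@mulfV _ C1) ?gt_eqF // ler_pM2l.
  have /andP[us1 _] := us i ii0.
  have us0 : 0 < cabs (sigma i (u t)).
    by apply: cabs_gt0; rewrite fmorph_eq0 (lattice_unit_neq0 uU).
  rewrite mulrC ler_pdivrMr //.
  have xle : cabs (sigma i x) <= (C + 2 * B * S) * t.
    have [z xz] := in_latticeE hb xi.
    rewrite xz (sigma_lattice_elt w emb) -xz (le_trans (cabsD _ _)) // mulrDl; apply: lerD.
      rewrite cabs_real gtr0_norm //; apply: (le_trans exC).
      apply: le_trans (_ : C <= _); first by rewrite ler_pdivrMr // ler_peMr.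
      by rewrite ler_peMr.
    apply: le_trans (cabs_sum _) _.
    have zt j : `|(z (lift ord0 j))%:~R : R| <= 2 * B * t.
      have rB m' : K (real_point t m') -> - (B * t) <= (m' 0 j)%:~R <= B * t.
        move=> /KB /(_ j); rewrite !mxE normrM gtr0_norm ?invr_gt0 // mulrC ler_pdivrMr //.
        have : (B - 1) * t <= B * t by rewrite ler_pM2r //; lra.
        by rewrite ler_norml; lra.
      have := rB _ Km; have := rB _ (set_mem Kx).
      rewrite xz (int_coords_elt hb) !mxE intrD intrM ler_norml.
      by case: (e); rewrite /= ?expr0 ?expr1 ?rmorph1 ?rmorphN1 ?mul1r ?mulN1r; lra.
    apply: le_trans (_ : 2 * B * t * \sum_(j < d) cabs (sigma i (tnth w j) - (emb (tnth w j))%:C%C) <= _).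
      rewrite mulr_sumr; apply: ler_sum => j _; rewrite cabsM; apply: ler_wpM2r; first exact: cabs_ge0.
      by rewrite -(rmorph_int (real_complex R)) cabs_real.
    have -> : 2 * B * S * t = 2 * B * t * S by ring.
    apply: ler_wpM2l; first by rewrite !mulr_ge0 // ltW.
    apply: (@ler_sum_term R _ (fun i => \sum_(j < d)
      cabs (sigma i (tnth w j) - (emb (tnth w j))%:C%C))) => i'.
    by apply: sumr_ge0 => ? _; apply: cabs_ge0.
  apply: (le_trans xle); rewrite /N -[_ * C1 * _]mulrA; apply: ler_wpM2l => //.
  by rewrite mulrC -ler_pdivrMr // mulrC.
exists v; rewrite -xv mulVKf //; exact: lattice_unit_neq0 uU.
Qed.

End Candidates.

(** * Functions on the torus *)

Section CircleFunctions.
Variable R : realType.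

Lemma repr_to_circle (x : R) : exists k : int, repr (to_circle x) = x + k%:~R.
Proof.
have : \pi_(circle R)%qT (repr (to_circle x)) = \pi_(circle R)%qT x by rewrite reprK.
move=> /eqP; rewrite -ring_quotient.Quotient.idealrBE => /intrP[k e].
by exists k; rewrite -e addrC subrK.
Qed.

Lemma polar_repr (l x s : R) : polar l (repr (to_circle x) + s) = polar l (x + s).
Proof. by have [k ->] := repr_to_circle x; rewrite addrAC polarDz. Qed.

Lemma circle_dist_ge0 (a a' : circle R) : 0 <= circle_dist a a'.
Proof.
apply: lb_le_inf; last by move=> e [x [y [_ _ ->]]].
by exists `|repr a - repr a'|, (repr a), (repr a'); split; rewrite // /to_circle reprK.
Qed.

(** The angles may be computed from any representatives, and the bound obtained
    for all of them passes to the infimum defining the distance. *)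
Lemma polar_circle_lip (L l l' s s' : R) (a a' : circle R) : l <= L -> l' <= L ->
  cabs (polar l (repr a + s) - polar l' (repr a' + s'))
    <= 2 * expR L * (`|l - l'| + 2 * pi * (circle_dist a a' + `|s - s'|)).
Proof.
move=> lL lL'.
have c0 : 0 < 2 * expR L by rewrite mulr_gt0 ?expR_gt0.
have p0 : 0 < 2 * pi :> R by rewrite mulr_gt0 ?pi_gt0.
set X := cabs _; set A := `|l - l'|; set S := `|s - s'|.
set c := 2 * expR L in c0 *; set P := 2 * pi in p0 *.
have solve (Y : R) : ((X / c - A) / P - S <= Y) = (X <= c * (A + P * (Y + S))).
  by rewrite lerBlDr ler_pdivrMr // lerBlDl ler_pdivrMr // mulrC [P * _]mulrC.
rewrite -solve; apply: lb_le_inf.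
  by exists `|repr a - repr a'|, (repr a), (repr a'); split; rewrite // /to_circle reprK.
move=> e [x [y [xa ya ->]]]; rewrite solve.
rewrite /X -xa -ya !polar_repr.
apply: le_trans (polar_lip _ _ lL lL') _.
rewrite ler_pM2l // lerD2l ler_pM2l //.
have -> : x + s - (y + s') = (x - y) + (s - s') by ring.
exact: ler_normD.
Qed.

Lemma expRN1_powR (t : R) : 0 < t -> expR (-1) `^ ln t = t^-1.
Proof.
by move=> t0; rewrite /powR gt_eqF ?expR_gt0 // expRK mulrN1 expRN lnK.
Qed.

End CircleFunctions.

(** * Ratios of neighbouring gaps from membership patterns *)

Section Selection.
Variables (R : realType) (d : nat) (K : set 'rV[R]_d) (B : R).
Hypothesis B1 : 1 <= B.
Hypothesis KB : forall v, K v -> forall i, `|v 0 i| <= B - 1.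
Variables (Phi : fieldExtType rat) (w : d.-tuple Phi).
Let b : d.+1.-tuple Phi := [tuple of 1 :: w].
Hypothesis hb : basis_of fullv b.
Variables (emb : {rmorphism Phi -> R}) (omega : 'rV[R]_d).
Hypothesis homega : forall i : 'I_d, omega 0 i = emb (tnth w i).
Variable n : nat.

Local Notation T := {ffun 'I_d.+1 -> 'I_n.*2.+1}.
Local Notation F := (@box_elt d Phi w n).

(** The default value [1] never occurs for patterns that come from a gap. *)
Definition least_candidate (g : pred T) : Phi :=
  if [pick v | [&& g v, 0 < emb (F v) &
       [forall v', g v' && (0 < emb (F v')) ==> (emb (F v) <= emb (F v'))]]]
  is Some v then F v else 1.

Definition pattern_ratio (f : {ffun T * bool -> bool}) : Phi :=
  least_candidate (fun v => f (v, true)) / least_candidate (fun v => f (v, false)).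

Definition ratio_list : seq Phi :=
  let s := 1 :: [seq F v | v <- enum {: T}] in
  undup [seq x / y | x <- s, y <- s].

Lemma pattern_ratio_in f : pattern_ratio f \in ratio_list.
Proof.
have lc g : least_candidate g \in 1 :: [seq F v | v <- enum {: T}].
  rewrite /least_candidate; case: pickP => [v _|_]; rewrite inE ?eqxx //.
  by rewrite map_f ?orbT // mem_enum.
rewrite mem_undup; apply/allpairsP.
exists (least_candidate (fun v => f (v, true)), least_candidate (fun v => f (v, false))).
by split; rewrite ?lc.
Qed.

Variables (t : R) (ut : Phi).
Hypotheses (t0 : 0 < t) (uU : lattice_units b ut) (u0 : 0 < emb ut).

Definition gap_shift (x : T * bool) : 'rV[R]_d :=
  (-1) ^+ (~~ x.2) *: real_point t (int_coords w (ut * F x.1)).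

Definition pattern_at (m : 'rV[int]_d) : {ffun T * bool -> bool} :=
  [ffun x => real_point t m + gap_shift x \in K].

Lemma real_point_shift m (e : bool) v :
  real_point t (m + (-1) ^+ (~~ e) *: int_coords w (ut * F v)) = real_point t m + gap_shift (v, e).
Proof.
apply/rowP => i; rewrite !mxE intrD intrM rmorphXn rmorphN1 /=; ring.
Qed.

Lemma least_candidate_gap e m x v0 : gap K w emb t e m x -> x = ut * F v0 ->
  ut * least_candidate (fun v => pattern_at m (v, e)) = x.
Proof.
move=> [xi /andP[ex Kx] xmin] xE.
have adm v : pattern_at m (v, e) -> 0 < emb (F v) -> emb (F v0) <= emb (F v).
  rewrite ffunE -real_point_shift => Kv ev.
  rewrite -(ler_pM2l u0) -!rmorphM -xE; apply: xmin.
    by apply: lattice_unit_in => //; apply: in_lattice_elt.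
  by rewrite /admissible rmorphM mulr_gt0.
have ev0 : 0 < emb (F v0) by move: ex; rewrite xE rmorphM pmulr_rgt0.
have gv0 : pattern_at m (v0, e) by rewrite ffunE -real_point_shift -xE.
rewrite /least_candidate; case: pickP => [v /and3P[gv ev /forallP vmin]|/(_ v0)].
  rewrite xE; congr (_ * _); apply: (fmorph_inj emb); apply/eqP.
  by rewrite eq_le adm // andbT; have := vmin v0; rewrite gv0 ev0 /= => ->.
rewrite gv0 ev0 /= => /negbT /negP []; apply/forallP => v; apply/implyP => /andP[gv ev].
exact: adm.
Qed.

Hypothesis cand : forall e m x, K (real_point t m) -> gap K w emb t e m x ->
  exists v, x = ut * F v.

Local Notation pts := (ordered_points K omega t).

Lemma spacing_ratio_pattern i : (2 <= i <= (npoints K t).-1)%N ->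
  spacing_ratio K omega t i = emb (pattern_ratio (pattern_at (nth 0 pts i.-1))).
Proof.
case: i => [//|[//|j]] /= jn.
have lt1 : (j.+2 < npoints K t)%N by case: (npoints K t) jn.
have lt0 : (j.+1 < npoints K t)%N by apply: ltnW.
have Km : K (real_point t (nth 0 pts j.+1)).
  by apply: set_mem; rewrite -(mem_ordered B1 KB omega t0) mem_nth // size_ordered.
have [x gx ex] := gap_exists B1 KB hb homega t0 true lt1.
have [y gy ey] := gap_exists B1 KB hb homega t0 false lt0.
rewrite /spacing_ratio /spacing /frac_point /= -ex -ey.
have [vx xE] := cand Km gx; have [vy yE] := cand Km gy.
rewrite -(least_candidate_gap gx xE) -(least_candidate_gap gy yE).
rewrite /pattern_ratio !rmorphM fmorphV invfM mulrACA divff ?mul1r //.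
by rewrite gt_eqF.
Qed.

Lemma count_spacing_ratio r : (2 < npoints K t)%N ->
  let p := count (fun i => spacing_ratio K omega t i == emb r) (index_iota 2 (npoints K t)) in
  let q := count (fun m => pattern_ratio (pattern_at m) == r) (lattice_fset K t) in
  (p <= q)%N /\ (q <= p + 2)%N.
Proof.
move=> n2 p q.
pose a m := pattern_ratio (pattern_at m) == r.
have sz := size_ordered K omega t.
have qE : q = count a pts by rewrite /pts; apply/esym/permP; rewrite perm_sort.
set N := npoints K t in n2 p sz *.
have pE : p = count a (take (N - 2) (drop 1 pts)).
  rewrite -(map_nth_iota 0) ?sz; last by rewrite leq_sub2l.
  rewrite /p /index_iota (iotaDl 1 1) !count_map; apply: eq_in_count => i.
  rewrite mem_iota => /andP[i1 i2] /=.
  rewrite spacing_ratio_pattern; last by rewrite -/N; lia.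
  by rewrite (inj_eq (fmorph_inj emb)).
have split_pts : pts = take 1 pts ++ (take (N - 2) (drop 1 pts) ++ drop (N - 2) (drop 1 pts)).
  by rewrite !cat_take_drop.
have c1 : (count a (take 1 pts) <= 1)%N.
  by apply: leq_trans (count_size _ _) _; rewrite size_take; case: ltnP.
have c2 : (count a (drop (N - 2) (drop 1 pts)) <= 1)%N.
  by apply: leq_trans (count_size _ _) _; rewrite !size_drop sz; lia.
have -> : q = (count a (take 1 pts) + (p + count a (drop (N - 2) (drop 1 pts))))%N.
  by rewrite qE {1}split_pts !count_cat -pE.
by split; lia.
Qed.

End Selection.

(** * The translation vectors as functions on the torus and the cube *)

Section FlowShift.
Variables (R : realType) (d : nat) (Phi : fieldExtType rat) (w : d.-tuple Phi).
Let b : d.+1.-tuple Phi := [tuple of 1 :: w].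
Hypothesis hb : basis_of fullv b.
Variable emb : {rmorphism Phi -> R}.
Variables (sigma : 'I_d.+1 -> {rmorphism Phi -> R[i]}) (i0 : 'I_d.+1).
Hypothesis Su : embmat b sigma \in unitmx.
Hypothesis s0 : forall x, sigma i0 x = (emb x)%:C%C.
Variables (n r : nat) (beta : 'I_r -> R) (lam phi : 'I_d.+1 -> 'I_r -> R).

Local Notation T := {ffun 'I_d.+1 -> 'I_n.*2.+1}.
Local Notation F := (@box_elt d Phi w n).

Definition flow_coef (x : T * bool) (j : 'I_d) (i : 'I_d.+1) : R[i] :=
  sigma i (F x.1) * invmx (embmat b sigma) (lift ord0 j) i.

(** The polar number stands for [t^-1 * sigma_i (u t)], and the inverse of
    [embmat] recombines conjugates into coordinates. For arbitrary angles the
    sum need not be real, hence the real part. *)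
Definition flow_shift (theta : 'I_d.+1 -> circle R) (y : 'rV[R]_r) (x : T * bool) : 'rV[R]_d :=
  \row_j ((-1) ^+ (~~ x.2) * complex.Re (\sum_(i | i != i0)
    polar (- \sum_l y 0 l * lam i l) (repr (theta i) - \sum_l y 0 l * phi i l)
      * flow_coef x j i)).

Lemma Re_sub (z z' : R[i]) : complex.Re z - complex.Re z' = complex.Re (z - z').
Proof. by case: z; case: z'. Qed.

Lemma flow_coef_bounded : exists2 M : R, 0 <= M &
  forall x j, \sum_i cabs (flow_coef x j i) <= M.
Proof.
exists (\sum_x \sum_j \sum_i cabs (flow_coef x j i)).
  by do 3![apply: sumr_ge0 => ? _]; apply: cabs_ge0.
move=> x j.
apply: le_trans (@ler_sum_term R _ (fun x => \sum_j \sum_i cabs (flow_coef x j i)) x _).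
  apply: (@ler_sum_term R _ (fun j => \sum_i cabs (flow_coef x j i))) => j'.
  by apply: sumr_ge0 => ? _; apply: cabs_ge0.
by move=> x'; do 2![apply: sumr_ge0 => ? _]; apply: cabs_ge0.
Qed.

Lemma flow_shift_lip : exists2 M : R, 0 <= M & forall theta theta' y y',
  unit_cube y -> unit_cube y' -> forall x j,
  `|flow_shift theta y x 0 j - flow_shift theta' y' x 0 j|
    <= M * (\sum_i circle_dist (theta i) (theta' i) + \sum_l `|y 0 l - y' 0 l|).
Proof.
have [M0 M00 hM0] := flow_coef_bounded.
pose La := \sum_i \sum_l `|lam i l|; pose Ph := \sum_i \sum_l `|phi i l|.
have La0 : 0 <= La by do 2![apply: sumr_ge0 => ? _].
have Ph0 : 0 <= Ph by do 2![apply: sumr_ge0 => ? _].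
have pi0 : 0 <= 2 * pi :> R by rewrite mulr_ge0 ?pi_ge0.
pose c := 2 * expR La * (La + 2 * pi * (1 + Ph)).
have c0 : 0 <= c.
  by rewrite /c mulr_ge0 ?mulr_ge0 ?expR_ge0 // addr_ge0 // mulr_ge0 // addr_ge0.
exists (c * M0) => [|theta theta' y y' hy hy' x j]; first by rewrite mulr_ge0.
set CD := \sum_i circle_dist _ _; set Y := \sum_l `|y 0 l - y' 0 l|.
have CD0 : 0 <= CD by apply: sumr_ge0 => i _; apply: circle_dist_ge0.
have Y0 : 0 <= Y by apply: sumr_ge0.
have abs_le (A : 'I_d.+1 -> 'I_r -> R) i l : `|A i l| <= \sum_i \sum_l `|A i l|.
  apply: le_trans (@ler_sum_term R _ (fun i => \sum_l `|A i l|) i _).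
    exact: (@ler_sum_term R _ (fun l => `|A i l|)).
  by move=> ?; apply: sumr_ge0.
have lin (A : 'I_d.+1 -> 'I_r -> R) i :
    `|\sum_l y 0 l * A i l - \sum_l y' 0 l * A i l| <= (\sum_i \sum_l `|A i l|) * Y.
  rewrite -sumrB (le_trans (ler_norm_sum _ _ _)) // mulr_sumr; apply: ler_sum => l _.
  by rewrite -mulrBl normrM mulrC ler_wpM2r.
have bnd (z : 'rV[R]_r) i : unit_cube z -> - \sum_l z 0 l * lam i l <= La.
  move=> hz; rewrite (le_trans (ler_norm _)) // normrN (le_trans (ler_norm_sum _ _ _)) //.
  apply: le_trans (@ler_sum_term R _ (fun i => \sum_l `|lam i l|) i _).
    apply: ler_sum => l _; rewrite normrM; have /andP[z0 z1] := hz l.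
    by rewrite ger0_norm // ler_piMl.
  by move=> ?; apply: sumr_ge0.
rewrite !mxE -mulrBr normrM normrX normrN1 expr1n mul1r Re_sub.
rewrite (le_trans (le_Re_cabs _)) // -sumrB.
apply: le_trans (_ : c * (CD + Y) * \sum_i cabs (flow_coef x j i) <= _); last first.
  have -> : c * M0 * (CD + Y) = c * (CD + Y) * M0 by ring.
  by apply: ler_wpM2l; [exact: mulr_ge0 c0 (addr_ge0 CD0 Y0) | exact: hM0].
rewrite mulr_sumr big_mkcond; apply: le_trans (cabs_sum _) _.
apply: ler_sum => i _; case: ifP => _; last first.
  by rewrite cabs0 mulr_ge0 ?cabs_ge0 // mulr_ge0 // addr_ge0.
rewrite -mulrBl cabsM; apply: ler_wpM2r; first exact: cabs_ge0.
apply: le_trans (polar_circle_lip _ _ _ _ (bnd y i hy) (bnd y' i hy')) _.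
rewrite /c -[X in _ <= X]mulrA ler_wpM2l ?mulr_ge0 ?expR_ge0 //.
have eN (a a' : R) : `|- a - - a'| = `|a - a'| by rewrite -opprD normrN.
rewrite !eN.
have := lin lam i; have := lin phi i; rewrite -/La -/Ph => h1 h2.
have h3 : circle_dist (theta i) (theta' i) <= CD.
  by apply: (@ler_sum_term R _ (fun i => circle_dist (theta i) (theta' i))) => ?; apply: circle_dist_ge0.
have p1 := mulr_ge0 La0 CD0; have p2 := mulr_ge0 pi0 (mulr_ge0 Ph0 CD0).
have p3 := mulr_ge0 pi0 Y0; have p4 := ler_wpM2l pi0 h1; have p5 := ler_wpM2l pi0 h3.
lra.
Qed.

Hypothesis d0 : (0 < d)%N.
Variables (u : R -> Phi) (C1 : R).
Hypothesis C11 : 1 <= C1.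
Hypothesis hu : forall t, 0 < t -> [/\ lattice_units b (u t), 0 < emb (u t) &
   forall i, i != i0 -> sigma i (u t) =
     t%:C%C * polar (- \sum_l frac_part (beta l * ln t) * lam i l)
       ((\sum_l beta l * phi i l) * ln t - \sum_l frac_part (beta l * ln t) * phi i l)].
Hypothesis usize : forall t, 0 < t -> emb (u t) * t ^+ d <= C1.

(** Only the distinguished conjugate is neglected, and it is tiny. *)
Lemma flow_shift_approx : exists2 M : R, 0 <= M & forall t, 1 <= t -> forall x j,
  `|gap_shift w t (u t) x 0 j - flow_shift (fun i => to_circle ((\sum_l beta l * phi i l) * ln t))
        (\row_l frac_part (beta l * ln t)) x 0 j| <= M / t.
Proof.
have [M0 M00 hM0] := flow_coef_bounded.
exists (C1 * M0) => [|t t1 x j].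
  by rewrite mulr_ge0 //; apply: le_trans C11.
have t0 : 0 < t by apply: lt_le_trans t1.
have [uU eu0 us] := hu t0.
have td1 : 1 <= t ^+ d by rewrite exprn_ege1.
have eu : emb (u t) <= C1.
  by apply: le_trans (usize t0); rewrite ler_peMr // ltW.
have xi : in_lattice b (u t * F x.1).
  by apply: lattice_unit_in => //; apply: in_lattice_elt.
have coordE : (int_coords w (u t * F x.1) 0 j)%:~R
   = complex.Re (\sum_i sigma i (u t) * flow_coef x j i) :> R.
  have h : (ratr (coords b (u t * F x.1) (lift ord0 j) 0) : R[i])
     = \sum_i sigma i (u t) * flow_coef x j i.
    rewrite (coords_embmat hb Su); apply: eq_bigr => i _.
    by rewrite /flow_coef rmorphM; ring.
  rewrite -h mxE -[in RHS](numqK (x := coords _ _ _ _)); last by move/in_latticeP: xi.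
  by rewrite ratr_int -(rmorph_int (real_complex R)).
have tE i : i != i0 -> sigma i (u t) * flow_coef x j i = t%:C%C * (polar
   (- \sum_l (\row_l frac_part (beta l * ln t)) 0 l * lam i l)
   (repr (to_circle ((\sum_l beta l * phi i l) * ln t)) -
      \sum_l (\row_l frac_part (beta l * ln t)) 0 l * phi i l) * flow_coef x j i).
  move=> ii0; rewrite us // polar_repr -mulrA; congr (_ * (polar (- _) (_ - _) * _)).
    by apply: eq_bigr => l _; rewrite mxE.
  by apply: eq_bigr => l _; rewrite mxE.
have Re_real (a : R) (z : R[i]) : complex.Re (a%:C%C * z) = a * complex.Re z.
  by case: z => z1 z2 /=; rewrite mul0r subr0.
have -> : gap_shift w t (u t) x 0 j = (-1) ^+ (~~ x.2) * (t^-1 *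
    complex.Re (\sum_i sigma i (u t) * flow_coef x j i)).
  by rewrite -coordE !mxE.
rewrite mxE -mulrBr normrM normrX normrN1 expr1n mul1r.
rewrite (bigD1 i0) //= (eq_bigr _ (fun i ii0 => tE i ii0)) -mulr_sumr.
set S := \sum_(i | _) _.
have -> : t^-1 * complex.Re (sigma i0 (u t) * flow_coef x j i0 + t%:C%C * S) - complex.Re S
   = t^-1 * (emb (u t) * complex.Re (flow_coef x j i0)).
  have -> (z z' : R[i]) : complex.Re (z + z') = complex.Re z + complex.Re z'.
    by case: z; case: z'.
  by rewrite s0 !Re_real; field; rewrite gt_eqF.
rewrite normrM gtr0_norm ?invr_gt0 // mulrC ler_pM2r ?invr_gt0 // normrM gtr0_norm //.
apply: ler_pM => //; first exact: ltW.
rewrite (le_trans (le_Re_cabs _)) // (le_trans _ (hM0 x j)) //.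
by apply: (@ler_sum_term R _ (fun i => cabs (flow_coef x j i))) => i; apply: cabs_ge0.
Qed.

End FlowShift.

(** * Quasiperiodicity of the proportions *)

(** The first and the last point are not the middle of a ratio of spacings, but
    do show a pattern. *)
Lemma proportion_perturb (R : realType) (p q n : nat) : (2 < n)%N -> (q <= n)%N ->
  (p <= q)%N -> (q <= p + 2)%N ->
  `|p%:R / (n - 2)%:R - q%:R / n%:R : R| <= 4 / (n - 2)%:R.
Proof.
move=> n2 qn pq qp.
have nR : n%:R = (n - 2)%:R + 2 :> R by rewrite -[in LHS](subnK (ltnW n2)) natrD.
set m := (n - 2)%:R : R in nR *.
have m0 : 0 < m by rewrite ltr0n subn_gt0.
rewrite nR.
have h1 : p%:R <= q%:R :> R by rewrite ler_nat.
have h2 : q%:R <= p%:R + 2 :> R by rewrite -natrD ler_nat.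
have h3 : q%:R <= m + 2 by rewrite -nR ler_nat.
have h4 : 0 <= p%:R :> R by [].
have m2 : 0 < m + 2 by lra.
have -> : p%:R / m - q%:R / (m + 2) = (2 * p%:R / (m + 2) - (q%:R - p%:R) * m / (m + 2)) / m.
  by field; rewrite !gt_eqF.
rewrite normrM [X in _ * X]gtr0_norm ?invr_gt0 // ler_pM2r ?invr_gt0 //.
rewrite -mulrBl normrM [X in _ * X]gtr0_norm ?invr_gt0 // ler_pdivrMr //.
rewrite ler_norml; apply/andP; split; nra.
Qed.

Lemma bounded_coords (R : realType) d (K : set 'rV[R]_d) : bounded_set K ->
  exists2 B : R, 1 <= B & forall v, K v -> forall i, `|v 0 i| <= B - 1.
Proof.
move=> [M [_ h]]; exists (`|M| + 2) => [|v Kv i]; first by have := normr_ge0 M; lra.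
have lt : M < `|M| + 1 by have := ler_norm M; lra.
have -> : `|M| + 2 - 1 = `|M| + 1 by ring.
apply: le_trans (h _ lt v Kv); rewrite /Num.norm /= mx_normrE.
exact: (le_bigmax _ (fun ij : 'I_1 * 'I_d => `|v ij.1 ij.2|) (0, i)).
Qed.

Lemma interior_cube (R : realType) d (K : set 'rV[R]_d) : K° !=set0 ->
  exists (p : 'rV[R]_d) (rho : R), 0 < rho /\
    forall v : 'rV[R]_d, (forall i, `|v 0 i - p 0 i| <= rho) -> K v.
Proof.
move=> [p]; rewrite /interior /= => /nbhs_ballP [e /= e0 h].
exists p, (e / 2); split; first by rewrite divr_gt0.
move=> v hv; apply: h; split=> // i j.
rewrite (ord1 i) -ball_normE /= distrC; apply: le_lt_trans (hv j) _.
by rewrite ltr_pdivrMr // ltr_pMr // ltr1n.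
Qed.

Theorem theoremB (R : realType) (d : nat) (hd : (1 <= d)%N)
    (K : set 'rV[R]_d) (Kbounded : bounded_set K) (Kconvex : convex_set K)
    (Kinterior : K° !=set0)
    (Phi : fieldExtType rat) (emb : {rmorphism Phi -> R})
    (omega : 'rV[R]_d) (w : d.-tuple Phi)
    (homega : forall i : 'I_d, omega 0 i = emb (tnth w i))
    (hbasis : basis_of fullv (1 :: w))
    (r : nat) (hr1 : (1 <= r)%N) (hr : has_unit_rank Phi r) :
  exists (J : nat) (rs : J.-tuple Phi), uniq rs /\
    (forall (t : R) (i : nat), 1 < t -> (2 <= i <= (npoints K t).-1)%N ->
       exists j : 'I_J, spacing_ratio K omega t i = emb (tnth rs j)) /\
    exists (k : nat) (h : ('I_k -> circle R) -> 'rV[R]_r -> 'rV[R]_J)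
           (theta : 'I_k -> R) (beta : 'I_r -> R) (alpha : R),
      [/\ (k <= d.+1)%N,
          forall x y, unit_cube y -> prob_simplex (h x y),
          lipschitz_torus_cube h,
          0 < alpha < 1 &
          exists C : R, \forall t \near +oo, forall j : 'I_J,
            `|ratio_proportion K omega t (emb (tnth rs j))
              - h (fun i => to_circle (theta i * ln t))
                  (\row_i frac_part (beta i * ln t)) 0 j|
            <= C * alpha `^ ln t].
Proof.
have [B B1 KB] := bounded_coords Kbounded.
have [p [rho [rho0 pK]]] := interior_cube Kinterior.
pose b : d.+1.-tuple Phi := [tuple of 1 :: w].
have hb : basis_of fullv b by [].
have b0 : tnth b ord0 = 1 by rewrite tnth0.
have [sigma Su] := @embmat_exists Phi d b R[i] hb b0.
have [i0 s0'] := embeddings_complete hb b0 Su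
  (real_complex R \o emb : {rmorphism Phi -> R[i]})%FUN.
have s0 x : sigma i0 x = (emb x)%:C%C by exact: s0'.
have [beta [lam [phi [u hu]]]] := unit_flow hd hb Su s0 hr.
have [C1 C11 usize] := unit_flow_size hd hb Su s0 hu.
have hu' t : 0 < t -> lattice_units b (u t) /\ 0 < emb (u t) by move=> /hu[].
have [n cand] := gap_candidates hb Su s0 C11 hu' usize B1 KB rho0 pK.
pose T : finType := {ffun 'I_d.+1 -> 'I_n.*2.+1}.
pose rs := ratio_list w n.
have rsin (f : {ffun T * bool -> bool}) : pattern_ratio w emb f \in rs by exact: pattern_ratio_in.
pose J := size rs.
pose cl (f : {ffun T * bool -> bool}) : 'I_J := Ordinal (etrans (index_mem _ rs) (rsin f)).
have clE (f : {ffun T * bool -> bool}) j : (cl f == j) = (pattern_ratio w emb f == tnth (in_tuple rs) j).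
  rewrite (tnth_nth 0) /=; apply/eqP/eqP => [<-|e]; first by rewrite /= nth_index.
  by apply: val_inj => /=; rewrite e index_uniq ?undup_uniq.
exists J, (in_tuple rs); split; first exact: undup_uniq.
have candt t : 1 <= t -> forall e m x, K (real_point t m) -> gap K w emb t e m x ->
    exists v : T, x = u t * box_elt w v.
  by move=> t1 e m x Km gx; apply: cand t1 Km gx.
split.
  move=> t i t1 hi; have t0 : 0 < t by apply: lt_trans t1.
  have [uU eu0] := hu' t t0.
  exists (cl (pattern_at K w n t (u t) (nth 0 (ordered_points K omega t) i.-1))).
  rewrite (spacing_ratio_pattern B1 KB hb homega t0 uU eu0 (candt t (ltW t1)) hi).
  congr (emb _); apply/eqP; rewrite -clE; exact: eqxx.
have [H [L [Hs HL Hc]]] := pattern_frequency Kconvex hd B1 KB rho0 pK cl.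
have [M1 M10 hM1] := flow_shift_lip w sigma i0 n lam phi.
have usize' t : 0 < t -> emb (u t) * t ^+ d <= C1 by move=> /usize[/andP[]].
have [M2 M20 hM2] := flow_shift_approx hb Su s0 n C11 hu usize'.
have [C2 hC2] := Hc M2 M20.
exists d.+1, (fun theta y => H (flow_shift w sigma i0 lam phi theta y)),
  (fun i => \sum_l beta l * phi i l), beta, (expR (-1)); split=> //.
- exists (`|L| * (#|{: T * bool}|%:R * M1)) => theta theta' y y' hy hy' j.
  set D := \sum_i _ + _.
  have D0 : 0 <= D.
    by apply: addr_ge0; apply: sumr_ge0 => i _ //; apply: circle_dist_ge0.
  apply: le_trans (HL _ _ (fun=> M1 * D) _ _ j) _.
  + by move=> x i; apply: hM1.
  + by move=> x; apply: mulr_ge0.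
  have -> : \sum_(x : T * bool) M1 * D = #|{: T * bool}|%:R * M1 * D.
    by rewrite sumr_const -[RHS]mulrA [RHS]mulr_natl.
  rewrite -[X in _ <= X]mulrA.
  by apply: ler_wpM2r; [rewrite !mulr_ge0 | exact: ler_norm].
- by rewrite expR_gt0 expR_lt1 ltrN10.
pose c0 := (rho / 2) ^+ d.
have c00 : 0 < c0 by rewrite exprn_gt0 // divr_gt0.
(* [8 / c0] accounts for the two extreme points, [C2] for the patterns. *)
exists (8 / c0 + C2).
near=> t.
have t1 : 1 <= t by near: t; apply: nbhs_pinfty_ge; rewrite num_real.
have tr : 2 / rho <= t by near: t; apply: nbhs_pinfty_ge; rewrite num_real.
have tc : 4 / c0 <= t by near: t; apply: nbhs_pinfty_ge; rewrite num_real.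
have t0 : 0 < t by apply: lt_le_trans t1.
have rt : 2 <= rho * t by rewrite mulrC -ler_pdivrMr.
have ct : 4 <= c0 * t by rewrite mulrC -ler_pdivrMr.
move=> j; rewrite expRN1_powR //.
have [uU eu0] := hu' t t0.
pose c := gap_shift w t (u t) : T * bool -> 'rV[R]_d.
have [_ hj] := hC2 t c _ t1 rt (hM2 t t1).
have cntE : count (fun m => pattern_ratio w emb (pattern_at K w n t (u t) m) == tnth (in_tuple rs) j)
    (lattice_fset K t) = pattern_count K B t c (fun f => cl f == j).
  rewrite /pattern_count -(count_lattice_fset B1 KB (S := pattern_set K c (fun f => cl f == j))) //.
    apply: eq_in_count => m mL; rewrite /pattern_set clE.
    by rewrite -(mem_lattice_fset B1 KB m t0) mL.
  by move=> v /andP[/set_mem].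
have nE : npoints K t = pattern_count K B t c xpredT.
  rewrite /pattern_count -(count_lattice_fset B1 KB (S := pattern_set K c xpredT)) //.
    rewrite /npoints -count_predT; apply: eq_in_count => m mL; rewrite /pattern_set andbT.
    by rewrite -(mem_lattice_fset B1 KB m t0) mL.
  by move=> v /andP[/set_mem].
have nge : c0 * t <= (npoints K t)%:R.
  rewrite nE; apply: le_trans (convex_count_ge B1 KB c rho0 pK rt t0).
  by rewrite -/c0 ler_pM2l // ler_eXnr.
have n2 : (2 < npoints K t)%N.
  by rewrite -(ltr_nat R); apply: lt_le_trans nge; apply: lt_le_trans ct; rewrite ltr_nat.
have [pq qp] := count_spacing_ratio B1 KB hb homega t0 uU eu0 (candt t t1) (tnth (in_tuple rs) j) n2.
rewrite /ratio_proportion.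
set pc := count _ (index_iota _ _) in pq qp *; rewrite cntE in pq qp.
rewrite size_iota.
have := hj j; rewrite -cntE -nE cntE => hj'.
have qn : (pattern_count K B t c (fun f => cl f == j) <= npoints K t)%N.
  by rewrite -cntE; apply: count_size.
have h1 := proportion_perturb R n2 qn pq qp.
set q := _%:R / (npoints K t)%:R in hj' h1.
have m0 : c0 * t / 2 <= (npoints K t - 2)%:R.
  by rewrite natrB 1?ltnW //; lra.
have h2 : 4 / (npoints K t - 2)%:R <= 8 / c0 / t.
  have ct0 : 0 < c0 * t by apply: lt_le_trans ct.
  have mm : 0 < (npoints K t - 2)%:R :> R by apply: lt_le_trans m0; rewrite divr_gt0.
  have -> : 8 / c0 / t = 4 / (c0 * t / 2) by field; rewrite !gt_eqF.
  by rewrite ler_pM2l // lef_pV2 ?posrE // divr_gt0.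
rewrite [_ * t^-1]mulrDl; apply: le_trans (lerD (le_trans h1 h2) hj').
apply: le_trans (ler_normD _ _); rewrite addrA subrK; exact: lexx.
Unshelve. all: by end_near.
Qed.
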